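(* Let $n>0$ be even. Let $V$ be an abelian group and $f\colon[S^{n-1}\times S^n,S^n_{\mathbb Q}]\to V$ be an invariant of finite degree. Then $f(\bar u(q))=f(\bar u(0))$ for all $q\in\mathbb Z$.
   Context: $\mathbb N=\{0,1,2,\dots\}$. ''Space'' means pointed topological space; ''map'' means basepoint-preserving continuous map; homotopies are pointed and $[X,Y]$ is the set of pointed homotopy classes of maps $X\to Y$. For a space $X$, $C_0(X)$ denotes the free abelian group on all points of $X$. A map $a\colon X\to Y$ and a number $r\in\mathbb N$ give the Cartesian power $a^r\colon X^r\to Y^r$ and the induced homomorphism $C_0(a^r)\colon C_0(X^r)\to C_0(Y^r)$. For an abelian group $V$, a function $f\colon[X,Y]\to V$ (called an invariant) has degree at most $r$ if and only if there is a homomorphism of abelian groups $l\colon\operatorname{Hom}(C_0(X^r),C_0(Y^r))\to V$ such that $f([a])=l(C_0(a^r))$ for all maps $a\colon X\to Y$. It has finite degree if it has degree at most $r$ for some $r\in\mathbb N$. For even $n>0$: let $c\colon S^{n-1}\times S^n\to S^{2n-1}$ be a map of degree $1$; put $i=[\mathrm{id}]\in\pi_n(S^n)$, let $j=i*i\in\pi_{2n-1}(S^n)$ be the Whitehead square of $i$, and put $u(q)=(qj)\circ[c]\in[S^{n-1}\times S^n,S^n]$ for $q\in\mathbb Z$. Let $l\colon S^n\to S^n_{\mathbb Q}$ be the rationalization and put $\bar u(q)=[l]\circ u(q)\in[S^{n-1}\times S^n,S^n_{\mathbb Q}]$. *)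

(* Defs.v *)
From HB Require Import structures.
From mathcomp Require Import all_boot all_order all_algebra.
From mathcomp Require Import generic_quotient.
From mathcomp Require Import all_classical reals topology normedtype realfun.
From mathcomp Require Import freeg.
From mathcomp Require Import ring lra.

Set Implicit Arguments.
Unset Strict Implicit.
Unset Printing Implicit Defensive.

Import Order.TTheory GRing.Theory Num.Theory.
Import numFieldNormedType.Exports.

Local Open Scope classical_set_scope.
Local Open Scope ring_scope.
Local Open Scope quotient_scope.

Lemma cts_pair (X Y Z : topologicalType) (f : X -> Y) (g : X -> Z) :
  continuous f -> continuous g -> continuous (fun x => (f x, g x)).
Proof.
by move=> cf cg x; exact: (cvg_pair (cf x) (cg x)).
Qed.

Lemma cts_comp (X Y Z : topologicalType) (f : X -> Y) (g : Y -> Z) :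
  continuous f -> continuous g -> continuous (fun x => g (f x)).
Proof.
move=> cf cg x; apply: (@continuous_comp _ _ _ f g); first exact: cf.
exact: cg.
Qed.

Lemma cts_fst (X Y : topologicalType) : continuous (@fst X Y).
Proof. by move=> [x y]; exact: cvg_fst. Qed.

Lemma cts_snd (X Y : topologicalType) : continuous (@snd X Y).
Proof. by move=> [x y]; exact: cvg_snd. Qed.

Lemma cts_cst (X Y : topologicalType) (y : Y) : continuous (fun _ : X => y).
Proof. by move=> x; exact: cvg_cst. Qed.

Lemma cts_add (R : realType) (X : topologicalType) (f g : X -> R) :
  continuous f -> continuous g -> continuous (fun x => f x + g x).
Proof. by move=> cf cg x; apply: cvgD; [exact: cf|exact: cg]. Qed.

Lemma cts_sub (R : realType) (X : topologicalType) (f g : X -> R) :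
  continuous f -> continuous g -> continuous (fun x => f x - g x).
Proof. by move=> cf cg x; apply: cvgB; [exact: cf|exact: cg]. Qed.

Lemma cts_mul (R : realType) (X : topologicalType) (f g : X -> R) :
  continuous f -> continuous g -> continuous (fun x => f x * g x).
Proof. by move=> cf cg x; apply: cvgM; [exact: cf|exact: cg]. Qed.

Lemma cts_norm (R : realType) (X : topologicalType) (f : X -> R) :
  continuous f -> continuous (fun x => `|f x|).
Proof. by move=> cf; apply: cts_comp cf _; exact: norm_continuous. Qed.

Lemma cts_sqrt (R : realType) (X : topologicalType) (f : X -> R) :
  continuous f -> continuous (fun x => Num.sqrt (f x)).
Proof. by move=> cf; apply: cts_comp cf _; exact: sqrt_continuous. Qed.

Lemma cts_max (R : realType) (X : topologicalType) (f g : X -> R) :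
  continuous f -> continuous g -> continuous (fun x => Num.max (f x) (g x)).
Proof. by move=> cf cg x; apply: continuous_max; [exact: cf|exact: cg]. Qed.

Lemma cts_min (R : realType) (X : topologicalType) (f g : X -> R) :
  continuous f -> continuous g -> continuous (fun x => Num.min (f x) (g x)).
Proof. by move=> cf cg x; apply: continuous_min; [exact: cf|exact: cg]. Qed.

Lemma cts_inv (R : realType) (X : topologicalType) (f : X -> R) :
  (forall x, f x != 0) -> continuous f -> continuous (fun x => (f x)^-1).
Proof. by move=> f0 cf x; apply: cvgV; [exact: f0|exact: cf]. Qed.

Lemma cts_paste (R : realType) (X Y : topologicalType) (h : X -> R)
    (f g : X -> Y) :
  continuous h -> continuous f -> continuous g ->
  (forall x, h x = 0 -> f x = g x) ->
  continuous (fun x => if 0 <= h x then f x else g x).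
Proof.
move=> ch cf cg fg; apply/continuous_subspace_setT.
have -> : [set: X] = [set x | 0 <= h x] `|` [set x | h x <= 0].
  apply/seteqP; split=> // x _ /=.
  by case: (lerP 0 (h x)) => [?|/ltW ?]; [left|right].
apply: withinU_continuous.
- apply: (@preimage_closed _ _ h [set y | 0 <= y]); last exact: closed_ge.
  by move=> x _; exact: ch.
- apply: (@preimage_closed _ _ h [set y | y <= 0]); last exact: closed_le.
  by move=> x _; exact: ch.
- have cf' : {within [set x | 0 <= h x], continuous f}.
    exact: continuous_subspaceT.
  apply: subspace_eq_continuous cf' => x /set_mem /= hx.
  by rewrite /from_subspace /= hx.
- have cg' : {within [set x | h x <= 0], continuous g}.
    exact: continuous_subspaceT.
  apply: subspace_eq_continuous cg' => x /set_mem /= hx.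
  rewrite /from_subspace /=; case: ifP => // hx'.
  by apply/esym/fg/le_anti; rewrite hx hx'.
Qed.

Lemma cts_row (R : realType) (X : topologicalType) m
    (F : X -> 'I_m -> R) :
  (forall i, continuous (F ^~ i)) ->
  continuous (fun x => \row_(i < m) F x i : 'rV[R]_m).
Proof.
move=> cF x A [P Px sPA].
have : \forall y \near x, forall i, P 0 i (F y i).
  apply: filter_forall => i; have := Px 0 i; rewrite mxE; exact: cF.
apply: filterS => y Py; apply: sPA => i j; rewrite mxE ord1; exact: Py.
Qed.

Lemma cts_sum (R : realType) (X : topologicalType) (I : Type)
    (r : seq I) (F : I -> X -> R) :
  (forall i, continuous (F i)) -> continuous (fun x => \sum_(i <- r) F i x).
Proof.
move=> cF; elim: r => [|i r IH].
  by under eq_fun do rewrite big_nil; exact: cts_cst.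
by under eq_fun do rewrite big_cons; apply: cts_add.
Qed.

Lemma cts_set_type (X Y : topologicalType) (A : set Y) (f : X -> A) :
  continuous (fun x => val (f x)) -> continuous f.
Proof. by move=> cf; apply: continuous_comp_initial. Qed.

(* Makes X * Y, based at (point, point), a ptopologicalType. *)
HB.instance Definition _ (X Y : ptopologicalType) := Pointed.on (X * Y)%type.

Record pointed_map (X Y : ptopologicalType) := PMap {
  pmap_fun :> X -> Y;
  pmap_cts : continuous pmap_fun;
  pmap_pt : pmap_fun point = point
}.

HB.instance Definition _ (X Y : ptopologicalType) :=
  gen_eqMixin (pointed_map X Y).
HB.instance Definition _ (X Y : ptopologicalType) :=
  gen_choiceMixin (pointed_map X Y).

HB.instance Definition _ (X Y : ptopologicalType) (f : pointed_map X Y) :=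
  isContinuous.Build X Y (pmap_fun f) (@pmap_cts X Y f).

Definition pointed_id (X : ptopologicalType) : pointed_map X X :=
  @PMap X X idfun (@cts_fun X X idfun) erefl.

Definition pointed_const (X Y : ptopologicalType) : pointed_map X Y :=
  @PMap X Y (cst point) (@cts_fun X Y (cst point)) erefl.

Lemma pointed_comp_pt (X Y Z : ptopologicalType)
    (g : pointed_map Y Z) (f : pointed_map X Y) :
  (g \o f) point = point.
Proof. by rewrite /= !pmap_pt. Qed.

Definition pointed_comp (X Y Z : ptopologicalType)
    (g : pointed_map Y Z) (f : pointed_map X Y) : pointed_map X Z :=
  @PMap X Z (g \o f) (@cts_fun X Z (g \o f)) (pointed_comp_pt g f).

(* H is only required to be continuous on X x [0, 1]. *)
Definition homotopic (R : realType) (X Y : ptopologicalType)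
    (f g : pointed_map X Y) : Prop :=
  exists H : X * R -> Y,
    [/\ {within [set xt | 0 <= xt.2 <= 1], continuous H},
        forall x, H (x, 0) = f x,
        forall x, H (x, 1) = g x &
        forall t, 0 <= t <= 1 -> H (point, t) = point].
Arguments homotopic R {X Y}.

Definition clamp (R : realType) (t : R) : R := Num.max 0 (Num.min 1 t).

Lemma clamp_itv (R : realType) (t : R) : 0 <= clamp t <= 1.
Proof.
by rewrite /clamp le_max lexx /= ge_max ler01 /= ge_min lexx.
Qed.

Lemma clamp_id (R : realType) (t : R) : 0 <= t <= 1 -> clamp t = t.
Proof. by case/andP=> t0 t1; rewrite /clamp (min_idPr t1) (max_idPr t0). Qed.

Lemma cts_clamp (R : realType) (X : topologicalType) (f : X -> R) :
  continuous f -> continuous (fun x => clamp (f x)).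
Proof.
by move=> cf; apply: cts_max; [exact: cts_cst|apply: cts_min => //; exact: cts_cst].
Qed.

Lemma homotopicP (R : realType) (X Y : ptopologicalType) (f g : pointed_map X Y) :
  homotopic R f g <->
  exists H : X * R -> Y,
    [/\ continuous H, forall x, H (x, 0) = f x, forall x, H (x, 1) = g x &
        forall t, H (point, t) = point].
Proof.
split=> -[H [cH H0 H1 Hp]]; last first.
  by exists H; split=> //; exact: continuous_subspaceT.
exists (fun xt => H (xt.1, clamp xt.2)).
split=> [|x|x|t] /=; last 3 first.
- by rewrite clamp_id ?lexx ?ler01.
- by rewrite clamp_id ?lexx ?ler01.
- by apply: Hp; exact: clamp_itv.
pose A := [set xt : X * R | 0 <= xt.2 <= 1].
pose phi (xt : X * R) : A :=
  exist _ (xt.1, clamp xt.2) (mem_set (clamp_itv xt.2 : A (xt.1, clamp xt.2))).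
have cphi : continuous phi.
  apply: cts_set_type; apply: cts_pair; first exact: cts_fst.
  by apply: cts_clamp; exact: cts_snd.
have /subspace_sigL_continuousP cHA := cH.
exact: cts_comp cphi cHA.
Qed.

Lemma homotopic_refl (R : realType) (X Y : ptopologicalType) (f : pointed_map X Y) :
  homotopic R f f.
Proof.
apply/homotopicP; exists (fun xt => f xt.1); split=> // [|t]; last exact: pmap_pt.
by apply: cts_comp; [exact: cts_fst|exact: pmap_cts].
Qed.

Lemma homotopic_sym (R : realType) (X Y : ptopologicalType) (f g : pointed_map X Y) :
  homotopic R f g -> homotopic R g f.
Proof.
move=> /homotopicP[H [cH H0 H1 Hp]]; apply/homotopicP.
exists (fun xt => H (xt.1, 1 - xt.2)); split=> [|x|x|t] /=.
- apply: (@cts_comp _ _ _ (fun xt : X * R => (xt.1, 1 - xt.2)) H) => //.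
  apply: cts_pair; first exact: cts_fst.
  by apply: cts_sub; [exact: cts_cst|exact: cts_snd].
- by rewrite subr0.
- by rewrite subrr.
- exact: Hp.
Qed.

Lemma homotopic_trans (R : realType) (X Y : ptopologicalType)
    (f g h : pointed_map X Y) :
  homotopic R f g -> homotopic R g h -> homotopic R f h.
Proof.
move=> /homotopicP[H [cH H0 H1 Hp]] /homotopicP[K [cK K0 K1 Kp]].
apply/homotopicP.
exists (fun xt => if 0 <= 1 - xt.2 * 2 then H (xt.1, clamp (xt.2 * 2))
                  else K (xt.1, clamp (xt.2 * 2 - 1))).
have c2 : continuous (fun xt : X * R => xt.2 * 2).
  by apply: cts_mul; [exact: cts_snd|exact: cts_cst].
split=> [|x|x|t] /=; last 3 first.
- by rewrite mul0r subr0 ler01 clamp_id ?H0 ?lexx ?ler01.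
- rewrite ifF; last by apply/negbTE; rewrite -ltNge; lra.
  by rewrite (_ : 1 * 2 - 1 = 1 :> R) ?clamp_id ?lexx ?ler01 //; lra.
- by case: ifP.
apply: cts_paste.
- by apply: cts_sub => //; exact: cts_cst.
- apply: (@cts_comp _ _ _ (fun xt : X * R => (xt.1, clamp (xt.2 * 2))) H) => //.
  by apply: cts_pair; [exact: cts_fst|exact: cts_clamp].
- apply: (@cts_comp _ _ _ (fun xt : X * R => (xt.1, clamp (xt.2 * 2 - 1))) K) => //.
  apply: cts_pair; first exact: cts_fst.
  by apply: cts_clamp; apply: cts_sub => //; exact: cts_cst.
- move=> [x t] /= /subr0_eq <-.
  by rewrite subrr !clamp_id ?lexx ?ler01 // H1 K0.
Qed.

Lemma homotopic_comp (R : realType) (X Y Z : ptopologicalType)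
    (g g' : pointed_map Y Z) (f f' : pointed_map X Y) :
  homotopic R g g' -> homotopic R f f' ->
  homotopic R (pointed_comp g f) (pointed_comp g' f').
Proof.
move=> /homotopicP[H [cH H0 H1 Hp]] /homotopicP[K [cK K0 K1 Kp]].
apply/homotopicP; exists (fun xt => H (K xt, xt.2)).
split=> [|x|x|t] /=; rewrite ?K0 ?K1 ?Kp //.
apply: (@cts_comp _ _ _ (fun xt : X * R => (K xt, xt.2)) H) => //.
by apply: cts_pair; [exact: cK|exact: cts_snd].
Qed.

Section HomotopyClasses.
Context (R : realType) (X Y : ptopologicalType).

Definition homotopicb (f g : pointed_map X Y) : bool := `[< homotopic R f g >].

Lemma homotopicb_refl : reflexive homotopicb.
Proof. by move=> f; apply/asboolP; exact: homotopic_refl. Qed.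

Lemma homotopicb_sym : symmetric homotopicb.
Proof. by move=> f g; apply/asboolP/asboolP; exact: homotopic_sym. Qed.

Lemma homotopicb_trans : transitive homotopicb.
Proof.
by move=> g f h /asboolP fg /asboolP gh; apply/asboolP; exact: homotopic_trans gh.
Qed.

Canonical homotopic_equiv : equiv_rel (pointed_map X Y) :=
  EquivRel homotopicb homotopicb_refl homotopicb_sym homotopicb_trans.

Definition hclasses : Type := {eq_quot homotopic_equiv}.
HB.instance Definition _ := Choice.on hclasses.
HB.instance Definition _ := EqQuotient.on hclasses.

Definition hclass (f : pointed_map X Y) : hclasses := \pi_hclasses f.

Lemma hclassP (f g : pointed_map X Y) : hclass f = hclass g <-> homotopic R f g.
Proof.
by split=> [/eqquotP/asboolP|fg] //; apply/eqquotP/asboolP.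
Qed.

Lemma hclass_repr (a : hclasses) : hclass (repr a) = a.
Proof. by rewrite /hclass reprK. Qed.

End HomotopyClasses.

(* Composition of classes; it does not depend on the representatives, by hcompE
   below, and likewise for hadd and hwhitehead. *)
Definition hcomp (R : realType) (X Y Z : ptopologicalType)
    (b : hclasses R Y Z) (a : hclasses R X Y) : hclasses R X Z :=
  hclass R (pointed_comp (repr b) (repr a)).

Lemma hcompE (R : realType) (X Y Z : ptopologicalType)
    (g : pointed_map Y Z) (f : pointed_map X Y) :
  hcomp (hclass R g) (hclass R f) = hclass R (pointed_comp g f).
Proof.
by apply/hclassP/homotopic_comp; apply/hclassP; rewrite hclass_repr.
Qed.

Section EuclideanSpace.
Context (R : realType).

Definition sqnorm m (x : 'rV[R]_m) : R := \sum_(i < m) x 0 i ^+ 2.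

Definition enorm m (x : 'rV[R]_m) : R := Num.sqrt (sqnorm x).

(* Coordinates indexed by natural numbers, with value 0 out of range. *)
Definition crd m (x : 'rV[R]_m) (i : nat) : R :=
  if insub i is Some j then x 0 j else 0.

Lemma crdE m (x : 'rV[R]_m) (i : 'I_m) : crd x i = x 0 i.
Proof. by rewrite /crd valK. Qed.

Lemma crd_out m (x : 'rV[R]_m) i : (m <= i)%N -> crd x i = 0.
Proof. by move=> mi; rewrite /crd insubN // -leqNgt. Qed.

Lemma crd_row m (F : nat -> R) i :
  (i < m)%N -> crd (\row_(j < m) F j) i = F i.
Proof. by move=> im; rewrite -[i]/(val (Ordinal im)) crdE mxE. Qed.

Lemma sqnormE m (x : 'rV[R]_m) : sqnorm x = \sum_(i < m) crd x i ^+ 2.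
Proof. by apply: eq_bigr => i _; rewrite crdE. Qed.

Lemma sqnorm_row m (F : nat -> R) :
  sqnorm (\row_(i < m) F i) = \sum_(i < m) F i ^+ 2.
Proof. by apply: eq_bigr => i _; rewrite mxE. Qed.

Lemma sqnorm_ge0 m (x : 'rV[R]_m) : 0 <= sqnorm x.
Proof. by apply: sumr_ge0 => i _; exact: sqr_ge0. Qed.

Lemma sqnormZ m a (x : 'rV[R]_m) : sqnorm (a *: x) = a ^+ 2 * sqnorm x.
Proof. by rewrite mulr_sumr; apply: eq_bigr => i _; rewrite mxE exprMn. Qed.

Lemma sqnorm_eq0 m (x : 'rV[R]_m) : (sqnorm x == 0) = (x == 0).
Proof.
apply/idP/eqP => [|->]; last first.
  by rewrite /sqnorm big1 // => i _; rewrite mxE expr0n.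
rewrite psumr_eq0 => [/allP x0|i _]; last exact: sqr_ge0.
apply/rowP => i; rewrite mxE; apply/eqP; rewrite -sqrf_eq0.
by apply: x0; rewrite mem_index_enum.
Qed.

Lemma cts_crd m (X : topologicalType) (f : X -> 'rV[R]_m) i :
  continuous f -> continuous (fun x => crd (f x) i).
Proof.
move=> cf; rewrite /crd; case: insubP => [j _ _|_]; last exact: cts_cst.
by apply: (@cts_comp _ _ _ f (fun x : 'rV[R]_m => x 0 j)) => //;
  exact: coord_continuous.
Qed.

Lemma cts_sqnorm m (X : topologicalType) (f : X -> 'rV[R]_m) :
  continuous f -> continuous (fun x => sqnorm (f x)).
Proof.
move=> cf; under eq_fun do rewrite sqnormE.
by apply: cts_sum => i; apply: cts_mul; apply: cts_crd.
Qed.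

Lemma cts_enorm m (X : topologicalType) (f : X -> 'rV[R]_m) :
  continuous f -> continuous (fun x => enorm (f x)).
Proof. by move=> cf; apply/cts_sqrt/cts_sqnorm. Qed.

Definition sphere_set k : set 'rV[R]_k.+1 := [set x | sqnorm x = 1].
Arguments sphere_set k : clear implicits.

Definition sphere k : Type := set_type (sphere_set k).
HB.instance Definition _ k :=
  Topological.copy (sphere k) (set_type (sphere_set k)).

Definition svec k (x : sphere k) : 'rV[R]_k.+1 := val x.

Lemma svec_sqnorm k (x : sphere k) : sqnorm (svec x) = 1.
Proof. exact: (set_mem (valP x)). Qed.

Definition mksphere k (x : 'rV[R]_k.+1) (x1 : sqnorm x = 1) : sphere k :=
  exist _ x (mem_set x1).

Lemma svec_inj k : injective (@svec k).
Proof. exact: val_inj. Qed.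

Lemma cts_svec k (X : topologicalType) (f : X -> sphere k) :
  continuous f -> continuous (fun x => svec (f x)).
Proof.
move=> cf; apply: (@cts_comp _ _ _ f (@svec k)) => //.
exact: initial_continuous.
Qed.

Lemma cts_sphere k (X : topologicalType) (f : X -> sphere k) :
  continuous (fun x => svec (f x)) -> continuous f.
Proof. exact: cts_set_type. Qed.

Definition e0 k : 'rV[R]_k.+1 := \row_(i < k.+1) (i == 0%N :> nat)%:R.

Lemma e0_sqnorm k : sqnorm (e0 k) = 1.
Proof.
rewrite (sqnorm_row _ (fun i => (i == 0%N)%:R)) big_ord_recl /= expr1n.
by rewrite big1 ?addr0 // => i _; rewrite expr0n.
Qed.

HB.instance Definition _ k :=
  isPointed.Build (sphere k) (mksphere (e0_sqnorm k)).

Lemma svecpt k : svec (point : sphere k) = e0 k.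
Proof. by []. Qed.

End EuclideanSpace.

Section SphereGroup.
Context (R : realType).

(* Both halves x_1 >= 0 and x_1 <= 0 of S^k are mapped onto S^k, by a map of
   degree 1 relative to the equator x_1 = 0, which goes to the base point.
   For k = 1, this is the squaring map of the circle.  For k = 0, where there
   is no coordinate x_1, this is the constant map. *)
Definition pinch_crd k (x : 'rV[R]_k.+1) (i : nat) : R :=
  let a := crd x 1 in
  match i with
  | 0 => 1 - 2 * a ^+ 2
  | 1 => 2 * a * crd x 0
  | _ => 2 * `|a| * crd x i
  end.

Lemma pinch_sqnorm k (x : sphere R k) :
  sqnorm (\row_(i < k.+1) pinch_crd (svec x) i) = 1.
Proof.
rewrite sqnorm_row; have := svec_sqnorm x; rewrite sqnormE.
case: k x => [|k] x; rewrite !big_ord_recl /=.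
  by rewrite !big_ord0 [crd _ 1]crd_out //; lra.
rewrite /bump /= !add1n.
under [in X in _ -> X]eq_bigr do rewrite exprMn exprMn real_normK ?num_real //.
rewrite -mulr_sumr.
set a := crd _ 0; set b := crd _ 1; set s := \sum_(i < _) _ => abs.
have -> : s = 1 - a ^+ 2 - b ^+ 2 by rewrite -abs; ring.
by ring.
Qed.

Context (k : nat).

Definition pinch (x : sphere R k) : sphere R k := mksphere (pinch_sqnorm x).

Lemma pinch_cts : continuous pinch.
Proof.
apply: cts_sphere; apply: (@cts_row _ _ _ (fun x i => pinch_crd (svec x) i)).
have ccrd j : continuous (fun x : sphere R k => crd (svec x) j).
  by apply/cts_crd/cts_svec => x; exact: cvg_id.
move=> [[|[|i]] ?] /=; rewrite /pinch_crd.
- apply: cts_sub; first exact: cts_cst.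
  by apply: cts_mul; [exact: cts_cst|apply: cts_mul].
- by apply: cts_mul => //; apply: cts_mul => //; exact: cts_cst.
- by apply: cts_mul => //; apply: cts_mul; [exact: cts_cst|exact: cts_norm].
Qed.

Lemma pinch_equator (x : sphere R k) : crd (svec x) 1 = 0 -> pinch x = point.
Proof.
move=> x0; apply: svec_inj; apply/rowP => i; rewrite !mxE /pinch_crd x0.
by case: i => -[|[|i]] ? /=; rewrite ?normr0; ring.
Qed.

Lemma crd_point1 : crd (svec (point : sphere R k)) 1 = 0.
Proof.
rewrite /crd; case: insubP => //= j _ j1.
by rewrite mxE j1.
Qed.

Section Add.
Context (X : ptopologicalType) (f g : pointed_map (sphere R k) X).

Definition padd_fun (x : sphere R k) : X :=
  if 0 <= crd (svec x) 1 then f (pinch x) else g (pinch x).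

Lemma padd_cts : continuous padd_fun.
Proof.
apply: cts_paste.
- by apply/cts_crd/cts_svec => x; exact: cvg_id.
- by apply: cts_comp; [exact: pinch_cts|exact: pmap_cts].
- by apply: cts_comp; [exact: pinch_cts|exact: pmap_cts].
- by move=> x x0; rewrite pinch_equator // !pmap_pt.
Qed.

Lemma padd_pt : padd_fun point = point.
Proof. by rewrite /padd_fun crd_point1 lexx pinch_equator ?crd_point1 ?pmap_pt. Qed.

Definition padd : pointed_map (sphere R k) X := PMap padd_cts padd_pt.

End Add.

Definition reflect_crd (x : 'rV[R]_k.+1) (i : nat) : R :=
  if i == 1%N then - crd x i else crd x i.

Lemma reflect_sqnorm (x : sphere R k) :
  sqnorm (\row_(i < k.+1) reflect_crd (svec x) i) = 1.
Proof.
rewrite sqnorm_row -[RHS](svec_sqnorm x) sqnormE.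
by apply: eq_bigr => i _; rewrite /reflect_crd; case: ifP => //; rewrite sqrrN.
Qed.

Definition preflect_fun (x : sphere R k) : sphere R k :=
  mksphere (reflect_sqnorm x).

Lemma preflect_cts : continuous preflect_fun.
Proof.
apply: cts_sphere; apply: (@cts_row _ _ _ (fun x i => reflect_crd (svec x) i)).
have ccrd j : continuous (fun x : sphere R k => crd (svec x) j).
  by apply/cts_crd/cts_svec => x; exact: cvg_id.
move=> i; rewrite /reflect_crd; case: (nat_of_ord i == 1%N) => //.
by under eq_fun do rewrite -sub0r; apply: cts_sub; [exact: cts_cst|exact: ccrd].
Qed.

Lemma preflect_pt : preflect_fun point = point.
Proof.
apply: svec_inj; apply/rowP => i; rewrite !mxE /reflect_crd.
case: ifP => [/eqP i1|_]; last by rewrite svecpt crdE mxE.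
by rewrite i1 crd_point1 oppr0.
Qed.

Definition preflect : pointed_map (sphere R k) (sphere R k) :=
  PMap preflect_cts preflect_pt.

Section Homotopy.
Context (X : ptopologicalType).

Lemma homotopic_padd (f f' g g' : pointed_map (sphere R k) X) :
  homotopic R f f' -> homotopic R g g' -> homotopic R (padd f g) (padd f' g').
Proof.
move=> /homotopicP[H [cH H0 H1 Hp]] /homotopicP[K [cK K0 K1 Kp]].
apply/homotopicP.
exists (fun xt => if 0 <= crd (svec xt.1) 1 then H (pinch xt.1, xt.2)
                  else K (pinch xt.1, xt.2)).
have cp : continuous (fun xt : sphere R k * R => (pinch xt.1, xt.2)).
  apply: cts_pair; last exact: cts_snd.
  by apply: cts_comp; [exact: cts_fst|exact: pinch_cts].
split=> [|x|x|t] /=; last 3 first.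
- by rewrite H0 K0.
- by rewrite H1 K1.
- by rewrite pinch_equator ?crd_point1 // Hp Kp; case: ifP.
apply: cts_paste.
- by apply/cts_crd/cts_svec; exact: cts_fst.
- exact: cts_comp cp cH.
- exact: cts_comp cp cK.
- by move=> [x t] /= x0; rewrite pinch_equator // Hp Kp.
Qed.

End Homotopy.
End SphereGroup.

Section HomotopyGroup.
Context (R : realType) (k : nat) (X : ptopologicalType).

(* The underlying set of the k-th homotopy group of X for 0 < k; it is only
   a pointed set for k = 0. *)
Definition hgroup := hclasses R (sphere R k) X.
HB.instance Definition _ := Choice.on hgroup.

Definition hzero : hgroup := hclass R (pointed_const (sphere R k) X).

Definition hadd (a b : hgroup) : hgroup := hclass R (padd (repr a) (repr b)).

Definition hopp (a : hgroup) : hgroup := hcomp a (hclass R (preflect R k)).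

Definition hmuln (n : nat) (a : hgroup) : hgroup := iter n (hadd a) hzero.

Definition hmulz (q : int) (a : hgroup) : hgroup :=
  match q with
  | Posz n => hmuln n a
  | Negz n => hopp (hmuln n.+1 a)
  end.

Lemma haddE (f g : pointed_map (sphere R k) X) :
  hadd (hclass R f) (hclass R g) = hclass R (padd f g).
Proof. by apply/hclassP/homotopic_padd; apply/hclassP; rewrite hclass_repr. Qed.

End HomotopyGroup.
Arguments hzero {R k X}.

Section WhiteheadProduct.
Context (R : realType).

(* The standard quotient map D^p -> D^p / S^{p-1} = S^p, extended to R^p by
   the base point outside of D^p. *)
Definition collapse_crd p (x : 'rV[R]_p) (i : nat) : R :=
  let s := Num.min 1 (sqnorm x) in
  if i is j.+1 then 2 * Num.sqrt (1 - s) * crd x j else 2 * s - 1.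

Lemma collapse_sqnorm p (x : 'rV[R]_p) :
  sqnorm (\row_(i < p.+1) collapse_crd x i) = 1.
Proof.
rewrite sqnorm_row big_ord_recl /=.
under eq_bigr do rewrite exprMn exprMn.
rewrite -mulr_sumr -sqnormE; set s := Num.min 1 _.
rewrite sqr_sqrtr ?subr_ge0 ?ge_min ?lexx //.
have [x1|x1] := lerP 1 (sqnorm x).
  by rewrite (_ : s = 1) /s ?(min_idPl x1) //; ring.
by rewrite (_ : sqnorm x = s) /s ?(min_idPr (ltW x1)) //; ring.
Qed.

Definition collapse p (x : 'rV[R]_p) : sphere R p :=
  mksphere (collapse_sqnorm x).

Lemma cts_collapse p (X : topologicalType) (f : X -> 'rV[R]_p) :
  continuous f -> continuous (fun x => collapse (f x)).
Proof.
move=> cf; apply: cts_sphere.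
apply: (@cts_row _ _ _ (fun x i => collapse_crd (f x) i)).
have cs : continuous (fun x => Num.min 1 (sqnorm (f x))).
  by apply: cts_min; [exact: cts_cst|exact: cts_sqnorm].
move=> [[|i] ?] /=; rewrite /collapse_crd.
  by apply: cts_sub; [apply: cts_mul => //|]; exact: cts_cst.
apply: cts_mul; last exact: cts_crd.
apply: cts_mul; first exact: cts_cst.
by apply: cts_sqrt; apply: cts_sub => //; exact: cts_cst.
Qed.

Lemma collapse_out p (x : 'rV[R]_p) : 1 <= sqnorm x -> collapse x = point.
Proof.
move=> x1; apply: svec_inj; apply/rowP => i; rewrite !mxE /collapse_crd.
rewrite (min_idPl x1) subrr sqrtr0.
by case: i => -[|i] ? /=; ring.
Qed.

Section Join.
Context (p q : nat) (p_gt0 : (0 < p)%N) (q_gt0 : (0 < q)%N).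
Local Notation S := (sphere R (p + q).-1).

(* The coordinates of z : S are those of a point of R^p x R^q, except that
   (z_0, z_p) is replaced with (z_0 - z_p, z_0 + z_p).  This gives a linear
   isomorphism of R^{p+q} onto R^p x R^q which preserves the orientation, and
   takes the base point of S to a pair of vectors of the same length. *)
Definition wleft_crd (z : S) (i : nat) : R :=
  if i == 0%N then crd (svec z) 0 - crd (svec z) p else crd (svec z) i.

Definition wright_crd (z : S) (i : nat) : R :=
  if i == 0%N then crd (svec z) 0 + crd (svec z) p else crd (svec z) (p + i).

Definition wleft (z : S) : 'rV[R]_p := \row_(i < p) wleft_crd z i.
Definition wright (z : S) : 'rV[R]_q := \row_(i < q) wright_crd z i.

Definition wmax (z : S) : R := Num.max (enorm (wleft z)) (enorm (wright z)).

Lemma wmax_neq0 (z : S) : wmax z != 0.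
Proof.
apply/eqP => M0.
have l0 : wleft z = 0.
  apply/eqP; rewrite -sqnorm_eq0 eq_le sqnorm_ge0 andbT -sqrtr_eq0.
  by rewrite eq_le sqrtr_ge0 andbT -M0 le_max lexx.
have r0 : wright z = 0.
  apply/eqP; rewrite -sqnorm_eq0 eq_le sqnorm_ge0 andbT -sqrtr_eq0.
  by rewrite eq_le sqrtr_ge0 andbT -M0 le_max lexx orbT.
have cl i : (i < p)%N -> wleft_crd z i = 0.
  by move=> ip; rewrite -(crd_row (wleft_crd z) ip) [X in crd X]l0
    /crd; case: insubP => // j _ _; rewrite mxE.
have cr i : (i < q)%N -> wright_crd z i = 0.
  by move=> iq; rewrite -(crd_row (wright_crd z) iq) [X in crd X]r0
    /crd; case: insubP => // j _ _; rewrite mxE.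
have [/= z1 z2] := (cl 0%N p_gt0, cr 0%N q_gt0).
rewrite /wleft_crd /wright_crd /= in z1 z2.
have z0 : crd (svec z) 0 = 0 by lra.
have zp : crd (svec z) p = 0 by lra.
have := svec_sqnorm z; rewrite sqnormE big1 => [/eqP|i _].
  by rewrite eq_sym oner_eq0.
suff -> : crd (svec z) i = 0 by rewrite expr0n.
have [ip|pi] := ltnP i p.
  by have := cl _ ip; rewrite /wleft_crd; case: eqP => // ->.
have iq : (i - p < q)%N.
  by rewrite ltn_subLR // (leq_trans (ltn_ord i)) // prednK ?addn_gt0 ?p_gt0.
have := cr _ iq; rewrite /wright_crd subnKC //; case: eqP => // ip0 _.
by rewrite (_ : nat_of_ord i = p) //; apply/eqP; rewrite eqn_leq pi -subn_eq0 ip0.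
Qed.

Definition wside (z : S) : R := enorm (wright z) - enorm (wleft z).

Definition wleft_sphere (z : S) : sphere R p :=
  collapse ((wmax z)^-1 *: wleft z).

Definition wright_sphere (z : S) : sphere R q :=
  collapse ((wmax z)^-1 *: wright z).

Lemma cts_wcrd j : continuous (fun z : S => crd (svec z) j).
Proof. by apply/cts_crd/cts_svec => z; exact: cvg_id. Qed.

Lemma cts_wleft : continuous wleft.
Proof.
apply: (@cts_row _ _ _ (fun z i => wleft_crd z i)) => i; rewrite /wleft_crd.
case: (nat_of_ord i == 0%N); last exact: cts_wcrd.
by apply: cts_sub; exact: cts_wcrd.
Qed.

Lemma cts_wright : continuous wright.
Proof.
apply: (@cts_row _ _ _ (fun z i => wright_crd z i)) => i; rewrite /wright_crd.
case: (nat_of_ord i == 0%N); last exact: cts_wcrd.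
by apply: cts_add; exact: cts_wcrd.
Qed.

Lemma cts_wmax : continuous wmax.
Proof.
by apply: cts_max; apply: cts_enorm; [exact: cts_wleft|exact: cts_wright].
Qed.

Lemma cts_wside : continuous wside.
Proof.
by apply: cts_sub; apply: cts_enorm; [exact: cts_wright|exact: cts_wleft].
Qed.

Lemma cts_wscale m (f : S -> 'rV[R]_m) :
  continuous f -> continuous (fun z => (wmax z)^-1 *: f z).
Proof.
move=> cf.
have -> : (fun z => (wmax z)^-1 *: f z) =
    (fun z => \row_(i < m) ((wmax z)^-1 * crd (f z) i)).
  by apply/funext => z; apply/rowP => i; rewrite !mxE crdE.
apply: (@cts_row _ _ _ (fun z i => (wmax z)^-1 * crd (f z) i)) => i.
apply: cts_mul; last exact: cts_crd.
by apply: cts_inv; [exact: wmax_neq0|exact: cts_wmax].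
Qed.

Lemma cts_wleft_sphere : continuous wleft_sphere.
Proof. by apply/cts_collapse/cts_wscale/cts_wleft. Qed.

Lemma cts_wright_sphere : continuous wright_sphere.
Proof. by apply/cts_collapse/cts_wscale/cts_wright. Qed.

Lemma wscale_sqnorm m (x : 'rV[R]_m) (M : R) :
  M != 0 -> enorm x = M -> sqnorm (M^-1 *: x) = 1.
Proof.
move=> M0 xM; rewrite sqnormZ -[sqnorm x]sqr_sqrtr ?sqnorm_ge0 //.
by rewrite -/(enorm x) xM -exprMn mulVf // expr1n.
Qed.

Lemma wleft_sphere0 z : wside z = 0 -> wleft_sphere z = point.
Proof.
move=> /subr0_eq rl; apply: collapse_out.
by rewrite (wscale_sqnorm (wmax_neq0 z)) // /wmax rl maxxx.
Qed.

Lemma wright_sphere0 z : wside z = 0 -> wright_sphere z = point.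
Proof.
move=> /subr0_eq rl; apply: collapse_out.
by rewrite (wscale_sqnorm (wmax_neq0 z)) // /wmax rl maxxx.
Qed.

Lemma wside_pt : wside point = 0.
Proof.
have crdpt j : crd (svec (point : S)) j = (j == 0%N)%:R.
  rewrite svecpt; have [jk|kj] := ltnP j (p + q).-1.+1.
    by rewrite (crd_row (fun i => (i == 0%N)%:R)).
  by rewrite crd_out //; case: j kj.
have e1 m (F : nat -> R) : (0 < m)%N -> (forall i, F i = (i == 0%N)%:R) ->
    enorm (\row_(i < m) F i) = 1.
  case: m => // m _ FE; rewrite /enorm sqnorm_row big_ord_recl big1 => [|i _].
    by rewrite FE expr1n addr0 sqrtr1.
  by rewrite FE expr0n.
have pE : (p == 0)%N = false by case: (p) p_gt0.
rewrite /wside /wleft /wright !e1 ?subrr // => i.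
  rewrite /wleft_crd !crdpt pE; case: eqP => //= _; exact: subr0.
rewrite /wright_crd !crdpt pE addn_eq0 pE /=.
by case: eqP => //= _; exact: addr0.
Qed.

Section Maps.
Context (X : ptopologicalType).
Context (f : pointed_map (sphere R p) X) (g : pointed_map (sphere R q) X).

(* After scaling by 1 / wmax z, the pair (wleft z, wright z) runs over the
   boundary D^p x S^{q-1} \cup S^{p-1} x D^q of D^p x D^q.  The Whitehead
   product is f on the first factor of D^p x S^{q-1} (where wside z >= 0), and
   g on the second factor of S^{p-1} x D^q. *)
Definition whitehead_fun (z : S) : X :=
  if 0 <= wside z then f (wleft_sphere z) else g (wright_sphere z).

Lemma whitehead_cts : continuous whitehead_fun.
Proof.
apply: cts_paste.
- exact: cts_wside.
- by apply: cts_comp; [exact: cts_wleft_sphere|exact: pmap_cts].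
- by apply: cts_comp; [exact: cts_wright_sphere|exact: pmap_cts].
- by move=> z z0; rewrite wleft_sphere0 // wright_sphere0 // !pmap_pt.
Qed.

Lemma whitehead_pt : whitehead_fun point = point.
Proof. by rewrite /whitehead_fun wside_pt lexx wleft_sphere0 ?wside_pt ?pmap_pt. Qed.

Definition whitehead : pointed_map S X := PMap whitehead_cts whitehead_pt.

End Maps.

Lemma homotopic_whitehead (X : ptopologicalType)
    (f f' : pointed_map (sphere R p) X) (g g' : pointed_map (sphere R q) X) :
  homotopic R f f' -> homotopic R g g' ->
  homotopic R (whitehead f g) (whitehead f' g').
Proof.
move=> /homotopicP[H [cH H0 H1 Hp]] /homotopicP[K [cK K0 K1 Kp]].
apply/homotopicP.
exists (fun zt => if 0 <= wside zt.1 then H (wleft_sphere zt.1, zt.2)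
                  else K (wright_sphere zt.1, zt.2)).
have cl : continuous (fun zt : S * R => (wleft_sphere zt.1, zt.2)).
  apply: cts_pair; last exact: cts_snd.
  by apply: cts_comp; [exact: cts_fst|exact: cts_wleft_sphere].
have cr : continuous (fun zt : S * R => (wright_sphere zt.1, zt.2)).
  apply: cts_pair; last exact: cts_snd.
  by apply: cts_comp; [exact: cts_fst|exact: cts_wright_sphere].
split=> [|z|z|t] /=; last 3 first.
- by rewrite H0 K0.
- by rewrite H1 K1.
- by rewrite wside_pt lexx wleft_sphere0 ?wside_pt.
apply: cts_paste.
- by apply: cts_comp; [exact: cts_fst|exact: cts_wside].
- exact: cts_comp cl cH.
- exact: cts_comp cr cK.
- by move=> [z t] /= z0; rewrite wleft_sphere0 // wright_sphere0 // Hp Kp.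
Qed.

Definition hwhitehead (X : ptopologicalType) (a : hgroup R p X)
    (b : hgroup R q X) : hgroup R (p + q).-1 X :=
  hclass R (whitehead (repr a) (repr b)).

Lemma hwhiteheadE (X : ptopologicalType)
    (f : pointed_map (sphere R p) X) (g : pointed_map (sphere R q) X) :
  hwhitehead (hclass R f) (hclass R g) = hclass R (whitehead f g).
Proof.
by apply/hclassP/homotopic_whitehead; apply/hclassP; rewrite hclass_repr.
Qed.

End Join.
End WhiteheadProduct.

Section SingularHomology.
Context (R : realType).

Definition simplex_set k : set 'rV[R]_k.+1 :=
  [set t | (forall i, 0 <= t 0 i) /\ \sum_i t 0 i = 1].
Arguments simplex_set k : clear implicits.

Definition simplex k : Type := set_type (simplex_set k).
HB.instance Definition _ k :=
  Topological.copy (simplex k) (set_type (simplex_set k)).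

Definition face_row k (j : 'I_k.+2) (t : 'rV[R]_k.+1) : 'rV[R]_k.+2 :=
  \row_(i < k.+2) if unlift j i is Some i' then t 0 i' else 0.

Lemma face_subproof k (j : 'I_k.+2) (t : simplex k) :
  simplex_set k.+1 (face_row j (val t)).
Proof.
have [t0 t1] := set_mem (valP t); split=> [i|].
  by rewrite mxE; case: unliftP => [i' _|_] //; exact: t0.
rewrite (bigD1_ord j) //= mxE unlift_none add0r -[RHS]t1.
by apply: eq_bigr => i _; rewrite mxE liftK.
Qed.

Definition face_fun k (j : 'I_k.+2) (t : simplex k) : simplex k.+1 :=
  exist _ (face_row j (val t)) (mem_set (face_subproof j t)).

Lemma face_cts k (j : 'I_k.+2) : continuous (face_fun j).
Proof.
apply: cts_set_type.
apply: (@cts_row _ _ _ (fun (t : simplex k) (i : 'I_k.+2) =>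
  if unlift j i is Some i' then (val t : 'rV[R]_k.+1) 0 i' else 0)) => i.
case: (unlift j i) => [i'|]; last exact: cts_cst.
apply: (@cts_comp _ _ _ (fun t : simplex k => val t : 'rV[R]_k.+1)
  (fun x : 'rV[R]_k.+1 => x 0 i')); first exact: initial_continuous.
exact: coord_continuous.
Qed.

HB.instance Definition _ k (j : 'I_k.+2) :=
  isContinuous.Build (simplex k) (simplex k.+1) (face_fun j) (@face_cts k j).

Section Chains.
Context (X : topologicalType).

Definition schain k : zmodType := {freeg (continuousType (simplex k) X)}.

Definition boundary k : schain k -> schain k.-1 :=
  match k return schain k -> schain k.-1 with
  | 0 => fun=> 0
  | m.+1 => fglift (fun s : continuousType (simplex m.+1) X =>
      \sum_(j < m.+2) << (-1) ^+ j *g (s \o face_fun j : continuousType _ _) >>)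
  end.

Definition is_cycle k (z : schain k) : Prop := boundary z = 0.

Definition homologous k (z w : schain k) : Prop :=
  exists b : schain k.+1, boundary b = z - w.

(* The class of the cycle z freely generates the k-th homology group of X, as
   the fundamental class of an oriented connected closed k-manifold does. *)
Definition fundamental_cycle k (z : schain k) : Prop :=
  is_cycle z /\
  forall w, is_cycle w -> exists! d : int, homologous w (z *~ d).

End Chains.

Definition chain_map (X Y : topologicalType) (f : continuousType X Y) k :
    schain X k -> schain Y k :=
  fglift (fun s : continuousType (simplex k) X =>
    << (f \o s : continuousType _ _) >>).

(* f has degree d with respect to the orientations given by z and w. *)
Definition has_degree (X Y : topologicalType) k (z : schain X k) (w : schain Y k)
    (f : continuousType X Y) (d : int) : Prop :=
  homologous (chain_map f z) (w *~ d).

End SingularHomology.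

Section FiniteDegree.

Definition zhom (A B : zmodType) : Type := {additive A -> B}.

Section HomZmodule.
Context (A B : zmodType).

Definition hom_fun (f : zhom A B) : A -> B := (f : {additive A -> B}).

HB.instance Definition _ := gen_eqMixin (zhom A B).
HB.instance Definition _ := gen_choiceMixin (zhom A B).

Lemma hom_eqP (f g : zhom A B) : hom_fun f =1 hom_fun g -> f = g.
Proof.
case: f g => [f [[cf]]] [g [[cg]]] /= /funext fg.
rewrite /hom_fun /= in fg; subst g.
by rewrite (Prop_irrelevance cf cg).
Qed.

Definition hom_zero : zhom A B := (\0 : {additive A -> B}).
Definition hom_add (f g : zhom A B) : zhom A B :=
  ((f : {additive A -> B}) \+ (g : {additive A -> B}) : {additive A -> B}).
Definition hom_opp (f : zhom A B) : zhom A B :=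
  (\- (f : {additive A -> B}) : {additive A -> B}).

Lemma hom_addA : associative hom_add.
Proof. by move=> f g h; apply: hom_eqP => x; exact: addrA. Qed.
Lemma hom_addC : commutative hom_add.
Proof. by move=> f g; apply: hom_eqP => x; exact: addrC. Qed.
Lemma hom_add0 : left_id hom_zero hom_add.
Proof. by move=> f; apply: hom_eqP => x; exact: add0r. Qed.
Lemma hom_addN : left_inverse hom_zero hom_opp hom_add.
Proof. by move=> f; apply: hom_eqP => x; exact: addNr. Qed.

HB.instance Definition _ :=
  GRing.isZmodule.Build (zhom A B) hom_addA hom_addC hom_add0 hom_addN.

End HomZmodule.

Definition C0 (X : choiceType) : zmodType := {freeg X}.

Definition C0_fun (X Y : choiceType) (a : X -> Y) : C0 X -> C0 Y :=
  fglift (fun x => << a x >>).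

Lemma C0_fun_additive (X Y : choiceType) (a : X -> Y) : additive (C0_fun a).
Proof. exact: lift_is_additive. Qed.

HB.instance Definition _ (X Y : choiceType) (a : X -> Y) :=
  GRing.isAdditive.Build (C0 X) (C0 Y) (C0_fun a) (C0_fun_additive a).

Definition C0_map (X Y : choiceType) (a : X -> Y) : zhom (C0 X) (C0 Y) :=
  (C0_fun a : {additive C0 X -> C0 Y}).

(* C0 (r.-tuple X) only depends on the points of the r-th Cartesian power of X;
   its topology plays no role. *)
Definition degree_at_most (R : realType) (X Y : ptopologicalType)
    (V : zmodType) (r : nat) (f : hclasses R X Y -> V) : Prop :=
  exists l : {additive zhom (C0 (r.-tuple X)) (C0 (r.-tuple Y)) -> V},
  forall a : pointed_map X Y, f (hclass R a) = l (C0_map (map_tuple (n := r) a)).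

Definition finite_degree (R : realType) (X Y : ptopologicalType)
    (V : zmodType) (f : hclasses R X Y -> V) : Prop :=
  exists r : nat, degree_at_most r f.

End FiniteDegree.

Section Rationalization.
Context (R : realType).

Definition path_connected (X : topologicalType) : Prop :=
  forall x y : X, exists g : R -> X,
    [/\ {within [set t | 0 <= t <= 1], continuous g}, g 0 = x & g 1 = y].

Definition simply_connected (X : ptopologicalType) : Prop :=
  path_connected X /\ forall a : hgroup R 1 X, a = hzero.

(* A simply connected space whose homotopy groups are vector spaces over rat,
   that is, are uniquely divisible. *)
Definition rational_space (X : ptopologicalType) : Prop :=
  simply_connected X /\
  forall k m : nat, (0 < k)%N -> (0 < m)%N ->
    bijective (fun a : hgroup R k X => hmuln m a).

Definition hmorphism k (X : ptopologicalType) (W : zmodType)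
    (h : hgroup R k X -> W) : Prop :=
  {morph h : a b / hadd a b >-> a + b}.

(* l is a rationalization of the simply connected space X: its target is
   rational, and the homomorphism that l induces on each homotopy group is
   universal among the homomorphisms to vector spaces over rat. *)
Definition rationalization (X Y : ptopologicalType) (l : pointed_map X Y) : Prop :=
  rational_space Y /\
  forall (k : nat) (W : lmodType rat) (h : hgroup R k X -> W),
    (0 < k)%N -> hmorphism h ->
    exists! h' : hgroup R k Y -> W,
      hmorphism h' /\ forall a : hgroup R k X, h' (hcomp (hclass R l) a) = h a.

End Rationalization.

Section SphereClasses.
Context (R : realType) (n : nat) (n_gt0 : (0 < n)%N).

Local Notation SxS := (sphere R n.-1 * sphere R n)%type.

Definition whitehead_square : hgroup R (n + n).-1 (sphere R n) :=
  let i := hclass R (pointed_id (sphere R n)) in hwhitehead n_gt0 n_gt0 i i.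

Definition u_class (c : pointed_map SxS (sphere R (n + n).-1)) (q : int) :
    hclasses R SxS (sphere R n) :=
  hcomp (hmulz q whitehead_square) (hclass R c).

Definition ubar_class (c : pointed_map SxS (sphere R (n + n).-1))
    (SnQ : ptopologicalType) (l : pointed_map (sphere R n) SnQ) (q : int) :
    hclasses R SxS SnQ :=
  hcomp (hclass R l) (u_class c q).

End SphereClasses.

(* Main.v *)
Require Import Defs.
From HB Require Import structures.
From mathcomp Require Import all_boot all_order all_algebra all_fingroup.
From mathcomp Require Import generic_quotient.
From mathcomp Require freeg.
From mathcomp Require Import all_classical reals topology normedtype realfun derive.
From mathcomp Require Import zify ring lra.

(* Put p = n - 1 and read a map S^p x S^n -> Y in charts R^p and R^n of the two
   spheres.  The maps (called amaps) that send S^p x pt to the base point have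
   homotopy classes forming an abelian group A(Y), where maps are added along a
   coordinate of R^n.  Put Y = S^n_Q and alpha(s, t) = l(t).

   An invariant of degree at most r of the class in [S^p x S^n, Y] of a sum of
   amaps with disjoint supports has vanishing alternating sums over the subsets
   of r + 1 summands, since a point of (S^p x S^n)^r meets at most r supports.
   Hence it takes the same value on D and 0 in A(Y) as soon as D + k alpha and
   k alpha have the same image in [S^p x S^n, Y] for all k > 0.

   A map G : S^{p+1} = S^n -> Y acts additively on A(Y), by surrounding the support
   in R^n with the collar (x, s) |-> G(x, s).  This does not change the image in
   [S^p x S^n, Y], as the collar can be swept to infinity.  The difference
   D(a, G) = G.a - a is additive in a and in the class of G, and the action is
   trivial on such differences.  If [l] = k [G], then
   k alpha + z D(alpha, l) = k alpha + z k D(alpha, G) = k alpha + z D(k alpha, G) = G^z.(k alpha)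
   has the same image as k alpha; G exists because Y is rational.

   It remains to see that ubar(q) is the image of a multiple of D(alpha, l).  The
   element D(alpha, l) is the composition of l, the Whitehead square and the
   map of degree 1 onto the top cell: this map can be written as a linking map,
   the position of t relative to two centres.  Moreover every map
   S^p x S^n -> S^{p+n} is homotopic to a multiple of that map, by Hopf: a
   piecewise affine approximation has, for a generic target, finitely many
   regular preimages, each of which contributes plus or minus the top cell since
   the general linear group of R^{p+n} has two components. *)

Set Implicit Arguments.
Unset Strict Implicit.
Unset Printing Implicit Defensive.

Import Order.TTheory GRing.Theory Num.Theory.
Import numFieldNormedType.Exports.

Local Open Scope classical_set_scope.
Local Open Scope ring_scope.
Local Open Scope quotient_scope.

(** * Continuity and norms *)

(** The set [S^p x S^n, Y] carries no group structure, and the map from A(Y) to it need not be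
    injective. The action of G provides the coincidences, but G.0 = 0, so D(alpha, l) and 0 cannot
    be compared directly: a multiple k alpha with k > 0 has to be present for G to act on. Finite
    degree supplies these copies of alpha: in the alternating sum the empty subset is the only one
    without a copy, so its term is determined by the others. Dividing [l] by k makes up for the k
    copies: G changes k alpha by k D(alpha, G) = D(alpha, l), whereas l itself would change it by k
    D(alpha, l). The action is trivial on D(a, G) for this reason: G.a and a agree for s at
    infinity, so their difference is null there; and a collar, which leaves the base point only for
    bounded s, can be moved to s at infinity, where nothing is left to surround. Norms of row
    vectors are maximum norms. Supports are therefore measured by cubes, and constants such as m + 2
    compare them with the Euclidean norm of the spheres. *)

Lemma cts_id (X : topologicalType) : continuous (fun x : X => x).
Proof. by move=> x; exact: cvg_id. Qed.

Lemma cts_pairl (X Y : topologicalType) (x : X) : continuous (pair x : Y -> X * Y).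
Proof. by apply: cts_pair; [exact: cts_cst|exact: cts_id]. Qed.

Lemma cts_fst_comp (X Y Z : topologicalType) (f : X -> Y * Z) :
  continuous f -> continuous (fun x => (f x).1).
Proof. by move=> cf; apply: (cts_comp cf); exact: cts_fst. Qed.

Lemma cts_snd_comp (X Y Z : topologicalType) (f : X -> Y * Z) :
  continuous f -> continuous (fun x => (f x).2).
Proof. by move=> cf; apply: (cts_comp cf); exact: cts_snd. Qed.

Lemma cts_eq (X Y : topologicalType) (f g : X -> Y) :
  f =1 g -> continuous g -> continuous f.
Proof. by move=> /funext ->. Qed.

Lemma cts_opp (R : realType) (X : topologicalType) (f : X -> R) :
  continuous f -> continuous (fun x => - f x).
Proof. by move=> cf x; apply: cvgN; exact: cf. Qed.

Section RowContinuity.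
Context (R : realType) (X : topologicalType).
Implicit Types k : nat.

Lemma cts_rowP k (f : X -> 'rV[R]_k) :
  (forall i, continuous (fun x => f x 0 i)) -> continuous f.
Proof.
move=> cf; have -> : f = fun x => \row_i f x 0 i.
  by apply/funext => x; apply/rowP => i; rewrite mxE.
exact: cts_row.
Qed.

Lemma cts_coord k (f : X -> 'rV[R]_k) i :
  continuous f -> continuous (fun x => f x 0 i).
Proof.
move=> cf; apply: (@cts_comp _ _ _ f (fun v : 'rV_k => v 0 i)) => //.
exact: coord_continuous.
Qed.

Lemma cts_addv k (f g : X -> 'rV[R]_k) :
  continuous f -> continuous g -> continuous (fun x => f x + g x).
Proof. by move=> cf cg x; apply: cvgD; [exact: cf|exact: cg]. Qed.

Lemma cts_oppv k (f : X -> 'rV[R]_k) :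
  continuous f -> continuous (fun x => - f x).
Proof. by move=> cf x; apply: cvgN; exact: cf. Qed.

Lemma cts_scalev k (a : X -> R) (f : X -> 'rV[R]_k) :
  continuous a -> continuous f -> continuous (fun x => a x *: f x).
Proof. by move=> ca cf x; apply: cvgZ; [exact: ca|exact: cf]. Qed.

Lemma cts_normv k (f : X -> 'rV[R]_k) :
  continuous f -> continuous (fun x => `|f x|).
Proof. by move=> cf x; apply: cvg_norm; exact: cf. Qed.

Lemma cts_row_mx k l (f : X -> 'rV[R]_k) (g : X -> 'rV[R]_l) :
  continuous f -> continuous g -> continuous (fun x => row_mx (f x) (g x)).
Proof.
move=> cf cg; apply: cts_rowP => i.
have -> : (fun x => row_mx (f x) (g x) 0 i) =
  fun x => match fintype.split i with inl j => f x 0 j | inr j => g x 0 j end.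
  by apply/funext => x; rewrite mxE.
by case: (fintype.split i) => j; exact: cts_coord.
Qed.

Lemma cts_lsubmx k l (f : X -> 'rV[R]_(k + l)) :
  continuous f -> continuous (fun x => lsubmx (f x)).
Proof.
move=> cf; apply: cts_rowP => i.
by under eq_fun do rewrite mxE; exact: cts_coord.
Qed.

Lemma cts_rsubmx k l (f : X -> 'rV[R]_(k + l)) :
  continuous f -> continuous (fun x => rsubmx (f x)).
Proof.
move=> cf; apply: cts_rowP => i.
by under eq_fun do rewrite mxE; exact: cts_coord.
Qed.

Lemma cts_if (Y : topologicalType) (h : X -> R) (f g : X -> Y) :
  continuous h -> continuous f -> continuous g ->
  (forall x, h x = 0 -> f x = g x) ->
  continuous (fun x => if h x <= 0 then f x else g x).
Proof.
move=> ch cf cg fg.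
have -> : (fun x => if h x <= 0 then f x else g x) =
          (fun x => if 0 <= - h x then f x else g x).
  by apply/funext => x; rewrite oppr_ge0.
apply: cts_paste => //; first exact: cts_opp.
by move=> x /eqP; rewrite oppr_eq0 => /eqP; exact: fg.
Qed.

End RowContinuity.

(** Directed by the syntax of the body; hypotheses [continuous g] serve as rules for composition.
    Piecewise definitions are left to [cts_if] and [cts_paste], since the matching on the wall needs
    an argument. *)
Ltac cts_step :=
  match goal with |- continuous ?f =>
  first
  [ match goal with H : continuous f |- _ => exact H end
  | lazymatch f with
    | fun _ => ?c => apply: cts_cst
    | fun x => x => apply: cts_id
    | fst => apply: cts_fst
    | snd => apply: cts_snd
    | pair _ => apply: cts_pairl
    | @svec _ _ => apply: (@cts_svec _ _ _ _ (@cts_id _))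
    | Num.norm => first [apply: (@cts_normv _ _ _ _ (@cts_id _)) | apply: (@cts_norm _ _ _ (@cts_id _))]
    | fun x => (_, _) => apply: cts_pair
    | fun x => fst _ => apply: cts_fst_comp
    | fun x => snd _ => apply: cts_snd_comp
    | fun x => Num.max _ _ => apply: cts_max
    | fun x => Num.min _ _ => apply: cts_min
    | fun x => clamp _ => apply: cts_clamp
    | fun x => Num.sqrt _ => apply: cts_sqrt
    | fun x => row_mx _ _ => apply: cts_row_mx
    | fun x => lsubmx _ => apply: cts_lsubmx
    | fun x => rsubmx _ => apply: cts_rsubmx
    | fun x => enorm _ => apply: cts_enorm
    | fun x => sqnorm _ => apply: cts_sqnorm
    | fun x => crd _ _ => apply: cts_crd
    | fun x => svec _ => apply: cts_svec
    | fun x => collapse _ => apply: cts_collapse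
    | fun x => _ *: _ => apply: cts_scalev
    | fun x => _ * _ => apply: cts_mul
    | fun x => _ + _ => first [apply: cts_addv | apply: cts_add]
    | fun x => - _ => first [apply: cts_oppv | apply: cts_opp]
    | fun x => `|_| => first [apply: cts_normv | apply: cts_norm]
    | fun x => fun_of_matrix _ _ _ => apply: cts_coord
    end
  | match goal with H : continuous ?g |- _ =>
      lazymatch f with fun x => g _ => apply: (@cts_comp _ _ _ _ g _ H) end
    end ] end.
Ltac cts := repeat cts_step.

Section RowNorms.
Context (R : realType).
Implicit Types k : nat.

Lemma normv_le k (x : 'rV[R]_k) (a : R) :
  0 <= a -> (forall i, `|x 0 i| <= a) -> `|x| <= a.
Proof.
move=> a0 xa; rewrite [`|x|]mx_normrE; apply: bigmax_le => // -[i j] _.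
by rewrite (ord1 i) /=; exact: xa.
Qed.

Lemma le_normv k (x : 'rV[R]_k) i : `|x 0 i| <= `|x|.
Proof.
rewrite [leRHS]mx_normrE.
exact: (le_bigmax _ (fun ij : 'I_1 * 'I_k => `|x ij.1 ij.2|) (0, i)).
Qed.

Lemma le_normv_enorm k (x : 'rV[R]_k) : `|x| <= enorm x.
Proof.
apply: normv_le => [|i]; first exact: sqrtr_ge0.
rewrite -sqrtr_sqr ler_wsqrtr // /sqnorm (bigD1 i) //= lerDl.
by apply: sumr_ge0 => j _; exact: sqr_ge0.
Qed.

(** The crude constant k instead of its square root suffices; it is the origin of the factor
    [(m.+2)%:R] in the scale of the charts. *)
Lemma le_enorm_normv k (x : 'rV[R]_k) : enorm x <= k%:R * `|x|.
Proof.
have k0 : 0 <= k%:R * `|x| by rewrite mulr_ge0.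
rewrite -(ger0_norm k0) -sqrtr_sqr ler_wsqrtr //.
have -> : (k%:R * `|x|) ^+ 2 = \sum_(i < k) (k%:R * `|x| ^+ 2).
  by rewrite sumr_const card_ord -mulr_natl; ring.
apply: ler_sum => i _; rewrite -[_ ^+ 2]real_normK ?num_real //.
apply: (@le_trans _ _ (`|x| ^+ 2)); first by rewrite lerXn2r ?nnegrE ?le_normv.
by rewrite ler_peMl ?sqr_ge0 // ler1n (leq_ltn_trans _ (ltn_ord i)).
Qed.

Lemma enorm_ge0 k (x : 'rV[R]_k) : 0 <= enorm x.
Proof. exact: sqrtr_ge0. Qed.

Lemma enorm_eq0 k (x : 'rV[R]_k) : (enorm x == 0) = (x == 0).
Proof. by rewrite sqrtr_eq0 -sqnorm_eq0 eq_le sqnorm_ge0 andbT. Qed.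

Lemma enorm_sqr k (x : 'rV[R]_k) : enorm x ^+ 2 = sqnorm x.
Proof. by rewrite sqr_sqrtr ?sqnorm_ge0. Qed.

Lemma enormZ k (a : R) (x : 'rV[R]_k) : 0 <= a -> enorm (a *: x) = a * enorm x.
Proof.
by move=> a0; rewrite /enorm sqnormZ sqrtrM ?sqr_ge0 // sqrtr_sqr ger0_norm.
Qed.

Lemma sqnorm_ge1 k (x : 'rV[R]_k) : (1 <= sqnorm x) = (1 <= enorm x).
Proof. by rewrite -enorm_sqr expr_ge1 // enorm_ge0. Qed.

Lemma collapse_pt k (x : 'rV[R]_k) : 1 <= enorm x -> collapse x = point.
Proof. by move=> x1; apply: collapse_out; rewrite sqnorm_ge1. Qed.

Lemma collapse_far k (x : 'rV[R]_k) : 1 <= `|x| -> collapse x = point.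
Proof. by move=> x1; apply: collapse_pt; exact: le_trans x1 (le_normv_enorm _). Qed.

Lemma normv_const k (a : R) : 0 <= a -> `|const_mx a : 'rV[R]_k.+1| = a.
Proof.
move=> a0; apply/le_anti/andP; split.
  by apply: normv_le => // i; rewrite mxE ger0_norm.
by have := le_normv (const_mx a : 'rV[R]_k.+1) 0; rewrite mxE ger0_norm.
Qed.

End RowNorms.

(** * The group of amaps *)

Section Amap.
Context (R : realType) (m : nat).
Local Notation S := 'rV[R]_m.+1.
Local Notation T := 'rV[R]_m.+2.

(** Maps are added along [ax]. Commutativity turns them around each other in the plane of [ax] and
    [ax1], which exists since n = m + 2 is at least 2. *)
Definition ax : T := delta_mx 0 0.
Definition ax1 : T := delta_mx 0 (lift 0 0).
Definition refl (t : T) : T := \row_i if i == 0 then - t 0 i else t 0 i.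
(** The sum of a map and its reflection factors through this folding along the wall t_0 = 0, and so
    does the distance to the nearer one of two opposite centres. *)
Definition fold (t : T) : T := \row_i if i == 0 then `|t 0 i| else t 0 i.

Lemma ax0 : ax 0 0 = 1. Proof. by rewrite mxE eqxx. Qed.

Lemma norm_ax (d : R) : 0 <= d -> `|d *: ax| = d.
Proof.
move=> d0; apply/le_anti/andP; split; last first.
  by have := le_normv (d *: ax) 0; rewrite mxE ax0 mulr1 ger0_norm.
apply: normv_le => // i; rewrite !mxE /=.
by case: (i == 0); rewrite ?(mulr1, mulr0) ?normr0 // ger0_norm.
Qed.

Lemma shift_far (t : T) (d r : R) : r + `|d| <= `|t| -> r <= `|t - d *: ax|.
Proof.
move=> h; have := ler_distD (t - d *: ax) t 0; rewrite !subr0 opprD addrA subrr.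
rewrite add0r opprK normrZ => h2.
have a1 : `|ax| = 1 by rewrite -[LHS](congr1 _ (scale1r ax)) norm_ax.
by rewrite a1 mulr1 in h2; lra.
Qed.

Lemma shift_ge (t : T) (d : R) : `|t 0 0 - d| <= `|t - d *: ax|.
Proof. by have := le_normv (t - d *: ax) 0; rewrite !mxE eqxx mulr1. Qed.

Lemma norm_refl (t : T) : `|refl t| = `|t|.
Proof.
apply/le_anti/andP; split; apply: normv_le => // i.
  by rewrite mxE; case: (i == 0); rewrite ?normrN le_normv.
have := le_normv (refl t) i; rewrite mxE.
by case: (i == 0); rewrite ?normrN.
Qed.

Lemma norm_fold (t : T) : `|fold t| = `|t|.
Proof.
apply/le_anti/andP; split; apply: normv_le => // i.
  by rewrite mxE; case: (i == 0); rewrite ?normr_id le_normv.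
have := le_normv (fold t) i; rewrite mxE.
by case: (i == 0); rewrite ?normr_id.
Qed.

Lemma fold_pos (t : T) : 0 <= t 0 0 -> fold t = t.
Proof.
by move=> t0; apply/rowP => i; rewrite mxE; case: eqP => // ->; rewrite ger0_norm.
Qed.

Lemma fold_neg (t : T) : t 0 0 <= 0 -> fold t = refl t.
Proof.
by move=> t0; apply/rowP => i; rewrite !mxE; case: eqP => // ->; rewrite ler0_norm.
Qed.

Lemma fold_shift_neg (t : T) (d : R) :
  t 0 0 <= 0 -> fold t - d *: ax = refl (t + d *: ax).
Proof.
move=> t0; rewrite fold_neg //; apply/rowP => i; rewrite !mxE eqxx /=.
by case: eqP => [->|_]; rewrite ?(mulr1, mulr0); ring.
Qed.

Lemma cts_refl (X : topologicalType) (f : X -> T) :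
  continuous f -> continuous (fun x => refl (f x)).
Proof.
move=> cf; apply: cts_rowP => i.
apply: (@cts_eq _ _ _ (fun x => if i == 0 then - f x 0 i else f x 0 i)).
  by move=> x; rewrite mxE.
by case: (i == 0); lazy iota; cts.
Qed.

Lemma cts_fold (X : topologicalType) (f : X -> T) :
  continuous f -> continuous (fun x => fold (f x)).
Proof.
move=> cf; apply: cts_rowP => i.
apply: (@cts_eq _ _ _ (fun x => if i == 0 then `|f x 0 i| else f x 0 i)).
  by move=> x; rewrite mxE.
by case: (i == 0); lazy iota; cts.
Qed.

Section Target.
Context (Y : ptopologicalType).
Implicit Types f g h : S * T -> Y.

(* The first condition extends f to S x S^n, with the base point as value on
   S x {oo}; the second one then extends it to S^p x S^n. *)
Definition bounded_by (r : R) f :=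
  (forall s t, r <= `|t| -> f (s, t) = point) /\
  (forall s s' t, r <= `|s| -> r <= `|s'| -> f (s, t) = f (s', t)).

Definition is_amap f := continuous f /\ exists r, bounded_by r f.

(** The parameter runs over the whole line, and one radius serves for all its values; by clamping,
    [ahomot_itv] asks for the radius on the unit interval only. *)
Definition ahomot f g := exists H : R * (S * T) -> Y,
  [/\ continuous H, exists r, forall a, bounded_by r (fun x => H (a, x)),
      forall x, H (0, x) = f x & forall x, H (1, x) = g x].

Lemma bounded_by_le r r' f : r <= r' -> bounded_by r f -> bounded_by r' f.
Proof.
move=> rr' [f1 f2]; split=> [s t|s s' t] h; first exact/f1/(le_trans rr').
by move=> h'; apply: f2; apply: le_trans rr' _.
Qed.

Lemma is_amap_rad f : is_amap f -> exists2 r, 1 <= r & bounded_by r f.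
Proof.
move=> [_ [r br]]; exists (Num.max 1 r); first by rewrite le_max lexx.
by apply: bounded_by_le br; rewrite le_max lexx orbT.
Qed.

Lemma is_amap_cst : is_amap (fun=> point).
Proof. by split; [exact: cts_cst|exists 0]. Qed.

Lemma ahomot_itv f g (H : R * (S * T) -> Y) r :
  continuous H -> (forall a, 0 <= a <= 1 -> bounded_by r (fun x => H (a, x))) ->
  (forall x, H (0, x) = f x) -> (forall x, H (1, x) = g x) -> ahomot f g.
Proof.
move=> cH bH H0 H1; exists (fun ax => H (clamp ax.1, ax.2)); split.
- by cts.
- by exists r => a; exact: (bH _ (clamp_itv a)).
- by move=> x /=; rewrite clamp_id ?lexx ?ler01.
- by move=> x /=; rewrite clamp_id ?lexx ?ler01.
Qed.

Lemma ahomot_amap_l f g : ahomot f g -> is_amap f.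
Proof.
move=> [H [cH [r bH] H0 _]]; have -> : f = fun x => H (0, x) by apply/funext.
by split; [cts|exists r].
Qed.

Lemma ahomot_amap_r f g : ahomot f g -> is_amap g.
Proof.
move=> [H [cH [r bH] _ H1]]; have -> : g = fun x => H (1, x) by apply/funext.
by split; [cts|exists r].
Qed.

Definition amap : Type := {f : S * T -> Y | is_amap f}.
HB.instance Definition _ := gen_eqMixin amap.
HB.instance Definition _ := gen_choiceMixin amap.

(** With the generated equivalence no homotopies have to be concatenated, and a function on classes
    only has to be constant along a single homotopy ([acls_lift]). *)
Definition amap_rel (f g : amap) : Prop :=
  Relation_Operators.clos_refl_sym_trans amap
    (fun u v : amap => ahomot (sval u) (sval v)) f g.

Definition amap_relb (f g : amap) : bool := `[< amap_rel f g >].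

Lemma amap_relb_refl : reflexive amap_relb.
Proof. by move=> f; apply/asboolP; exact: Relation_Operators.rst_refl. Qed.

Lemma amap_relb_sym : symmetric amap_relb.
Proof.
by move=> f g; apply/asboolP/asboolP => h; exact: Relation_Operators.rst_sym.
Qed.

Lemma amap_relb_trans : transitive amap_relb.
Proof.
move=> g f h /asboolP fg /asboolP gh; apply/asboolP.
exact: Relation_Operators.rst_trans gh.
Qed.

Canonical amap_equiv : equiv_rel amap :=
  EquivRel amap_relb amap_relb_refl amap_relb_sym amap_relb_trans.

Definition aclasses : Type := {eq_quot amap_equiv}.
HB.instance Definition _ := Choice.on aclasses.
HB.instance Definition _ := EqQuotient.on aclasses.

Definition amk f : amap :=
  match pselect (is_amap f) with
  | left p => exist _ f p
  | right _ => exist _ (fun=> point) is_amap_cst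
  end.

(* The class of the zero map when f is not an amap. *)
Definition acls f : aclasses := \pi_aclasses (amk f).

Lemma sval_amk f : is_amap f -> sval (amk f) = f.
Proof. by rewrite /amk; case: pselect. Qed.

Lemma acls_homot f g : ahomot f g -> acls f = acls g.
Proof.
move=> fg; apply/eqquotP/asboolP/Relation_Operators.rst_step.
by rewrite !sval_amk //; [exact: ahomot_amap_r fg|exact: ahomot_amap_l fg].
Qed.

Definition arep (a : aclasses) : S * T -> Y := sval (repr a).

Lemma arep_amap a : is_amap (arep a).
Proof. exact: (svalP (repr a)). Qed.

Lemma acls_rep a : acls (arep a) = a.
Proof.
rewrite -[RHS]reprK /acls; congr (\pi _).
have: sval (amk (arep a)) = sval (repr a) by rewrite sval_amk //; exact: arep_amap.
by case: (amk _) (repr a) => [u pu] [v pv] /= uv; subst v; congr exist.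
Qed.

Lemma acls_lift (B : Type) (phi : (S * T -> Y) -> B) f g :
  (forall f g, ahomot f g -> phi f = phi g) ->
  is_amap f -> is_amap g -> acls f = acls g -> phi f = phi g.
Proof.
move=> phiH af ag /eqquotP/asboolP fg.
suff /(_ _ _ fg) : forall u v : amap, amap_rel u v -> phi (sval u) = phi (sval v).
  by rewrite !sval_amk.
move=> {fg ag af}f' g'; elim=> {f' g'} [f' g'|f'|f' g' _|f' g' h' _ + _] //.
  exact: phiH.
by move=> -> ->.
Qed.

Lemma acls_eq f g : f =1 g -> acls f = acls g.
Proof. by move=> /funext ->. Qed.

(** Once d bounds the radii of f and g, both shifted maps take the base point on the wall t_0 = 0,
    which makes the sum continuous. *)
Definition addf (d : R) f g (x : S * T) : Y :=
  if 0 <= x.2 0 0 then f (x.1, x.2 - d *: ax) else g (x.1, x.2 + d *: ax).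

Definition oppf f (x : S * T) : Y := f (x.1, refl x.2).

Lemma cts_addf (Z : topologicalType) (d : Z -> R) (F G : Z * (S * T) -> Y) :
  continuous d -> continuous F -> continuous G ->
  (forall z s t, d z <= `|t| -> F (z, (s, t)) = point) ->
  (forall z s t, d z <= `|t| -> G (z, (s, t)) = point) ->
  continuous (fun zx : Z * (S * T) =>
    addf (d zx.1) (fun x => F (zx.1, x)) (fun x => G (zx.1, x)) zx.2).
Proof.
move=> cd cF cG Fd Gd; apply: cts_paste; [by cts|by cts|by cts|].
move=> [z [s t]] /= t0.
rewrite Fd; last by have := shift_ge t (d z); rewrite t0 sub0r normrN; apply: le_trans; exact: ler_norm.
rewrite Gd //; have := shift_ge t (- d z); rewrite t0 scaleNr !opprK add0r.
by apply: le_trans; exact: ler_norm.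
Qed.

Lemma bounded_addf r d f g : 0 <= d -> bounded_by r f -> bounded_by r g ->
  bounded_by (r + d) (addf d f g).
Proof.
move=> d0 [f1 f2] [g1 g2]; split=> [s t|s s' t] h; rewrite /addf /=.
  rewrite f1; last by apply: shift_far; rewrite ger0_norm.
  rewrite g1 ?if_same // -[X in _ + X]opprK -scaleNr.
  by apply: shift_far; rewrite normrN ger0_norm.
have rd : r <= r + d by lra.
move=> h'; case: ifP => _; [apply: f2|apply: g2]; exact: le_trans rd _.
Qed.

Lemma is_amap_addf r d f g : is_amap f -> is_amap g -> 0 <= d -> r <= d ->
  bounded_by r f -> bounded_by r g -> is_amap (addf d f g).
Proof.
move=> [cf _] [cg _] d0 rd bf bg; split; last first.
  by exists (r + d); exact: bounded_addf.
have cA : continuous (fun zx : R * (S * T) => addf d f g zx.2).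
  apply: (@cts_addf R (fun=> d) (fun x => f x.2) (fun x => g x.2)) => [|||z s t h|z s t h] /=.
  - by cts.
  - by cts.
  - by cts.
  - by apply: bf.1; exact: le_trans h.
  - by apply: bg.1; exact: le_trans h.
by apply: (cts_eq _ (@cts_comp _ _ _ (pair (0 : R)) _ (@cts_pairl _ _ _) cA)) => x.
Qed.

Lemma addf_homot (F G : R * (S * T) -> Y) (d : R -> R) r :
  continuous d -> continuous F -> continuous G -> (forall a, 0 <= d a) ->
  (exists K, forall a, 0 <= a <= 1 -> d a <= K) ->
  (forall a, r <= d a) ->
  (forall a, bounded_by r (fun x => F (a, x))) ->
  (forall a, bounded_by r (fun x => G (a, x))) ->
  ahomot (addf (d 0) (fun x => F (0, x)) (fun x => G (0, x)))
         (addf (d 1) (fun x => F (1, x)) (fun x => G (1, x))).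
Proof.
move=> cd cF cG d0 [K dK] rd bF bG.
apply: (@ahomot_itv _ _ (fun zx : R * (S * T) =>
  addf (d zx.1) (fun x => F (zx.1, x)) (fun x => G (zx.1, x)) zx.2) (r + K)) => //.
  apply: cts_addf => // a s t h; first exact: (proj1 (bF a) _ _ (le_trans (rd a) h)).
  exact: (proj1 (bG a) _ _ (le_trans (rd a) h)).
move=> a a01; apply: (@bounded_by_le (r + d a)); first by rewrite lerD2l dK.
exact: (bounded_addf (d0 a) (bF a) (bG a)).
Qed.

End Target.
End Amap.

Section AmapGroup.
Context (R : realType) (m : nat) (Y : ptopologicalType).
Local Notation S := 'rV[R]_m.+1.
Local Notation T := 'rV[R]_m.+2.
Local Notation A := (aclasses R m Y).
Local Notation ax := (ax R m).
Local Notation ax1 := (ax1 R m).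
Implicit Types f g h : S * T -> Y.

(** Some radius rather than the least one: by [addf_dE], the distance at which two maps are added
    does not matter as long as it is large enough. *)
Definition rad f : R := xget 1 [set r | 1 <= r /\ bounded_by r f].

Lemma radP f : is_amap f -> 1 <= rad f /\ bounded_by (rad f) f.
Proof.
move=> /is_amap_rad[r r1 br].
exact: (@xgetPex _ 1 [set r | 1 <= r /\ bounded_by r f]) (ex_intro _ r (conj r1 br)).
Qed.

Definition interp (x y a : R) : R := x + clamp a * (y - x).

Lemma interp0 x y : interp x y 0 = x.
Proof. by rewrite /interp clamp_id ?lexx ?ler01 // mul0r addr0. Qed.

Lemma interp1 x y : interp x y 1 = y.
Proof. by rewrite /interp clamp_id ?lexx ?ler01 // mul1r addrC subrK. Qed.

Lemma interp_itv x y r s a : r <= x <= s -> r <= y <= s -> r <= interp x y a <= s.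
Proof.
move=> /andP[rx xs] /andP[ry ys]; have /andP[c0 c1] := clamp_itv a.
have -> : interp x y a = (1 - clamp a) * x + clamp a * y by rewrite /interp; ring.
by apply/andP; split; nra.
Qed.

Lemma le_interp x y s a : s <= interp x y a -> s <= x \/ s <= y.
Proof.
move=> h; have [?|sx] := lerP s x; first by left.
have [?|sy] := lerP s y; first by right.
have /andP[c0 c1] := clamp_itv a; exfalso.
have : interp x y a <= Num.max x y.
  have l1 : Num.min x y <= x <= Num.max x y by rewrite ge_min le_max lexx.
  have l2 : Num.min x y <= y <= Num.max x y by rewrite ge_min le_max lexx !orbT.
  by have /andP[] := interp_itv a l1 l2.
move=> /(le_trans h); apply/negP; rewrite -ltNge gt_max.
by rewrite sx sy.
Qed.

Lemma cts_interp (X : topologicalType) (u v w : X -> R) :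
  continuous u -> continuous v -> continuous w ->
  continuous (fun x => interp (u x) (v x) (w x)).
Proof. by move=> cu cv cw; rewrite /interp; cts. Qed.

Lemma addf_dE r d d' f g : is_amap f -> is_amap g ->
  bounded_by r f -> bounded_by r g -> 0 <= r -> r <= d -> r <= d' ->
  acls (addf d f g) = acls (addf d' f g).
Proof.
move=> [cf _] [cg _] bf bg r0 rd rd'; apply: acls_homot.
have iP c : r <= interp d d' c <= Num.max d d'.
  by apply: interp_itv; rewrite ?rd ?rd' le_max lexx ?orbT.
have := @addf_homot _ _ _ (fun x => f x.2) (fun x => g x.2) (interp d d') r.
rewrite interp0 interp1; apply => //.
- by apply: cts_interp; cts.
- by cts.
- by cts.
- by move=> c; have /andP[+ _] := iP c; apply: le_trans.
- by exists (Num.max d d') => c _; have /andP[] := iP c.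
- by move=> c; have /andP[] := iP c.
Qed.

Definition addc (a b : A) : A :=
  acls (addf (rad (arep a) + rad (arep b)) (arep a) (arep b)).

Lemma addf_homotl r d f f' g : ahomot f f' -> is_amap g ->
  bounded_by r f -> bounded_by r f' -> bounded_by r g -> 0 <= r -> r <= d ->
  acls (addf d f g) = acls (addf d f' g).
Proof.
move=> ff' ag bf bf' bg r0 rd.
have af := ahomot_amap_l ff'; have af' := ahomot_amap_r ff'.
have [H [cH [s bs] H0 H1]] := ff'; pose D := Num.max r s.
rewrite (@addf_dE r d D f g) ?le_max ?lexx // (@addf_dE r d D f' g) ?le_max ?lexx //.
have cg : continuous g by case: ag.
have := @addf_homot _ _ _ H (fun x => g x.2) (fun=> D) D.
rewrite /= (funext H0 : (fun x => H (0, x)) = f) (funext H1 : (fun x => H (1, x)) = f').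
move=> hh; apply: acls_homot; apply: hh => //.
- by cts.
- by cts.
- by move=> _; rewrite /D le_max r0.
- by exists D.
- by move=> c; apply: bounded_by_le (bs c); rewrite /D le_max lexx orbT.
- by move=> c; apply: bounded_by_le bg; rewrite /D le_max lexx.
Qed.

Lemma addf_homotr r d f g g' : ahomot g g' -> is_amap f ->
  bounded_by r g -> bounded_by r g' -> bounded_by r f -> 0 <= r -> r <= d ->
  acls (addf d f g) = acls (addf d f g').
Proof.
move=> gg' af bg bg' bf r0 rd.
have ag := ahomot_amap_l gg'; have ag' := ahomot_amap_r gg'.
have [H [cH [s bs] H0 H1]] := gg'; pose D := Num.max r s.
rewrite (@addf_dE r d D f g) ?le_max ?lexx // (@addf_dE r d D f g') ?le_max ?lexx //.
have cf : continuous f by case: af.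
have := @addf_homot _ _ _ (fun x => f x.2) H (fun=> D) D.
rewrite /= (funext H0 : (fun x => H (0, x)) = g) (funext H1 : (fun x => H (1, x)) = g').
move=> hh; apply: acls_homot; apply: hh => //.
- by cts.
- by cts.
- by move=> _; rewrite /D le_max r0.
- by exists D.
- by move=> c; apply: bounded_by_le bf; rewrite /D le_max lexx.
- by move=> c; apply: bounded_by_le (bs c); rewrite /D le_max lexx orbT.
Qed.

(** Homotopic maps may have unrelated radii, hence the common distance D in [l] and [l']. One
    summand at a time is then replaced with the representative of its class. *)
Lemma addcE r d f g : is_amap f -> is_amap g ->
  bounded_by r f -> bounded_by r g -> 0 <= r -> r <= d ->
  acls (addf d f g) = addc (acls f) (acls g).
Proof.
move=> af ag bf bg r0 rd.
have aux u v : is_amap u -> is_amap v -> bounded_by (rad u + rad v) u /\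
    bounded_by (rad u + rad v) v.
  move=> /radP[u1 bu] /radP[v1 bv]; split; first by apply: bounded_by_le bu; lra.
  by apply: bounded_by_le bv; lra.
have rp u v : is_amap u -> is_amap v -> 0 <= rad u + rad v.
  by move=> /radP[u1 _] /radP[v1 _]; lra.
transitivity (acls (addf (rad f + rad g) f g)).
  pose D := Num.max d (rad f + rad g); have [bf' bg'] := aux _ _ af ag.
  rewrite (@addf_dE r d D) // ?(le_trans rd) ?le_max ?lexx //.
  by rewrite (@addf_dE (rad f + rad g) _ D) ?rp ?le_max ?lexx ?orbT.
have l u u' v : is_amap v -> ahomot u u' ->
    acls (addf (rad u + rad v) u v) = acls (addf (rad u' + rad v) u' v).
  move=> av uu'; have au := ahomot_amap_l uu'; have au' := ahomot_amap_r uu'.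
  have [bu bv] := aux _ _ au av; have [bu' bv'] := aux _ _ au' av.
  pose D := (rad u + rad v) + (rad u' + rad v).
  have D0 := rp _ _ au av; have D0' := rp _ _ au' av.
  rewrite (@addf_dE (rad u + rad v) _ D u v) ?/D ?lerDl //.
  rewrite (@addf_dE (rad u' + rad v) _ D u' v) ?/D ?lerDr //.
  apply: (@addf_homotl D) => //.
  - by apply: bounded_by_le bu; rewrite /D lerDl.
  - by apply: bounded_by_le bu'; rewrite /D lerDr.
  - by apply: bounded_by_le bv; rewrite /D lerDl.
  - by rewrite /D addr_ge0.
have l' u v v' : is_amap u -> ahomot v v' ->
    acls (addf (rad u + rad v) u v) = acls (addf (rad u + rad v') u v').
  move=> au vv'; have av := ahomot_amap_l vv'; have av' := ahomot_amap_r vv'.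
  have [bu bv] := aux _ _ au av; have [bu' bv'] := aux _ _ au av'.
  pose D := (rad u + rad v) + (rad u + rad v').
  have D0 := rp _ _ au av; have D0' := rp _ _ au av'.
  rewrite (@addf_dE (rad u + rad v) _ D u v) ?/D ?lerDl //.
  rewrite (@addf_dE (rad u + rad v') _ D u v') ?/D ?lerDr //.
  apply: (@addf_homotr D) => //.
  - by apply: bounded_by_le bv; rewrite /D lerDl.
  - by apply: bounded_by_le bv'; rewrite /D lerDr.
  - by apply: bounded_by_le bu; rewrite /D lerDl.
  - by rewrite /D addr_ge0.
rewrite /addc; transitivity (acls (addf (rad (arep (acls f)) + rad g) (arep (acls f)) g)).
  apply: (acls_lift (phi := fun u => acls (addf (rad u + rad g) u g))) => //.
  - by move=> u u'; exact: l.
  - exact: arep_amap.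
  - by rewrite acls_rep.
apply: (acls_lift (phi := fun v => acls (addf (rad (arep (acls f)) + rad v) (arep (acls f)) v))) => //.
- by move=> v v'; apply: l'; exact: arep_amap.
- exact: arep_amap.
- by rewrite acls_rep.
Qed.

Lemma shiftD (t : T) (x y : R) : t - x *: ax - y *: ax = t - (x + y) *: ax.
Proof. by rewrite scalerDl opprD addrA. Qed.

Lemma shift0 (t : T) (x : R) : (t - x *: ax) 0 0 = t 0 0 - x.
Proof. by rewrite !mxE eqxx mulr1. Qed.

Lemma shift0' (t : T) (x : R) : (t + x *: ax) 0 0 = t 0 0 + x.
Proof. by rewrite !mxE eqxx mulr1. Qed.

Lemma shiftN (t : T) (x : R) : t + x *: ax = t - (- x) *: ax.
Proof. by rewrite scaleNr opprK. Qed.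

(** Three maps on a line: the centres 3r, r, -2r with walls 2r, 0 slide to the centres 2r, -r, -3r
    with walls 0, -2r. Each wall stays at distance at least r from the two centres next to it. *)
Lemma addf_assoc r f g h : is_amap f -> is_amap g -> is_amap h -> 1 <= r ->
  bounded_by r f -> bounded_by r g -> bounded_by r h ->
  ahomot (addf (2 * r) (addf r f g) h) (addf (2 * r) f (addf r g h)).
Proof.
move=> [cf _] [cg _] [ch _] r1 bf bg bh.
pose b := interp (2 * r) 0; pose c := interp 0 (- (2 * r)).
pose x1 := interp (3 * r) (2 * r); pose x2 := interp r (- r).
pose x3 := interp (- (2 * r)) (- (3 * r)).
have cb : continuous (fun x : R * (S * T) => b x.1) by apply: cts_interp; cts.
have cc : continuous (fun x : R * (S * T) => c x.1) by apply: cts_interp; cts.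
have cx1 : continuous (fun x : R * (S * T) => x1 x.1) by apply: cts_interp; cts.
have cx2 : continuous (fun x : R * (S * T) => x2 x.1) by apply: cts_interp; cts.
have cx3 : continuous (fun x : R * (S * T) => x3 x.1) by apply: cts_interp; cts.
have sh (t : T) (x y : R) : t 0 0 = y -> r <= `|y - x| -> r <= `|t - x *: ax|.
  by move=> <-; move/le_trans; apply; exact: shift_ge.
have bd (f' : S * T -> Y) (x : R) s t :
    bounded_by r f' -> `|x| <= 3 * r -> 4 * r <= `|t| -> f' (s, t - x *: ax) = point.
  by move=> [f1 _] xr tr; apply: f1; apply: shift_far; lra.
apply: (@ahomot_itv _ _ _ _ _ (fun z : R * (S * T) =>
   if 0 <= z.2.2 0 0 - b z.1 then f (z.2.1, z.2.2 - x1 z.1 *: ax)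
   else if 0 <= z.2.2 0 0 - c z.1 then g (z.2.1, z.2.2 - x2 z.1 *: ax)
   else h (z.2.1, z.2.2 - x3 z.1 *: ax)) (4 * r)).
- apply: cts_paste; [by cts|by cts|apply: cts_paste; [by cts|by cts|by cts|]|].
    move=> [a [s t]] /= /subr0_eq t0; rewrite (proj1 bg) ?(proj1 bh) //; apply: (sh _ _ _ t0);
      rewrite /c /x2 /x3 /interp; have /andP[a0 a1] := clamp_itv a;
      rewrite ler_normr; apply/orP; [left|right]; nra.
  move=> [a [s t]] /= /subr0_eq t0; have /andP[a0 a1] := clamp_itv a.
  rewrite (proj1 bf); last first.
    by apply: (sh _ _ _ t0); rewrite /b /x1 /interp ler_normr; apply/orP; right; nra.
  rewrite ifT; last by rewrite t0 /b /c /interp; nra.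
  rewrite (proj1 bg) //; apply: (sh _ _ _ t0).
  by rewrite /b /x2 /interp ler_normr; apply/orP; left; nra.
- move=> a /andP[a0 a1]; split=> [s t|s s' t] hs /=; last first.
    move=> hs'; have rr : r <= 4 * r by lra.
    have hs1 := le_trans rr hs; have hs1' := le_trans rr hs'.
    by case: ifP => _; [apply: bf.2|case: ifP => _; [apply: bg.2|apply: bh.2]].
  have [x1r x2r x3r] : [/\ `|x1 a| <= 3 * r, `|x2 a| <= 3 * r & `|x3 a| <= 3 * r].
    by rewrite /x1 /x2 /x3 /interp clamp_id ?a0 //; split;
      rewrite ler_norml; apply/andP; split; nra.
  by rewrite !bd // !if_same.
- move=> [s t]; rewrite /addf /= /b /c /x1 /x2 /x3 !interp0 !subr0 shiftD shift0 !shiftN.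
  rewrite -[t - _ - _]addrA -opprD -scalerDl subr_ge0.
  have -> : 2 * r + r = 3 * r by ring.
  have -> : 2 * r - r = r by ring.
  by case: (lerP (2 * r) (t 0 0)) => // h1; rewrite ifT //; lra.
move=> [s t]; rewrite /addf /= /b /c /x1 /x2 /x3 !interp1 !subr0 !opprK shift0'.
rewrite !shiftN !shiftD.
have -> : - (2 * r) + r = - r by ring.
have -> : - (2 * r) - r = - (3 * r) by ring.
by [].
Qed.

Lemma addcA : associative addc.
Proof.
move=> a b c; rewrite -(acls_rep a) -(acls_rep b) -(acls_rep c).
have af := arep_amap a; have ag := arep_amap b; have ah := arep_amap c.
set f := arep a in af *; set g := arep b in ag *; set h := arep c in ah *.
pose r := rad f + rad g + rad h.
have [[f1 bf] [g1 bg] [h1 bh]] := And3 (radP af) (radP ag) (radP ah).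
have bf' : bounded_by r f by apply: bounded_by_le bf; rewrite /r; lra.
have bg' : bounded_by r g by apply: bounded_by_le bg; rewrite /r; lra.
have bh' : bounded_by r h by apply: bounded_by_le bh; rewrite /r; lra.
have r1 : 1 <= r by rewrite /r; lra.
have r0 : 0 <= r by lra.
have rr : r + r <= 2 * r by lra.
have rr0 : 0 <= r + r by lra.
have e := acls_homot (addf_assoc af ag ah r1 bf' bg' bh').
have le2 u : bounded_by r u -> bounded_by (r + r) u.
  by apply: bounded_by_le; lra.
have afg := is_amap_addf af ag r0 (lexx r) bf' bg'.
have agh := is_amap_addf ag ah r0 (lexx r) bg' bh'.
have e1 := addcE afg ah (bounded_addf r0 bf' bg') (le2 _ _ _ bh') rr0 rr.
have e2 := addcE af agh (le2 _ _ _ bf') (bounded_addf r0 bg' bh') rr0 rr.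
have e3 := addcE af ag bf' bg' r0 (lexx r).
have e4 := addcE ag ah bg' bh' r0 (lexx r).
have assoc (u v x y a' b' c' : A) : u = v -> u = addc x c' -> v = addc a' y ->
    x = addc a' b' -> y = addc b' c' -> addc a' (addc b' c') = addc (addc a' b') c'.
  by move=> -> -> xy hx hy; rewrite -hx -hy xy.
exact: assoc e e1 e2 e3 e4.
Qed.

End AmapGroup.

Section AmapZmodule.
Context (R : realType) (m : nat) (Y : ptopologicalType).
Local Notation S := 'rV[R]_m.+1.
Local Notation T := 'rV[R]_m.+2.
Local Notation A := (aclasses R m Y).
Local Notation ax := (ax R m).
Local Notation ax1 := (ax1 R m).
Implicit Types f g h : S * T -> Y.

Lemma add0f_homot r f : is_amap f -> bounded_by r f -> 1 <= r ->
  ahomot (addf r (fun=> point) f) f.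
Proof.
move=> [cf _] bf r1.
apply: (@ahomot_itv _ _ _ _ _ (fun z : R * (S * T) =>
  f (z.2.1, z.2.2 - interp (- r) 0 z.1 *: ax)) (2 * r)) => [|c c01|[s t]|[s t]] /=.
- by rewrite /interp; cts.
- have /andP[c0 c1] := c01; have [ic0 ic1] : - r <= interp (- r) 0 c /\ interp (- r) 0 c <= 0.
    by rewrite /interp clamp_id //; split; nra.
  split=> [s t h|s s' t h h'] /=; last by apply: bf.2; lra.
  by apply: bf.1; apply: shift_far; rewrite ler0_norm; lra.
- rewrite interp0 -shiftN /addf /=; case: ifP => // t0; apply: bf.1.
  rewrite shiftN; apply: le_trans (shift_ge _ _); rewrite opprK ger0_norm; lra.
- by rewrite interp1 scale0r subr0.
Qed.

Lemma is_amap_oppf f : is_amap f -> is_amap (oppf f).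
Proof.
move=> [cf [r bf]]; split.
  have cr : continuous (fun x : S * T => refl x.2) by apply: cts_refl; cts.
  by rewrite /oppf; cts.
by exists r; split=> [s t h|s s' t h h']; [apply: bf.1; rewrite norm_refl|apply: bf.2].
Qed.

Lemma bounded_oppf r f : bounded_by r f -> bounded_by r (oppf f).
Proof.
by move=> bf; split=> [s t h|s s' t h h']; [apply: bf.1; rewrite norm_refl|apply: bf.2].
Qed.

Lemma oppf_homot f g : ahomot f g -> ahomot (oppf f) (oppf g).
Proof.
move=> [H [cH [r bH] H0 H1]].
exists (fun z : R * (S * T) => H (z.1, (z.2.1, refl z.2.2))); split=> [||x|x].
- have cr : continuous (fun x : R * (S * T) => refl x.2.2) by apply: cts_refl; cts.
  by cts.
- by exists r => c; exact: (bounded_oppf (bH c)).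
- by rewrite H0.
- by rewrite H1.
Qed.

Lemma addf_oppE d f s t : addf d f (oppf f) (s, t) = f (s, fold t - d *: ax).
Proof.
rewrite /addf /oppf /=; case: ifP => t0; first by rewrite fold_pos.
by rewrite fold_shift_neg // ltW // ltNge t0.
Qed.

(** By [addf_oppE] the sum is f after a folding. Moving the centre from r to -r takes the support of
    f out of the half space in which the folding has its values. *)
Lemma addfN_homot r f : is_amap f -> bounded_by r f -> 1 <= r ->
  ahomot (addf r f (oppf f)) (fun=> point).
Proof.
move=> [cf _] bf r1.
have cF : continuous (fun z : R * (S * T) => fold z.2.2) by apply: cts_fold; cts.
apply: (@ahomot_itv _ _ _ _ _ (fun z : R * (S * T) =>
  f (z.2.1, fold z.2.2 - interp r (- r) z.1 *: ax)) (2 * r)) => [|c c01|[s t]|[s t]] /=.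
- by rewrite /interp; cts.
- have /andP[c0 c1] := c01; have [ic0 ic1] : - r <= interp r (- r) c /\ interp r (- r) c <= r.
    by rewrite /interp clamp_id //; split; nra.
  split=> [s t h|s s' t h h'] /=; last by apply: bf.2; lra.
  apply: bf.1; apply: shift_far; rewrite norm_fold.
  have : `|interp r (- r) c| <= r by rewrite ler_norml ic0.
  by lra.
- by rewrite interp0 addf_oppE.
- rewrite interp1; apply: bf.1; apply: le_trans (shift_ge _ _).
  rewrite mxE eqxx opprK ger0_norm; have := normr_ge0 (t 0 0); lra.
Qed.

Definition dot2 (t : T) (x y : R) : R := t 0 0 * x + t 0 (lift 0 0) * y.

(** In the plane of the two axes, the line orthogonal to w = (x, y) has Euclidean distance |w| from
    w; the factor 2 passes to the maximum norm. *)
Lemma dot2_far (t : T) (x y r : R) : dot2 t x y = 0 -> 0 <= r ->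
  2 * r ^+ 2 <= x ^+ 2 + y ^+ 2 -> r <= `|t - (x *: ax + y *: ax1)|.
Proof.
move=> txy r0 rxy; set v := t - _.
have v0 : v 0 0 = t 0 0 - x.
  by rewrite /v !mxE !eqxx /= mulr1 mulr0 addr0.
have v1 : v 0 (lift 0 0) = t 0 (lift 0 0) - y.
  by rewrite /v !mxE !eqxx /= mulr1 mulr0 add0r.
rewrite leNgt; apply/negP => vr.
have h0 : `|v 0 0| < r := le_lt_trans (le_normv v 0) vr.
have h1 : `|v 0 (lift 0 0)| < r := le_lt_trans (le_normv v _) vr.
have sq (z : R) : `|z| < r -> z ^+ 2 < r ^+ 2.
  by move=> zr; rewrite -real_normK ?num_real // ltrXn2r.
have := sq _ h0; have := sq _ h1; rewrite v0 v1.
move: txy; rewrite /dot2; set a := t 0 0; set b := t 0 _ => txy.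
have := sqr_ge0 a; have := sqr_ge0 b; nra.
Qed.

Lemma cts_dot2 (X : topologicalType) (f : X -> T) (u v : X -> R) :
  continuous f -> continuous u -> continuous v ->
  continuous (fun x => dot2 (f x) (u x) (v x)).
Proof. by move=> cf cu cv; rewrite /dot2; cts. Qed.

Lemma addfC_homot r f g : is_amap f -> is_amap g ->
  bounded_by r f -> bounded_by r g -> 1 <= r ->
  ahomot (addf (2 * r) f g) (addf (2 * r) g f).
Proof.
move=> [cf _] [cg _] bf bg r1.
(* The centres w and -w change places along parabolas instead of half circles, which avoids
   trigonometry; |w|^2 >= 3 r^2 all the way, and the wall stays orthogonal to w. *)
pose u (c : R) : R := 2 * r * (1 - 2 * clamp c).
pose v (c : R) : R := 2 * r * (4 * clamp c * (1 - clamp c)).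
pose w c : T := u c *: ax + v c *: ax1.
have uv c : 2 * r ^+ 2 <= u c ^+ 2 + v c ^+ 2.
  have /andP[c0 c1] := clamp_itv c; set x := clamp c * (1 - clamp c).
  have -> : u c ^+ 2 + v c ^+ 2 = 4 * r ^+ 2 * (1 - 4 * x + 16 * x ^+ 2).
    by rewrite /u /v /x; ring.
  have : 3 / 4 <= 1 - 4 * x + 16 * x ^+ 2 by have := sqr_ge0 (4 * x - 1 / 2); lra.
  have : 0 <= r ^+ 2 := sqr_ge0 r.
  by move: (1 - 4 * x + _) => y; nra.
have far c (t : T) : dot2 t (u c) (v c) = 0 ->
    r <= `|t - w c| /\ r <= `|t + w c|.
  move=> h; split; first by apply: dot2_far => //; lra.
  have -> : t + w c = t - ((- u c) *: ax + (- v c) *: ax1).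
    by rewrite !scaleNr -opprD opprK.
  by apply: dot2_far; [rewrite /dot2 in h *; lra|lra|rewrite !sqrrN].
have cu : continuous (fun x : R * (S * T) => u x.1) by rewrite /u; cts.
have cv : continuous (fun x : R * (S * T) => v x.1) by rewrite /v; cts.
have cw : continuous (fun x : R * (S * T) => w x.1) by rewrite /w; cts.
have wr c : `|w c| <= 4 * r.
  have /andP[c0 c1] := clamp_itv c; apply: (le_trans (ler_normD _ _)).
  have a1 : `|ax| = 1 by rewrite -[LHS](congr1 _ (scale1r ax)) norm_ax.
  have b1 : `|ax1| <= 1.
    by apply: normv_le => // i; rewrite mxE; case: andP; rewrite ?normr1 ?normr0.
  have : `|u c *: ax| <= 2 * r.
    by rewrite normrZ a1 mulr1 ler_norml /u; apply/andP; split; nra.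
  have : `|v c *: ax1| <= 2 * r.
    rewrite normrZ; apply: (@le_trans _ _ (`|v c| * 1)); first by rewrite ler_wpM2l.
    rewrite mulr1 ler_norml /v.
    have x1 : 4 * clamp c * (1 - clamp c) <= 1 by have := sqr_ge0 (2 * clamp c - 1); lra.
    have x0 : 0 <= 4 * clamp c * (1 - clamp c) by rewrite !mulr_ge0 // subr_ge0.
    by move: (4 * _ * _) x0 x1 => x x0 x1; apply/andP; split; nra.
  lra.
have bd (f' : S * T -> Y) s (t w' : T) :
    bounded_by r f' -> `|w'| <= 4 * r -> 5 * r <= `|t| -> f' (s, t - w') = point.
  move=> [f1 _] xr tr; apply: f1.
  by have := lerB_normD t (- w'); rewrite normrN; lra.
apply: (@ahomot_itv _ _ _ _ _ (fun z : R * (S * T) =>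
  if 0 <= dot2 z.2.2 (u z.1) (v z.1) then f (z.2.1, z.2.2 - w z.1)
  else g (z.2.1, z.2.2 + w z.1)) (5 * r)).
- apply: cts_paste; [by apply: cts_dot2; cts|by cts|by cts|].
  by move=> [c [s t]] /= /far[h1 h2]; rewrite bf.1 // bg.1.
- move=> c _; split=> [s t h|s s' t h h'] /=; last first.
    have rr : r <= 5 * r by lra.
    by case: ifP => _; [apply: bf.2|apply: bg.2]; apply: (le_trans rr).
  rewrite bd // -[w c]opprK bd ?normrN // if_same //.
- move=> [s t]; rewrite /addf /= /dot2 /w /u /v clamp_id ?lexx ?ler01 //.
  rewrite !(mulr0, mul0r, subr0, scale0r, addr0, mulr1).
  by rewrite pmulr_lge0 //; lra.
move=> [s t]; rewrite /addf /= /dot2 /w /u /v clamp_id ?lexx ?ler01 //.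
rewrite subrr !(mulr0, mul0r, scale0r, addr0, mulr1).
have -> : 2 * r * (1 - 2) = - (2 * r) by ring.
rewrite !scaleNr opprK.
case: (ltrgtP (t 0 0) 0) => t0.
- by rewrite ifT //; nra.
- by rewrite ifF //; apply/negbTE; rewrite -ltNge; nra.
rewrite t0 mul0r lexx bf.1 ?bg.1 //.
  by have := shift_ge t (2 * r); rewrite t0 sub0r normrN ger0_norm; lra.
by rewrite shiftN; have := shift_ge t (- (2 * r)); rewrite t0 sub0r opprK ger0_norm; lra.
Qed.

Lemma addcC : commutative (@addc R m Y).
Proof.
move=> a b; rewrite -(acls_rep a) -(acls_rep b).
have af := arep_amap a; have ag := arep_amap b.
set f := arep a in af *; set g := arep b in ag *.
have [[f1 bf] [g1 bg]] := (radP af, radP ag); pose r := rad f + rad g.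
have bf' : bounded_by r f by apply: bounded_by_le bf; rewrite /r; lra.
have bg' : bounded_by r g by apply: bounded_by_le bg; rewrite /r; lra.
have r1 : 1 <= r by rewrite /r; lra.
have /acls_homot := addfC_homot af ag bf' bg' r1.
by rewrite !(@addcE _ _ _ r (2 * r)) //; lra.
Qed.

Definition zeroc : A := acls (fun=> point).
Definition oppc (a : A) : A := acls (oppf (arep a)).

Lemma add0c : left_id zeroc (@addc R m Y).
Proof.
move=> a; rewrite -(acls_rep a); have af := arep_amap a.
have [f1 bf] := radP af; rewrite -(@addcE _ _ _ (rad (arep a)) (rad (arep a))) //.
- by apply/acls_homot/add0f_homot.
- exact: is_amap_cst.
- lra.
Qed.

Lemma oppcE f : is_amap f -> acls (oppf f) = oppc (acls f).
Proof.
move=> af; apply: (acls_lift (phi := fun g => acls (oppf g))) => //.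
- by move=> u v uv; apply/acls_homot/oppf_homot.
- exact: arep_amap.
- by rewrite acls_rep.
Qed.

Lemma addcN : left_inverse zeroc oppc (@addc R m Y).
Proof.
move=> a; rewrite addcC -(acls_rep a); have af := arep_amap a.
have [f1 bf] := radP af; rewrite -oppcE //.
rewrite -(@addcE _ _ _ (rad (arep a)) (rad (arep a))) //; last 3 first.
- exact: is_amap_oppf.
- exact: bounded_oppf.
- lra.
exact/acls_homot/addfN_homot.
Qed.

HB.instance Definition _ :=
  GRing.isZmodule.Build (aclasses R m Y) (@addcA R m Y) addcC add0c addcN.

Lemma acls_add r d f g : is_amap f -> is_amap g ->
  bounded_by r f -> bounded_by r g -> 0 <= r -> r <= d ->
  acls (addf d f g) = acls f + acls g.
Proof. exact: addcE. Qed.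

Lemma acls_opp f : is_amap f -> acls (oppf f) = - acls f.
Proof. exact: oppcE. Qed.

Lemma acls_point : acls (fun=> point) = 0 :> A.
Proof. by []. Qed.

End AmapZmodule.

(** * From amaps to maps of the product of spheres *)

Section TotalPointedMaps.
Context (R : realType) (X Y : ptopologicalType).

(* The constant map when g is not continuous or not pointed. *)
Definition mkp (g : X -> Y) : pointed_map X Y :=
  match pselect (continuous g /\ g point = point) with
  | left p => PMap p.1 p.2
  | right _ => pointed_const X Y
  end.

Lemma mkpE (g : X -> Y) : continuous g -> g point = point -> mkp g = g :> (X -> Y).
Proof. by move=> cg gp; rewrite /mkp; case: pselect => // -[]. Qed.

Lemma mkp_pmap (g : pointed_map X Y) : hclass R (mkp g) = hclass R g.
Proof.
apply/hclassP/homotopicP; exists (fun xt => g xt.1).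
have cg := @pmap_cts _ _ g; split=> [|x|x|t]; rewrite ?mkpE ?pmap_pt //.
by cts.
Qed.

Lemma hclass_homot (f g : pointed_map X Y) (H : R * X -> Y) :
  continuous H -> (forall c, H (c, point) = point) ->
  (forall x, H (0, x) = f x) -> (forall x, H (1, x) = g x) ->
  hclass R f = hclass R g.
Proof.
move=> cH Hp H0 H1; apply/hclassP/homotopicP.
by exists (fun xt => H (xt.2, xt.1)); split=> //; cts.
Qed.

Lemma mkp_homot (f g : X -> Y) (H : R * X -> Y) :
  continuous H -> (forall c, H (c, point) = point) ->
  (forall x, H (0, x) = f x) -> (forall x, H (1, x) = g x) ->
  hclass R (mkp f) = hclass R (mkp g).
Proof.
move=> cH Hp H0 H1; have sec c : continuous (fun x => H (c, x)) by cts.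
have Ef : f = fun x => H (0, x) by apply/funext => x.
have Eg : g = fun x => H (1, x) by apply/funext => x.
by rewrite Ef Eg; apply: (hclass_homot cH Hp) => x; rewrite mkpE.
Qed.

End TotalPointedMaps.

Section SphereChart.
Context (R : realType).

Definition headv k (x : sphere R k) : R := svec x 0 0.
Definition tailv k (x : sphere R k) : 'rV[R]_k := \row_i svec x 0 (lift 0 i).

Lemma head_tail k (x : sphere R k) : headv x ^+ 2 + sqnorm (tailv x) = 1.
Proof.
rewrite -(svec_sqnorm x) {2}/sqnorm big_ord_recl; congr (_ + _).
by apply: eq_bigr => i _; rewrite mxE.
Qed.

Lemma headv_pt k : headv (point : sphere R k) = 1.
Proof. by rewrite /headv svecpt mxE. Qed.

Lemma cts_headv (X : topologicalType) k (f : X -> sphere R k) :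
  continuous f -> continuous (fun x => headv (f x)).
Proof. by move=> cf; rewrite /headv; cts. Qed.

Lemma cts_tailv (X : topologicalType) k (f : X -> sphere R k) :
  continuous f -> continuous (fun x => tailv (f x)).
Proof.
move=> cf; apply: cts_rowP => i.
apply: (@cts_eq _ _ _ (fun x => svec (f x) 0 (lift 0 i))) => [x|]; first by rewrite mxE.
by cts.
Qed.

(* The southern hemisphere is scaled to a ball of radius lam, and the northern
   one goes to a point at distance lam. *)
Definition zeta k (lam : R) (x : sphere R k) : 'rV[R]_k :=
  if headv x <= 0 then lam *: tailv x else const_mx lam.

Lemma equator_norm k (x : sphere R k) : headv x = 0 -> 1 <= k%:R * `|tailv x|.
Proof.
move=> x0; apply: le_trans (le_enorm_normv _).
by rewrite -sqnorm_ge1 -(head_tail x) x0 expr0n /= add0r.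
Qed.

End SphereChart.

Section Phi.
Context (R : realType) (m : nat) (Y : ptopologicalType).
Local Notation S := 'rV[R]_m.+1.
Local Notation T := 'rV[R]_m.+2.
Local Notation X := (sphere R m.+1 * sphere R m.+2)%type.
Implicit Types f g : S * T -> Y.

(** Such an f still extends to S^p x S^n, but S^p x pt may go anywhere as long as its base point is
    respected. Homotopies that leave A(Y) pass through these maps. *)
Definition wbounded_by (r : R) f :=
  [/\ forall s t t', r <= `|t| -> r <= `|t'| -> f (s, t) = f (s, t'),
      forall s s' t, r <= `|s| -> r <= `|s'| -> f (s, t) = f (s', t) &
      forall s t, r <= `|s| -> r <= `|t| -> f (s, t) = point].

Lemma bounded_wbounded r f : bounded_by r f -> wbounded_by r f.
Proof.
by move=> [f1 f2]; split=> // [s t t' h h'|s t _ h]; rewrite !f1.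
Qed.

Lemma wbounded_by_le r r' f : r <= r' -> wbounded_by r f -> wbounded_by r' f.
Proof.
move=> rr' [f1 f2 f3]; split=> [s t t'|s s' t|s t] h h'; [apply: f1|apply: f2|apply: f3];
  exact: le_trans rr' _.
Qed.

Definition Phi (lam : R) f (x : X) : Y := f (zeta lam x.1, zeta lam x.2).

Lemma equator_far k (x : sphere R k) (lam r : R) : (k <= m.+2)%N ->
  0 <= r -> (m.+2)%:R * r <= lam -> headv x = 0 -> r <= `|lam *: tailv x|.
Proof.
move=> km r0 rl x0; have h := equator_norm x0; rewrite normrZ.
have kr : (k%:R : R) <= (m.+2)%:R by rewrite ler_nat.
have t0 := normr_ge0 (tailv x); have k0 : (0 : R) <= k%:R by rewrite ler0n.
have l0 : 0 <= lam by apply: le_trans rl; rewrite mulr_ge0.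
rewrite ger0_norm //.
have : (m.+2)%:R * r * `|tailv x| <= lam * `|tailv x| by rewrite ler_wpM2r.
apply: le_trans; rewrite mulrAC -[leLHS]mul1r ler_wpM2r //.
by apply: (le_trans h); rewrite ler_wpM2r.
Qed.

Lemma const_far k (lam r : R) : 0 <= r -> (m.+2)%:R * r <= lam ->
  r <= `|const_mx lam : 'rV[R]_k.+1|.
Proof.
move=> r0 rl; have h : r <= lam.
  by apply: le_trans rl; rewrite ler_peMl // ler1n.
by rewrite normv_const // (le_trans r0).
Qed.

(** On an equator the scaled tail has norm at least r z, where F no longer depends on that variable;
    it can be exchanged there for the constant vector used on the northern hemisphere. *)
Lemma cts_Phi (Z : topologicalType) (lam r : Z -> R) (F : Z * (S * T) -> Y) :
  continuous lam -> continuous F ->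
  (forall z, wbounded_by (r z) (fun x => F (z, x))) ->
  (forall z, 0 <= r z) -> (forall z, (m.+2)%:R * r z <= lam z) ->
  continuous (fun zx : Z * X => Phi (lam zx.1) (fun x => F (zx.1, x)) zx.2).
Proof.
move=> cl cF bF r0 rl.
have cc k : continuous (fun zx : Z * X => const_mx (lam zx.1) : 'rV[R]_k).
  apply: cts_rowP => i; apply: (@cts_eq _ _ _ (fun zx => lam zx.1)) => [x|].
    by rewrite mxE.
  by cts.
have cc1 := cc m.+1; have cc2 := cc m.+2.
have ct1 : continuous (fun zx : Z * X => tailv zx.2.1) by apply: cts_tailv; cts.
have ct2 : continuous (fun zx : Z * X => tailv zx.2.2) by apply: cts_tailv; cts.
have ch1 : continuous (fun zx : Z * X => headv zx.2.1) by apply: cts_headv; cts.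
have ch2 : continuous (fun zx : Z * X => headv zx.2.2) by apply: cts_headv; cts.
apply: (@cts_eq _ _ _ (fun zx : Z * X =>
  if headv zx.2.1 <= 0 then
    (if headv zx.2.2 <= 0 then F (zx.1, (lam zx.1 *: tailv zx.2.1, lam zx.1 *: tailv zx.2.2))
     else F (zx.1, (lam zx.1 *: tailv zx.2.1, const_mx (lam zx.1))))
  else (if headv zx.2.2 <= 0 then F (zx.1, (const_mx (lam zx.1), lam zx.1 *: tailv zx.2.2))
     else F (zx.1, (const_mx (lam zx.1), const_mx (lam zx.1)))))).
  by move=> [z [x y]]; rewrite /Phi /zeta /=; case: ifP => _; case: ifP => _.
apply: cts_if; [by cts|apply: cts_if; [by cts|by cts|by cts|]|apply: cts_if; [by cts|by cts|by cts|]|].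
- move=> [z [x y]] /= y0; case: (bF z) => b1 _ _.
  by apply: b1; [apply: equator_far|apply: const_far].
- move=> [z [x y]] /= y0; case: (bF z) => b1 _ _.
  by apply: b1; [apply: equator_far|apply: const_far].
- move=> [z [x y]] /= x0; case: (bF z) => _ b2 _.
  by case: ifP => _; apply: b2; [apply: equator_far|apply: const_far|apply: equator_far|apply: const_far].
Qed.

Lemma Phi_pt (lam r : R) f : wbounded_by r f -> 0 <= r -> (m.+2)%:R * r <= lam ->
  Phi lam f point = point.
Proof.
move=> [_ _ f3] r0 rl; rewrite /Phi /zeta !headv_pt leNgt ltr01 /=.
by apply: f3; exact: const_far.
Qed.

Definition is_wamap f := continuous f /\ exists r, wbounded_by r f.

Definition wrad f : R := xget 1 [set r | 1 <= r /\ wbounded_by r f].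

Lemma wradP f : is_wamap f -> 1 <= wrad f /\ wbounded_by (wrad f) f.
Proof.
move=> [_ [r br]].
apply: (@xgetPex _ 1 [set r | 1 <= r /\ wbounded_by r f]).
exists (Num.max 1 r); split; first by rewrite le_max lexx.
by apply: wbounded_by_le br; rewrite le_max lexx orbT.
Qed.

Definition Phicls f : hclasses R X Y := hclass R (mkp (Phi ((m.+2)%:R * wrad f) f)).

Lemma Phi_lamE (lam lam' r r' : R) f : continuous f ->
  wbounded_by r f -> wbounded_by r' f -> 0 <= r -> 0 <= r' ->
  (m.+2)%:R * r <= lam -> (m.+2)%:R * r' <= lam' ->
  hclass R (mkp (Phi lam f)) = hclass R (mkp (Phi lam' f)).
Proof.
move=> cf bf bf' r0 r0' rl rl'.
wlog rr' : lam lam' r r' bf bf' r0 r0' rl rl' / r <= r'.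
  move=> hw; have [h|/ltW h] := lerP r r'; first exact: (hw _ _ r r').
  by apply/esym; exact: (hw _ _ r' r).
have rlam' : (m.+2)%:R * r <= lam' by apply: le_trans rl'; rewrite ler_wpM2l.
have iP c : (m.+2)%:R * r <= interp lam lam' c <= Num.max lam lam'.
  by apply: interp_itv; rewrite ?rl ?rlam' le_max lexx ?orbT.
apply: (@mkp_homot _ _ _ _ _ (fun zx : R * X =>
  Phi (interp lam lam' zx.1) (fun x => f x) zx.2)) => [|c|x|x].
- apply: (@cts_Phi R (interp lam lam') (fun=> r) (fun x => f x.2)) => //.
  + by apply: cts_interp; cts.
  + by cts.
  + by move=> c; have /andP[] := iP c.
- by apply: (Phi_pt bf) => //; have /andP[] := iP c.
- by rewrite /= interp0.
- by rewrite /= interp1.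
Qed.

Lemma PhiclsE (lam r : R) f : continuous f -> wbounded_by r f -> 0 <= r ->
  (m.+2)%:R * r <= lam -> Phicls f = hclass R (mkp (Phi lam f)).
Proof.
move=> cf bf r0 rl; have [f1 bf'] : 1 <= wrad f /\ wbounded_by (wrad f) f.
  by apply: wradP; split=> //; exists r.
by apply: Phi_lamE bf' bf _ _ _ _ => //; lra.
Qed.

Lemma Phicls_homot (H : R * (S * T) -> Y) r f g : continuous H ->
  (forall c, 0 <= c <= 1 -> wbounded_by r (fun x => H (c, x))) ->
  (forall x, H (0, x) = f x) -> (forall x, H (1, x) = g x) ->
  Phicls f = Phicls g.
Proof.
move=> cH bH H0 H1; pose r' := Num.max 0 r.
have r0' : 0 <= r' by rewrite /r' le_max lexx.
pose K (cx : R * (S * T)) := H (clamp cx.1, cx.2).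
have bK c : wbounded_by r' (fun x => K (c, x)).
  apply: (@wbounded_by_le r); first by rewrite /r' le_max lexx orbT.
  exact: (bH _ (clamp_itv c)).
have cK : continuous K by rewrite /K; cts.
have cl0 : clamp (0 : R) = 0 by rewrite clamp_id // lexx ler01.
have cl1 : clamp (1 : R) = 1 by rewrite clamp_id // lexx ler01.
have Ef : f = fun x => K (0, x) by apply/funext => x; rewrite /K /= cl0.
have Eg : g = fun x => K (1, x) by apply/funext => x; rewrite /K /= cl1.
have bf : wbounded_by r' f by rewrite Ef.
have bg : wbounded_by r' g by rewrite Eg.
have cf : continuous f by rewrite Ef; cts.
have cg : continuous g by rewrite Eg; cts.
rewrite (PhiclsE cf bf r0' (lexx _)) (PhiclsE cg bg r0' (lexx _)).
apply: (@mkp_homot _ _ _ _ _ (fun zx : R * X =>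
  Phi ((m.+2)%:R * r') (fun x => K (zx.1, x)) zx.2)) => [|c|x|x].
- by apply: (@cts_Phi R (fun=> (m.+2)%:R * r') (fun=> r') K) => //; cts.
- exact: (Phi_pt (bK c)).
- by rewrite Ef.
- by rewrite Eg.
Qed.

Lemma Phicls_ahomot f g : ahomot f g -> Phicls f = Phicls g.
Proof.
move=> [H [cH [r bH] H0 H1]]; apply: (@Phicls_homot H r) => // c _.
exact: bounded_wbounded (bH c).
Qed.

Definition phi (a : aclasses R m Y) : hclasses R X Y := Phicls (arep a).

Lemma phiE f : is_amap f -> phi (acls f) = Phicls f.
Proof.
move=> af; apply: (acls_lift (phi := Phicls)) => //.
- exact: Phicls_ahomot.
- exact: arep_amap.
- exact: acls_rep.
Qed.

End Phi.

(** * The action of loops on amaps *)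

Section Whisker.
Context (R : realType) (m : nat) (Y : ptopologicalType).
Local Notation S := 'rV[R]_m.+1.
Local Notation T := 'rV[R]_m.+2.
Local Notation ax := (ax R m).
Local Notation A := (aclasses R m Y).
Implicit Types (f g : S * T -> Y) (G : R * S -> Y) (h : T -> R).

(** G stands for a pointed map of S^{p+1}, read in a chart R x R^p whose first coordinate becomes
    the direction across the collar. *)
Definition gbounded (c : R) G :=
  forall x s, c <= `|x| \/ c <= `|s| -> G (x, s) = point.

Definition is_gmap G := continuous G /\ exists c, gbounded c G.

Definition ghomot G G' := exists K : R * (R * S) -> Y,
  [/\ continuous K, exists c, forall a, gbounded c (fun x => K (a, x)),
      forall x, K (0, x) = G x & forall x, K (1, x) = G' x].

Definition grad G : R := xget 1 [set c | 1 <= c /\ gbounded c G].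

Lemma gbounded_le c c' G : c <= c' -> gbounded c G -> gbounded c' G.
Proof.
by move=> cc bG x s [h|h]; apply: bG; [left|right]; exact: le_trans h.
Qed.

Lemma gradP G : is_gmap G -> 1 <= grad G /\ gbounded (grad G) G.
Proof.
move=> [_ [c bc]].
apply: (@xgetPex _ 1 [set c | 1 <= c /\ gbounded c G]).
exists (Num.max 1 c); split; first by rewrite le_max lexx.
by apply: gbounded_le bc; rewrite le_max lexx orbT.
Qed.

(* f is surrounded by the loops x |-> G (x, s), travelled along the levels of h. *)
Definition whisk (c : R) h G f (x : S * T) : Y :=
  if h x.2 + c <= 0 then f x else G (h x.2, x.1).

(** The level h is any exhaustion function of R^n whose collar -c <= h <= c avoids the support of f.
    The class of the result does not depend on it ([whisk_hE]), so the shape of the collar can be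
    chosen freely. *)
Definition whiskable (c : R) h G f :=
  [/\ 1 <= c, gbounded c G, continuous h, exists r, forall t, `|t| - r <= h t &
      forall s t, - c <= h t -> f (s, t) = point].

Lemma whisk_homot (c r r' : R) (H : R * (S * T) -> Y) (K : R * (R * S) -> Y)
    (h : R * T -> R) : continuous H -> continuous K -> continuous h ->
  (forall a, 0 <= a <= 1 -> bounded_by r (fun x => H (a, x))) ->
  1 <= c -> (forall a, gbounded c (fun x => K (a, x))) ->
  (forall a t, 0 <= a <= 1 -> `|t| - r' <= h (a, t)) ->
  (forall a s t, - c <= h (a, t) -> H (a, (s, t)) = point) ->
  ahomot (whisk c (fun t => h (0, t)) (fun x => K (0, x)) (fun x => H (0, x)))
         (whisk c (fun t => h (1, t)) (fun x => K (1, x)) (fun x => H (1, x))).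
Proof.
move=> cH cK ch bH c1 bK hr Hp.
apply: (@ahomot_itv _ _ _ _ _ (fun z : R * (S * T) =>
   whisk c (fun t => h (z.1, t)) (fun x => K (z.1, x)) (fun x => H (z.1, x)) z.2)
   (Num.max r (Num.max c (c + r')))) => //.
- apply: cts_if; [by cts|by cts|by cts|].
  move=> [a [s t]] /= hc; have {}hc : h (a, t) = - c by lra.
  rewrite Hp ?hc // bK //; left; rewrite normrN ger0_norm //; lra.
move=> a a01; split=> [s t|s s' t]; rewrite !ge_max /whisk /=.
  move=> /and3P[hr1 hr2 hr3]; case: ifP => h0; first exact: (bH a a01).1.
  apply: bK; left; have := hr a t a01; rewrite ler_normr => ht.
  by apply/orP; left; lra.
move=> /and3P[h1 h2 h3] /and3P[h1' h2' h3']; case: ifP => _.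
  exact: ((bH a a01).2 s s' t).
by rewrite (bK a (h (a, t)) s) ?(bK a (h (a, t)) s') //; right.
Qed.

Lemma whisk_le c c' h G f : whiskable c h G f -> whiskable c' h G f -> c <= c' ->
  whisk c h G f = whisk c' h G f.
Proof.
move=> [c1 bG ch [r hr] fp] [c1' bG' _ _ fp'] cc; apply/funext => -[s t].
rewrite /whisk /=; case: ifP => hc; case: ifP => // hc'.
  have hc'' : - c' <= h t by move/negbT: hc'; rewrite -ltNge; lra.
  rewrite fp' // bG //; left; rewrite ler_normr; apply/orP; right; lra.
by exfalso; move/negbT: hc; rewrite -ltNge; lra.
Qed.

(** For a fixed c the admissible levels form a convex set, which gives the homotopy. To enlarge c,
    the level is first lowered by the difference; then both constants define the same map. *)
Lemma whisk_hE c c' h h' G f : continuous G -> is_amap f ->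
  whiskable c h G f -> whiskable c' h' G f ->
  acls (whisk c h G f) = acls (whisk c' h' G f).
Proof.
move=> cG [cf [rf bf]].
have same d k k' : whiskable d k G f -> whiskable d k' G f ->
    acls (whisk d k G f) = acls (whisk d k' G f).
  move=> [c1 bG ck [r kr] fp] [_ _ ck' [r' kr'] fp'].
  pose q (z : R * T) := interp (k z.2) (k' z.2) z.1.
  have -> : k = fun t => q (0, t) by apply/funext => t; rewrite /q interp0.
  have -> : k' = fun t => q (1, t) by apply/funext => t; rewrite /q interp1.
  apply: acls_homot.
  apply: (@whisk_homot d rf (Num.max r r') (fun z => f z.2) (fun z => G z.2) q) => //.
  - by cts.
  - by cts.
  - by apply: cts_interp; cts.
  - move=> a t a01; pose lo := `|t| - Num.max r r'; pose hi := Num.max (k t) (k' t).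
    have l1 : lo <= k t <= hi.
      rewrite /hi le_max lexx andbT; apply: le_trans (kr t).
      by rewrite /lo lerD2l lerN2 le_max lexx.
    have l2 : lo <= k' t <= hi.
      rewrite /hi le_max lexx orbT andbT; apply: le_trans (kr' t).
      by rewrite /lo lerD2l lerN2 le_max lexx orbT.
    by have /andP[] := interp_itv a l1 l2.
  - by move=> a s t; rewrite /q /= => /le_interp[]; [exact: fp|exact: fp'].
have up d d' k : whiskable d k G f -> d <= d' -> gbounded d' G ->
    whiskable d' (fun t => k t - (d' - d)) G f /\
    acls (whisk d k G f) = acls (whisk d' (fun t => k t - (d' - d)) G f).
  move=> wk dd bG'; have [c1 bG ck [r kr] fp] := wk.
  have w1 : whiskable d (fun t => k t - (d' - d)) G f.
    split=> //; first by cts.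
      by exists (r + (d' - d)) => t; have := kr t; lra.
    by move=> s t h1; apply: fp; lra.
  have w2 : whiskable d' (fun t => k t - (d' - d)) G f.
    split=> //; [by lra|by cts| |].
      by exists (r + (d' - d)) => t; have := kr t; lra.
    by move=> s t h1; apply: fp; lra.
  by split=> //; rewrite (same _ _ _ wk w1) (whisk_le w1 w2).
move=> wh wh'; have [c1 bG _ _ _] := wh; have [c1' bG' _ _ _] := wh'.
pose d := Num.max c c'.
have bd : gbounded d G by apply: gbounded_le bG; rewrite /d le_max lexx.
have [w1 ->] := up _ d _ wh ltac:(by rewrite /d le_max lexx) bd.
have [w2 ->] := up _ d _ wh' ltac:(by rewrite /d le_max lexx orbT) bd.
exact: same.
Qed.

(** The collar -c <= h <= c is here r <= |t| <= r + 2 c. *)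
Definition hstd (r c : R) (t : T) : R := `|t| - r - c.

Lemma whiskable_std r c G f : gbounded c G -> 1 <= c -> bounded_by r f ->
  whiskable c (hstd r c) G f.
Proof.
move=> bG c1 bf; split=> //.
- by rewrite /hstd; cts.
- by exists (r + c) => t; rewrite /hstd; lra.
- by move=> s t; rewrite /hstd => h1; apply: bf.1; lra.
Qed.

Lemma whisk_stdE r c G f s t :
  whisk c (hstd r c) G f (s, t) = if `|t| <= r then f (s, t) else G (`|t| - r - c, s).
Proof.
by rewrite /whisk /hstd /= -[X in X <= 0]/(_ + c) subrK subr_le0.
Qed.

Lemma bounded_whisk_std r c G f : gbounded c G -> 1 <= c -> 0 <= r -> bounded_by r f ->
  bounded_by (r + 2 * c) (whisk c (hstd r c) G f).
Proof.
move=> bG c1 r0 [f1 f2]; split=> [s t|s s' t] h; rewrite !whisk_stdE.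
  case: ifP => h1; first by exfalso; lra.
  by apply: bG; left; rewrite ler_normr; apply/orP; left; lra.
move=> h'; case: ifP => h1; first by apply: f2; lra.
by rewrite !bG //; right; lra.
Qed.

Lemma is_amap_whisk c h G f : continuous G -> is_amap f -> whiskable c h G f ->
  is_amap (whisk c h G f).
Proof.
move=> cG [cf [r bf]] [c1 bG ch [r' hr] fp].
have := @whisk_homot c r r' (fun z => f z.2) (fun z => G z.2) (fun z => h z.2).
move=> /(_ _ _ _ _ _ _ _ _)/ahomot_amap_l; apply=> //; by cts.
Qed.

Definition whiskc G (a : A) : A :=
  acls (whisk (grad G) (hstd (rad (arep a)) (grad G)) G (arep a)).

Lemma whisk_homotE c r G f g : continuous G -> gbounded c G -> 1 <= c ->
  bounded_by r f -> bounded_by r g -> ahomot f g ->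
  acls (whisk c (hstd r c) G f) = acls (whisk c (hstd r c) G g).
Proof.
move=> cG bG c1 bf bg fg; have af := ahomot_amap_l fg; have ag := ahomot_amap_r fg.
have [H [cH [s bs] H0 H1]] := fg; pose D := Num.max r s.
have bfD : bounded_by D f by apply: bounded_by_le bf; rewrite /D le_max lexx.
have bgD : bounded_by D g by apply: bounded_by_le bg; rewrite /D le_max lexx.
rewrite (@whisk_hE c c _ (hstd D c)) //; try exact: whiskable_std.
rewrite (@whisk_hE c c (hstd r c) (hstd D c)) //; try exact: whiskable_std.
apply: acls_homot.
have := @whisk_homot c D (D + c) H (fun z => G z.2) (fun z => hstd D c z.2).
rewrite /= (funext H0 : (fun x => H (0, x)) = f) (funext H1 : (fun x => H (1, x)) = g).
have bD a : bounded_by D (fun x => H (a, x)).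
  by apply: bounded_by_le (bs a); rewrite /D le_max lexx orbT.
apply=> //.
- by cts.
- by rewrite /hstd; cts.
- by move=> a t _; rewrite /hstd; lra.
- by move=> a s' t; rewrite /hstd => h1; apply: (bD a).1; lra.
Qed.

Lemma whiskcE c h G f : is_gmap G -> is_amap f -> whiskable c h G f ->
  acls (whisk c h G f) = whiskc G (acls f).
Proof.
move=> gG af wf; have cG := gG.1; have [g1 bG] := gradP gG.
have [f1 bf] := radP af.
rewrite (@whisk_hE c (grad G) _ (hstd (rad f) (grad G))) //; last exact: whiskable_std.
apply: (acls_lift (phi := fun u => acls (whisk (grad G) (hstd (rad u) (grad G)) G u))) => //.
- move=> u v uv; have au := ahomot_amap_l uv; have av := ahomot_amap_r uv.
  have [u1 bu] := radP au; have [v1 bv] := radP av; pose D := rad u + rad v.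
  have bu' : bounded_by D u by apply: bounded_by_le bu; rewrite /D; lra.
  have bv' : bounded_by D v by apply: bounded_by_le bv; rewrite /D; lra.
  rewrite (@whisk_hE _ (grad G) _ (hstd D (grad G))) //; try exact: whiskable_std.
  rewrite (@whisk_hE _ (grad G) (hstd (rad v) _) (hstd D (grad G))) //; try exact: whiskable_std.
  exact: whisk_homotE.
- exact: arep_amap.
- by rewrite acls_rep.
Qed.

(** By [whisk_hE] the collar around the sum may follow the level of the distance to the nearer
    centre, [|fold t - d *: ax|]; then it falls into two collars, one around each summand. *)
Lemma whiskcD G (a b : A) : is_gmap G -> whiskc G (a + b) = whiskc G a + whiskc G b.
Proof.
move=> gG; have cG := gG.1; have [c1 bG] := gradP gG; set c := grad G in c1 bG.
rewrite -(acls_rep a) -(acls_rep b); have af := arep_amap a; have ag := arep_amap b.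
set f := arep a in af *; set g := arep b in ag *.
have [[f1 bf] [g1 bg]] := (radP af, radP ag); pose r := rad f + rad g.
have bf' : bounded_by r f by apply: bounded_by_le bf; rewrite /r; lra.
have bg' : bounded_by r g by apply: bounded_by_le bg; rewrite /r; lra.
have r0 : 0 <= r by rewrite /r; lra.
pose d := r + 2 * c.
have rd : r <= d by rewrite /d; lra.
rewrite -(@acls_add _ _ _ r d) //.
have wf := whiskable_std bG c1 bf'; have wg := whiskable_std bG c1 bg'.
rewrite -(whiskcE gG af wf) -(whiskcE gG ag wg).
rewrite -(@acls_add _ _ _ d d) //; try exact: is_amap_whisk; try exact: bounded_whisk_std;
  last by rewrite /d; lra.
pose h (t : T) := `|fold t - d *: ax| - r - c.
have cfold : continuous (fun t : T => fold t) by apply: cts_fold; cts.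
have ch : continuous h by rewrite /h; cts.
have hneg (t : T) : t 0 0 <= 0 -> `|fold t - d *: ax| = `|t + d *: ax|.
  by move=> t0; rewrite fold_shift_neg // norm_refl.
have wh : whiskable c h G (addf d f g).
  split=> //.
    exists (d + r + c) => t; rewrite /h.
    have h1 : `|t| - d <= `|fold t - d *: ax|.
      by apply: shift_far; rewrite norm_fold ger0_norm ?subrK //; lra.
    by lra.
  move=> s t; rewrite /h => h1; rewrite /addf /=; case: ifP => t0.
    by apply: bf'.1; rewrite fold_pos // in h1; lra.
  by apply: bg'.1; rewrite hneg in h1; [lra|rewrite ltW // ltNge t0].
rewrite -(whiskcE gG _ wh); last by apply: (@is_amap_addf _ _ _ r) => //; lra.
apply: acls_eq => -[s t]; rewrite /addf /=; case: ifP => t0.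
  by rewrite whisk_stdE /whisk /h /= fold_pos // subrK subr_le0 t0.
have {}t0' : t 0 0 <= 0 by rewrite ltW // ltNge t0.
by rewrite whisk_stdE /whisk /h /= hneg // subrK subr_le0 t0.
Qed.

(** At time b the collar is frozen beyond |t| = r + 2 c b, so that S^p x pt is mapped by s |-> G (2
    c b - c, s). The intermediate maps are in general not amaps but only satisfy [wbounded_by]: the
    homotopy exists in [S^p x S^n, Y] and not in A(Y). *)
Lemma phi_whisk G (a : A) : is_gmap G -> phi (whiskc G a) = phi a.
Proof.
move=> gG; have cG := gG.1; have [c1 bG] := gradP gG; set c := grad G in c1 bG.
rewrite -(acls_rep a); have af := arep_amap a; set f := arep a in af *.
have [r1 bf] := radP af; set r := rad f in r1 bf.
have wf := whiskable_std bG c1 bf; rewrite -(whiskcE gG af wf).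
rewrite !phiE //; last exact: is_amap_whisk.
apply/esym; apply: (@Phicls_homot _ _ _ (fun z : R * (S * T) => if `|z.2.2| - r <= 0 then f z.2
  else G (Num.min (`|z.2.2| - r) (2 * c * z.1) - c, z.2.1)) (r + 2 * c)).
- have cf := af.1; apply: cts_if; [by cts|by cts|by cts|].
  move=> [b [s t]] /= /subr0_eq tr; rewrite bf.1 ?tr // bG //; left.
  rewrite subrr ler_normr; apply/orP; right.
  have : Num.min 0 (2 * c * b) <= 0 by rewrite ge_min lexx.
  by lra.
- move=> b /andP[b0 b1]; have b2 : 2 * c * b <= 2 * c by nra.
  split=> [s t t'|s s' t|s t] h h' /=.
  + rewrite !ifF; [|by apply/negbTE; rewrite -ltNge; lra..].
    by rewrite !(min_idPr _) //; lra.
  + case: ifP => _; first by apply: bf.2; lra.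
    by rewrite !bG //; right; lra.
  + case: ifP => h1; first by exfalso; lra.
    by apply: bG; right; lra.
- move=> [s t] /=; rewrite mulr0; case: ifP => // /negbT; rewrite -ltNge => h.
  rewrite (min_idPr _) ?ltW // sub0r bG; last by left; rewrite normrN ger0_norm; lra.
  by rewrite bf.1 //; lra.
move=> [s t] /=; rewrite mulr1 whisk_stdE subr_le0; case: ifP => // /negbT.
rewrite -ltNge => h; have [h1|h1] := lerP (`|t| - r) (2 * c); first by [].
rewrite !bG //; left; rewrite ler_normr; apply/orP; left; lra.
Qed.

End Whisker.

(** Applied to [a *+ k + b] with b fixed, W adds [d *+ k], which F cannot see. Negative z are
    reached by the same step from a fixed b that is a negative multiple of d. *)
Lemma unipotent_invariant (A : zmodType) (B : Type) (W : A -> A) (F : A -> B)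
    (a d : A) (k : nat) (z : int) :
  (forall x y, W (x + y) = W x + W y) -> (forall x, F (W x) = F x) ->
  W a = a + d -> W d = d -> F (a *+ k + d *+ k *~ z) = F (a *+ k).
Proof.
move=> WD FW Wa Wd.
have W0 : W 0 = 0 by apply: (addrI (W 0)); rewrite -WD !addr0.
have WMn x j : W (x *+ j) = W x *+ j.
  by elim: j => [|j IH]; rewrite ?mulr0n // !mulrS WD IH.
have WN x : W (- x) = - W x by apply: (addrI (W x)); rewrite -WD !subrr.
have step b : W b = b -> F (a *+ k + (b + d *+ k)) = F (a *+ k + b).
  by move=> Wb; rewrite -[RHS]FW WD Wb WMn Wa mulrnDl -addrA [d *+ k + b]addrC.
have inv j : W (d *+ k *+ j) = d *+ k *+ j by rewrite !WMn Wd.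
case: z => j.
  rewrite -pmulrn; elim: j => [|j IH]; first by rewrite mulr0n addr0.
  by rewrite mulrSr step.
rewrite NegzE mulrNz -pmulrn; elim: j => [|j IH].
  by rewrite mulr1n -(step (- (d *+ k))) ?addNr ?addr0 // WN -[d *+ k]mulr1n inv.
rewrite -IH -(step (- (d *+ k *+ j.+2))); last by rewrite WN inv.
by rewrite [d *+ k *+ j.+2]mulrSr opprD -addrA addNr addr0.
Qed.

Section WhiskerAlgebra.
Context (R : realType) (m : nat) (Y : ptopologicalType).
Local Notation S := 'rV[R]_m.+1.
Local Notation T := 'rV[R]_m.+2.
Local Notation ax := (ax R m).
Local Notation A := (aclasses R m Y).
Implicit Types (f g : S * T -> Y) (G : R * S -> Y).

Lemma ghomot_gmap_l G G' : ghomot G G' -> is_gmap G.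
Proof.
move=> [H [cH [r bH] H0 _]]; have -> : G = fun x => H (0, x) by apply/funext.
by split; [cts|exists r].
Qed.

Lemma ghomot_gmap_r G G' : ghomot G G' -> is_gmap G'.
Proof.
move=> [H [cH [r bH] _ H1]]; have -> : G' = fun x => H (1, x) by apply/funext.
by split; [cts|exists r].
Qed.

Lemma ghomot_itv (H : R * (R * S) -> Y) r G G' :
  continuous H -> (forall a, 0 <= a <= 1 -> gbounded r (fun x => H (a, x))) ->
  (forall x, H (0, x) = G x) -> (forall x, H (1, x) = G' x) -> ghomot G G'.
Proof.
move=> cH bH H0 H1; exists (fun ax => H (clamp ax.1, ax.2)); split.
- by cts.
- by exists r => a; exact: (bH _ (clamp_itv a)).
- by move=> x /=; rewrite clamp_id ?lexx ?ler01.
- by move=> x /=; rewrite clamp_id ?lexx ?ler01.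
Qed.

Lemma whiskc_ghomot G G' (a : A) : ghomot G G' -> whiskc G a = whiskc G' a.
Proof.
move=> GG; have gG := ghomot_gmap_l GG; have gG' := ghomot_gmap_r GG.
have [K [cK [k bK] K0 K1]] := GG; pose c := Num.max 1 k.
have c1 : 1 <= c by rewrite /c le_max lexx.
have {}bK x : gbounded c (fun y => K (x, y)).
  by apply: gbounded_le (bK x); rewrite /c le_max lexx orbT.
have EG : G = fun x => K (0, x) by apply/funext.
have EG' : G' = fun x => K (1, x) by apply/funext.
have bG : gbounded c G by rewrite EG.
have bG' : gbounded c G' by rewrite EG'.
rewrite -(acls_rep a); have af := arep_amap a; have [r1 bf] := radP af.
rewrite -(whiskcE gG af (whiskable_std bG c1 bf)).
rewrite -(whiskcE gG' af (whiskable_std bG' c1 bf)).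
apply: acls_homot; set r := rad _ in r1 bf *.
have := @whisk_homot R m Y c r (r + c) (fun z => arep a z.2) K (fun z => hstd r c z.2).
rewrite /= -EG -EG'; have cf := af.1; apply=> //.
- by cts.
- by rewrite /hstd; cts.
- by move=> x t _; rewrite /hstd; lra.
- by move=> x s t; rewrite /hstd => h1; apply: bf.1; lra.
Qed.

(** Concatenation in the direction across the collar. The part x >= 0 lies farther out, so G
    surrounds G' in [whiskc_star]. *)
Definition star (c : R) G G' (x : R * S) : Y :=
  if 0 <= x.1 then G (x.1 - c, x.2) else G' (x.1 + c, x.2).

Lemma is_gmap_star c G G' : is_gmap G -> is_gmap G' -> 1 <= c ->
  gbounded c G -> gbounded c G' -> is_gmap (star c G G') /\ gbounded (2 * c) (star c G G').
Proof.
move=> [cG _] [cG' _] c1 bG bG'.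
have bs : gbounded (2 * c) (star c G G').
  move=> x s h; rewrite /star /=; case: ifP => x0.
    apply: bG; case: h => h; [left|by right; lra].
    by move: h; rewrite ger0_norm // => h; rewrite ler_normr; apply/orP; left; lra.
  have {}x0 : x < 0 by rewrite ltNge x0.
  apply: bG'; case: h => h; [left|by right; lra].
  by move: h; rewrite ltr0_norm // => h; rewrite ler_normr; apply/orP; right; lra.
split=> //; split; last by exists (2 * c).
apply: cts_paste; [by cts|by cts|by cts|].
move=> [x s] /= ->; rewrite bG ?bG' //; left; rewrite ?sub0r ?normrN ?add0r ger0_norm //; lra.
Qed.

Lemma whiskc_star c G G' (a : A) : is_gmap G -> is_gmap G' -> 1 <= c ->
  gbounded c G -> gbounded c G' ->
  whiskc (star c G G') a = whiskc G (whiskc G' a).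
Proof.
move=> gG gG' c1 bG bG'; have [gs bs] := is_gmap_star gG gG' c1 bG bG'.
rewrite -(acls_rep a); have af := arep_amap a; set f := arep a in af *.
have [r1 bf] := radP af; set r := rad f in r1 bf.
have w1 := whiskable_std bG' c1 bf; rewrite -(whiskcE gG' af w1).
have bf1 : bounded_by (r + 2 * c) (whisk c (hstd r c) G' f).
  by apply: bounded_whisk_std => //; lra.
rewrite -(whiskcE gG _ (whiskable_std bG c1 bf1)); last exact: is_amap_whisk gG'.1 _ _.
have c2 : 1 <= 2 * c by lra.
rewrite -(whiskcE gs af (whiskable_std bs c2 bf)); apply: acls_eq => -[s t].
rewrite !whisk_stdE; case: (lerP `|t| (r + 2 * c)) => h; last first.
  rewrite ifF; last by apply/negbTE; rewrite -ltNge; lra.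
  by rewrite /star /= ifT; [congr G; congr pair; ring|lra].
case: ifP => // hr; rewrite /star /=; case: ifP => h0.
  have -> : `|t| = r + 2 * c by apply/le_anti; rewrite h; lra.
  rewrite bG ?bG' //; left; rewrite ler_normr; apply/orP; [left|right]; lra.
by congr G'; congr pair; ring.
Qed.

Lemma whiskc_const (a : A) : whiskc (fun=> point) a = a.
Proof.
have g0 : is_gmap (fun _ : R * S => point : Y) by split; [exact: cts_cst|exists 0].
rewrite -(acls_rep a); have af := arep_amap a; set f := arep a in af *.
have [r1 bf] := radP af; set r := rad f in r1 bf.
have b0 : gbounded 1 (fun _ : R * S => point : Y) by [].
rewrite -(whiskcE g0 af (whiskable_std b0 (lexx _) bf)).
apply: acls_eq => -[s t]; rewrite whisk_stdE; case: ifP => // /negbT.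
by rewrite -ltNge => h; rewrite bf.1 // ltW.
Qed.

(* If f is nullhomotopic for s at infinity, then it is homotopic to a map which
   vanishes for s at infinity, while G can be moved into that region. *)
Lemma whiskc_null G f (N : R * T -> Y) (r : R) : is_gmap G -> is_amap f ->
  continuous N -> (forall a t, 0 <= a <= 1 -> r <= `|t| -> N (a, t) = point) ->
  (forall s t, r <= `|s| -> f (s, t) = N (0, t)) -> (forall t, N (1, t) = point) ->
  whiskc G (acls f) = acls f.
Proof.
move=> gG af cN bN N0 N1; have [c1 bG] := gradP gG; set c := grad G in c1 bG.
have cG := gG.1; have [rf1 brf] := radP af; have cf := af.1.
pose r0 := Num.max (rad f) r.
have r01 : 1 <= r0 by rewrite /r0 le_max rf1.
have bf : bounded_by r0 f by apply: bounded_by_le brf; rewrite /r0 le_max lexx.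
have {}bN a t : 0 <= a <= 1 -> r0 <= `|t| -> N (a, t) = point.
  by move=> a01 h; apply: bN => //; apply: le_trans h; rewrite /r0 le_max lexx orbT.
have {}N0 s t : r0 <= `|s| -> f (s, t) = N (0, t).
  by move=> h; apply: N0; apply: le_trans h; rewrite /r0 le_max lexx orbT.
have cl0 (x : R) : x <= 0 -> clamp x = 0.
  by move=> x0; rewrite /clamp; apply/max_idPl; rewrite ge_min x0 orbT.
have cl1 (x : R) : 1 <= x -> clamp x = 1.
  by move=> x1; rewrite /clamp (min_idPl x1); apply/max_idPr; exact: ler01.
pose f' (x : S * T) := if `|x.1| - r0 <= 0 then f x else N (clamp (`|x.1| - r0), x.2).
have ff' : ahomot f f'.
  apply: (@ahomot_itv _ _ _ _ _ (fun z : R * (S * T) => if `|z.2.1| - r0 <= 0 then f z.2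
    else N (clamp (Num.min (`|z.2.1| - r0) z.1), z.2.2)) (r0 + 1)) => [|a /andP[a0 a1]|[s t]|[s t]].
  - apply: cts_if; [by cts|by cts|by cts|].
    move=> [a [s t]] /= /subr0_eq sr; rewrite N0 ?sr // subrr cl0 // ge_min lexx //.
  - split=> [s t h|s s' t h h'] /=.
      case: ifP => _; first by apply: bf.1; lra.
      by apply: bN; [exact: clamp_itv|lra].
    rewrite !ifF; [|by apply/negbTE; rewrite -ltNge; lra..].
    by rewrite !(min_idPr _) //; lra.
  - rewrite /=; case: ifP => // /negbT; rewrite -ltNge => h.
    by rewrite cl0 ?ge_min ?lexx ?orbT // N0 //; lra.
  - rewrite /f' /=; case: ifP => // /negbT; rewrite -ltNge => h.
    have [h1|h1] := lerP (`|s| - r0) 1; first by [].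
    by rewrite (cl1 1) // cl1 // ltW.
rewrite (acls_homot ff'); have af' := ahomot_amap_r ff'; have cf' := af'.1.
pose r1 := r0 + 1.
have f'far s t : r1 <= `|s| -> f' (s, t) = point.
  rewrite /r1 => h; rewrite /f' /= ifF; last by apply/negbTE; rewrite -ltNge; lra.
  by rewrite cl1 //; lra.
have bf' : bounded_by r1 f'.
  split=> [s t h|s s' t h h']; last by rewrite !f'far.
  rewrite /f' /=; case: ifP => _; first by apply: bf.1; rewrite /r1 in h; lra.
  by apply: bN; [exact: clamp_itv|rewrite /r1 in h; lra].
(* G is translated along the diagonal of R^p, just far enough to be trivial for |s| <= r1, while f'
   is trivial for |s| >= r1. *)
pose k := r1 + c; have k0 : 0 <= k by rewrite /k /r1; lra.
pose G' (x : R * S) := G (x.1, x.2 - const_mx k).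
have nk : `|const_mx k : S| = k by rewrite normv_const.
have GG' : ghomot G G'.
  apply: (@ghomot_itv (fun z : R * (R * S) => G (z.2.1, z.2.2 - z.1 *: const_mx k)) (c + k))
    => [|a /andP[a0 a1]|[x s]|[x s]] /=.
  - by cts.
  - move=> x s [h|h]; apply: bG; [left; lra|right].
    have := lerB_normD s (- (a *: const_mx k)).
    rewrite normrN normrZ nk ger0_norm //= => h1; apply: le_trans h1; nra.
  - by rewrite scale0r subr0.
  - by rewrite scale1r.
have gG' := ghomot_gmap_r GG'; have cG' := gG'.1.
rewrite (whiskc_ghomot _ GG').
pose d := c + k.
have d1 : 1 <= d by rewrite /d; lra.
have G'near x s : `|s| <= r1 -> G' (x, s) = point.
  move=> h; apply: bG; right; rewrite /=; have := lerB_normD (const_mx k : S) (- s).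
  by rewrite nk normrN distrC /k => h1; lra.
have bG' : gbounded d G'.
  move=> x s [h|h]; apply: bG; [left; rewrite /d in h; lra|right].
  have := lerB_normD s (- const_mx k); rewrite normrN nk => h1.
  by rewrite /d in h; lra.
rewrite -(whiskcE gG' af' (whiskable_std bG' d1 bf')); apply: acls_homot.
(* Over |s| >= r1 only the collar is left. It is pushed inwards until its argument exceeds d for
   every t, which makes it disappear. *)
apply: (@ahomot_itv _ _ _ _ _ (fun z : R * (S * T) => if `|z.2.1| - r1 <= 0 then f' z.2
    else G' (`|z.2.2| - r1 - d + z.1 * (r1 + 2 * d), z.2.1)) (r1 + 2 * d)) => [|a /andP[a0 a1]|[s t]|[s t]].
- apply: cts_if; [by cts|by cts|by cts|].
  by move=> [a [s t]] /= /subr0_eq sr; rewrite f'far ?sr // G'near // sr.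
- have ar : 0 <= a * (r1 + 2 * d) by rewrite mulr_ge0 // /r1; lra.
  split=> [s t h|s s' t h h'] /=.
    case: ifP => _; first by apply: bf'.1; lra.
    by apply: bG'; left; rewrite ler_normr; apply/orP; left; lra.
  rewrite !ifF; [|by apply/negbTE; rewrite -ltNge; lra..].
  by rewrite !bG' //; right; rewrite /d /k /r1 in h h' *; lra.
- rewrite whisk_stdE /= mul0r addr0; case: (lerP `|s| r1) => h.
    rewrite ifT; last lra.
    by case: ifP => // /negbT; rewrite -ltNge => h1; rewrite G'near // bf'.1 // ltW.
  rewrite ifF; last by apply/negbTE; rewrite -ltNge; lra.
  case: ifP => // h1; rewrite f'far ?ltW //; apply: bG'; left.
  by rewrite ler_normr; apply/orP; right; lra.
- rewrite /= mul1r; case: ifP => // /negbT; rewrite -ltNge => h.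
  rewrite f'far; last lra.
  apply: bG'; left; rewrite ler_normr; apply/orP; left.
  by have := normr_ge0 t; lra.
Qed.

(** For s at infinity G' is trivial, so both terms of the difference restrict to the same map t |->
    f (s0, t). The homotopy of [addfN_homot] for that map is the nullhomotopy N which [whiskc_null]
    asks for. *)
Lemma whiskc_unip G G' (a : A) : is_gmap G -> is_gmap G' ->
  whiskc G (whiskc G' a - a) = whiskc G' a - a.
Proof.
move=> gG gG'; rewrite -(acls_rep a); have af := arep_amap a; set f := arep a in af *.
have [r1 bf] := radP af; set r := rad f in r1 bf.
have [c1 bG] := gradP gG'; set c := grad G' in c1 bG.
have w1 := whiskable_std bG c1 bf; rewrite -(whiskcE gG' af w1) -acls_opp //.
set f1 := whisk _ _ _ _; pose d := r + 2 * c.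
have af1 : is_amap f1 := is_amap_whisk gG'.1 af w1.
have bf1 : bounded_by d f1 by apply: bounded_whisk_std => //; lra.
have bf' : bounded_by d f by apply: bounded_by_le bf; rewrite /d; lra.
have bo := bounded_oppf bf'; have ao := is_amap_oppf af.
have d0 : 0 <= d by rewrite /d; lra.
rewrite -(acls_add af1 ao bf1 bo d0 (lexx _)).
have cf := af.1; pose s0 : S := const_mx d.
have ns0 : `|s0| = d by rewrite normv_const.
pose N (z : R * T) := f (s0, fold z.2 - interp d (- d) z.1 *: ax).
apply: (@whiskc_null _ _ N (d + d)) => //.
- by apply: (@is_amap_addf _ _ _ d).
- have cF : continuous (fun z : R * T => fold z.2) by apply: cts_fold; cts.
  by rewrite /N /interp; cts.
- move=> b t b01 h; apply: bf'.1; apply: shift_far; rewrite norm_fold.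
  apply: le_trans h; rewrite lerD2l ler_norml.
  have l1 : - d <= d <= d by rewrite lexx andbT; lra.
  have l2 : - d <= - d <= d by rewrite lexx /=; lra.
  exact: interp_itv.
- move=> s t h; rewrite /N /= interp0.
  have e (u : T) : f1 (s, u) = f (s0, u).
    rewrite /f1 whisk_stdE; case: ifP => h1.
      by apply: bf'.2; rewrite ?ns0 //; lra.
    rewrite bG; last by right; rewrite /d in h; lra.
    by rewrite bf.1 //; move/negbT: h1; rewrite -ltNge => /ltW.
  rewrite /addf /=; case: ifP => t0; first by rewrite e fold_pos.
  rewrite /oppf /= fold_shift_neg; last by rewrite ltW // ltNge t0.
  by apply: bf'.2; rewrite ?ns0 //; lra.
- move=> t; rewrite /N /= interp1; apply: bf'.1; apply: le_trans (shift_ge _ _).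
  by rewrite mxE eqxx opprK ger0_norm; have := normr_ge0 (t 0 0); lra.
Qed.

Definition wdiff G (a : A) : A := whiskc G a - a.

(** W W' - 1 = (W - 1) + (W' - 1) + (W - 1)(W' - 1), and the last term vanishes by [whiskc_unip]. *)
Lemma wdiff_star c G G' (a : A) : is_gmap G -> is_gmap G' -> 1 <= c ->
  gbounded c G -> gbounded c G' ->
  wdiff (star c G G') a = wdiff G a + wdiff G' a.
Proof.
move=> gG gG' c1 bG bG'; rewrite /wdiff whiskc_star //.
have u := whiskc_unip a gG gG'; have d := whiskcD (whiskc G' a - a) a gG.
rewrite u subrK in d; rewrite d; move: (whiskc G a) (whiskc G' a) => x y.
by rewrite -addrA addrC.
Qed.

Lemma phi_wdiff G (a : A) (k : nat) (z : int) : is_gmap G ->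
  phi (a *+ k + wdiff G a *+ k *~ z) = phi (a *+ k).
Proof.
move=> gG; apply: (@unipotent_invariant A _ (whiskc G) (@phi R m Y)).
- by move=> x y; exact: whiskcD.
- by move=> x; exact: phi_whisk.
- by rewrite /wdiff addrC subrK.
- exact: whiskc_unip.
Qed.

End WhiskerAlgebra.

(** * Straight homotopies between maps to a sphere *)

Section Normalization.
Context (R : realType) (k : nat).
Implicit Types (u v : 'rV[R]_k.+1) (x y : sphere R k).

Lemma unit_sqnorm v : v != 0 -> sqnorm ((enorm v)^-1 *: v) = 1.
Proof.
move=> v0; rewrite sqnormZ -enorm_sqr -exprMn mulVf ?expr1n //.
by rewrite enorm_eq0.
Qed.

(* The base point when v = 0. *)
Definition nsph v : sphere R k :=
  match pselect (v != 0) with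
  | left p => mksphere (unit_sqnorm p)
  | right _ => point
  end.

Lemma svec_nsph v : v != 0 -> svec (nsph v) = (enorm v)^-1 *: v.
Proof. by move=> v0; rewrite /nsph; case: pselect. Qed.

Lemma svec_neq0 x : svec x != 0.
Proof. by rewrite -sqnorm_eq0 svec_sqnorm oner_neq0. Qed.

Lemma enorm_svec x : enorm (svec x) = 1.
Proof. by rewrite /enorm svec_sqnorm sqrtr1. Qed.

Lemma nsph_svec x : nsph (svec x) = x.
Proof.
by apply: svec_inj; rewrite svec_nsph ?svec_neq0 // enorm_svec invr1 scale1r.
Qed.

Lemma cts_nsph (X : topologicalType) (f : X -> 'rV[R]_k.+1) :
  (forall z, f z != 0) -> continuous f -> continuous (fun z => nsph (f z)).
Proof.
move=> f0 cf; apply: cts_sphere.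
apply: (@cts_eq _ _ _ (fun z => (enorm (f z))^-1 *: f z)) => [z|].
  by rewrite svec_nsph.
apply: cts_scalev => //; apply: cts_inv; first by move=> z; rewrite enorm_eq0.
by cts.
Qed.

Lemma segment_neq0 x y (a : R) : svec x + svec y != 0 -> 0 <= a <= 1 ->
  (1 - a) *: svec x + a *: svec y != 0.
Proof.
move=> xy /andP[a0 a1]; apply: contraNneq xy => /eqP h.
have e : (1 - a) *: svec x = - (a *: svec y) by apply/eqP; rewrite -addr_eq0.
have : (1 - a) ^+ 2 = a ^+ 2.
  have := congr1 (@sqnorm R _) e; rewrite -scaleNr !sqnormZ !svec_sqnorm !mulr1.
  by rewrite sqrrN.
move=> h1; have a2 : a = 1 / 2 by lra.
move: h; rewrite a2 (_ : 1 - 1 / 2 = 1 / 2 :> R); last by lra.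
by rewrite -scalerDr scaler_eq0 => /orP[/eqP|//]; lra.
Qed.

Definition shom (a : R) x y : sphere R k :=
  nsph ((1 - clamp a) *: svec x + clamp a *: svec y).

Lemma shom0 x y : shom 0 x y = x.
Proof.
by rewrite /shom clamp_id ?lexx ?ler01 // subr0 scale1r scale0r addr0 nsph_svec.
Qed.

Lemma shom1 x y : shom 1 x y = y.
Proof.
by rewrite /shom clamp_id ?lexx ?ler01 // subrr scale0r scale1r add0r nsph_svec.
Qed.

Lemma shom_same a x : shom a x x = x.
Proof. by rewrite /shom -scalerDl subrK scale1r nsph_svec. Qed.

Lemma cts_shom (X : topologicalType) (a : X -> R) (f g : X -> sphere R k) :
  continuous a -> continuous f -> continuous g ->
  (forall z, svec (f z) + svec (g z) != 0) ->
  continuous (fun z => shom (a z) (f z) (g z)).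
Proof.
move=> ca cf cg fg; apply: cts_nsph; last by cts.
by move=> x; apply: segment_neq0 => //; exact: clamp_itv.
Qed.

End Normalization.

Section Collapse.
Context (R : realType) (k : nat).
Implicit Types (v : 'rV[R]_k).

Lemma headv_collapse v : headv (collapse v) = 2 * Num.min 1 (sqnorm v) - 1.
Proof. by rewrite /headv mxE. Qed.

Lemma tailv_collapse v :
  tailv (collapse v) = (2 * Num.sqrt (1 - Num.min 1 (sqnorm v))) *: v.
Proof. by apply/rowP => i; rewrite !mxE /collapse_crd /= crdE. Qed.

Lemma collapse_south v : headv (collapse v) = -1 -> v = 0.
Proof.
rewrite headv_collapse => h; have {}h : Num.min 1 (sqnorm v) = 0 by lra.
apply/eqP; rewrite -sqnorm_eq0; move: h; case: lerP => _ h.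
  by move/eqP: h; rewrite oner_eq0.
by rewrite h.
Qed.

Lemma headv_add_tail (x y : sphere R k) : svec x + svec y = 0 ->
  headv x = - headv y /\ tailv x = - tailv y.
Proof.
move=> /eqP; rewrite addr_eq0 => /eqP xy; rewrite /headv xy; split.
  by rewrite mxE.
by apply/rowP => i; rewrite !mxE xy !mxE.
Qed.

End Collapse.

Section ConsRow.
Context (R : realType) (k : nat).

Definition consv (x : R) (s : 'rV[R]_k) : 'rV[R]_k.+1 :=
  \row_i if unlift 0 i is Some j then s 0 j else x.

Lemma consv0 x s : consv x s 0 0 = x.
Proof. by rewrite mxE unlift_none. Qed.

Lemma consvS x s j : consv x s 0 (lift 0 j) = s 0 j.
Proof. by rewrite mxE liftK. Qed.

Lemma norm_consvl x s : `|x| <= `|consv x s|.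
Proof. by have := le_normv (consv x s) 0; rewrite consv0. Qed.

Lemma norm_consvr x s : `|s| <= `|consv x s|.
Proof.
apply: normv_le => // i; have := le_normv (consv x s) (lift 0 i).
by rewrite consvS.
Qed.

Lemma cts_consv (X : topologicalType) (f : X -> R) (g : X -> 'rV[R]_k) :
  continuous f -> continuous g -> continuous (fun x => consv (f x) (g x)).
Proof.
move=> cf cg; apply: cts_rowP => i; have [j ->|->] := unliftP 0 i.
  by apply: (@cts_eq _ _ _ (fun x => g x 0 j)) => [x|]; [rewrite consvS|cts].
by apply: (@cts_eq _ _ _ f) => [x|]; [rewrite consv0|cts].
Qed.

Lemma sqnorm_consv x s : sqnorm (consv x s) = x ^+ 2 + sqnorm s.
Proof.
by rewrite {1}/sqnorm big_ord_recl consv0; congr (_ + _); apply: eq_bigr => i _; rewrite consvS.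
Qed.

End ConsRow.

(** * The pinch map and the sum of loops *)

Section Loops.
Context (R : realType) (m : nat).
Local Notation S := 'rV[R]_m.+1.
Local Notation Sn := (sphere R m.+2).
(** The point of the axis s = 0, x >= 0 at which the pinched loop reaches the antipode of the base
    point: 4 x^2 (1 - x^2) = 1 means x^2 = 1/2. *)
Let kap : R := (Num.sqrt 2)^-1.

Let kap0 : 0 < kap. Proof. by rewrite invr_gt0 sqrtr_gt0. Qed.
Let kap2 : kap ^+ 2 = 1 / 2. Proof. by rewrite exprVn sqr_sqrtr // mul1r. Qed.

Definition gloop (x : R * S) : Sn := collapse (consv x.1 x.2).

Lemma cts_gloop (X : topologicalType) (f : X -> R * S) :
  continuous f -> continuous (fun x => gloop (f x)).
Proof. by move=> cf; rewrite /gloop; apply: cts_collapse; apply: cts_consv; cts. Qed.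

Lemma gbounded_gloop : gbounded 1 gloop.
Proof.
move=> x s h; apply: collapse_far; case: h => h; apply: (le_trans h).
  exact: norm_consvl.
exact: norm_consvr.
Qed.

(* Half of the pinch map, carried by the half space e * x >= 0. *)
Definition ghalf (e : R) (x : R * S) : Sn :=
  if 0 <= e * x.1 then pinch (gloop x) else point.

Lemma pinch_pt k : pinch (point : sphere R k) = point.
Proof. by apply: pinch_equator; exact: crd_point1. Qed.

Lemma gloop_crd1 x : crd (svec (gloop x)) 1 =
  2 * Num.sqrt (1 - Num.min 1 (sqnorm (consv x.1 x.2))) * x.1.
Proof.
rewrite -[1%N]/(val (lift 0 (0 : 'I_m.+2))) crdE.
have := congr1 (fun v : 'rV[R]_m.+2 => v 0 0) (tailv_collapse (consv x.1 x.2)).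
by rewrite !mxE /= unlift_none.
Qed.

Lemma pinch_gloop0 x : x.1 = 0 -> pinch (gloop x) = point.
Proof. by move=> x0; apply: pinch_equator; rewrite gloop_crd1 x0 mulr0. Qed.

Lemma cts_pinch (X : topologicalType) k (f : X -> sphere R k) :
  continuous f -> continuous (fun x => pinch (f x)).
Proof. by move=> cf; apply: cts_comp cf _; exact: pinch_cts. Qed.

Lemma cts_ghalf e : e != 0 -> continuous (ghalf e).
Proof.
move=> e0; apply: cts_paste.
- by cts.
- by apply: cts_pinch; apply: cts_gloop; cts.
- by cts.
- by move=> x /eqP; rewrite mulf_eq0 (negPf e0) /= => /eqP /pinch_gloop0.
Qed.

Lemma gbounded_ghalf e : gbounded 1 (ghalf e).
Proof.
by move=> x s h; rewrite /ghalf gbounded_gloop // pinch_pt if_same.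
Qed.

Lemma headv_pinch (z : Sn) : headv (pinch z) = 1 - 2 * crd (svec z) 1 ^+ 2.
Proof. by rewrite /headv mxE. Qed.

Lemma tailv_pinch0 (z : Sn) : tailv (pinch z) 0 0 = 2 * crd (svec z) 1 * headv z.
Proof. by rewrite !mxE /= -[0%N]/(val (0 : 'I_m.+3)) crdE. Qed.

Lemma tailv_pinchS (z : Sn) j :
  tailv (pinch z) 0 (lift 0 j) = 2 * `|crd (svec z) 1| * tailv z 0 (lift 0 j).
Proof. by rewrite !mxE -crdE. Qed.

Definition gshift (e : R) (x : R * S) : Sn := gloop (x.1 - e * kap, x.2).

(** Both maps reach the antipode of the base point at (e * kap, 0), and they are never antipodal to
    each other. So half of the pinch map is joined to a translate of the standard loop by a straight
    homotopy. *)
Lemma ghalf_gshift e x : e = 1 \/ e = -1 -> svec (ghalf e x) + svec (gshift e x) != 0.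
Proof.
move=> e1; have ee : e * e = 1 by case: e1 => ->; rewrite ?mulrNN mulr1.
apply/eqP => /headv_add_tail; case: x => x s.
rewrite /gshift /gloop /=; set y := consv (x - _) s => -[hh ht].
have south : headv (collapse y) = -1 -> x = e * kap /\ s = 0.
  move=> /collapse_south y0; split.
    by apply/eqP; rewrite -subr_eq0; apply/eqP; rewrite -[LHS](consv0 _ s) -/y y0 mxE.
  by apply/rowP => j; rewrite -[LHS](consvS (x - e * kap)) -/y y0 !mxE.
have kk : 0 <= e * (e * kap) by rewrite mulrA ee mul1r ltW.
have hc0 : headv (collapse (consv 0 (0 : S))) = -1.
  have e0 : sqnorm (0 : S) = 0 by apply/eqP; rewrite sqnorm_eq0.
  rewrite headv_collapse sqnorm_consv e0 addr0 expr0n /=.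
  by rewrite [Num.min _ _](min_idPr _) ?ler01 // mulr0 sub0r.
have key : headv (ghalf e (e * kap, 0)) = -1.
  rewrite /ghalf /= kk headv_pinch gloop_crd1 /= sqnorm_consv.
  have -> : sqnorm (0 : S) = 0 by apply/eqP; rewrite sqnorm_eq0.
  have ek : (e * kap) ^+ 2 = 1 / 2.
    have -> : (e * kap) ^+ 2 = e * e * kap ^+ 2 by ring.
    by rewrite ee kap2 mul1r.
  rewrite addr0 ek.
  have -> : Num.min 1 (1 / 2) = 1 / 2 :> R by apply/min_idPr; lra.
  by rewrite exprMn ek exprMn sqr_sqrtr; lra.
have last_step : x = e * kap -> s = 0 -> headv (collapse y) = -1 -> False.
  by move=> xk s0 hs; move: hh; rewrite xk s0 key hs; lra.
have [[h0|h0] ?] : (headv (collapse y) = -1 \/ headv (collapse y) != -1) /\ True.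
  by split=> //; case: eqVneq => h; [left|right].
  by have [xk s0] := south h0; exact: last_step.
move: hh ht; rewrite /ghalf /=; case: ifP => ex; last first.
  by rewrite headv_pt => hh _; move/eqP: h0; apply; lra.
rewrite headv_pinch; set a := crd _ 1 => hh ht.
have ea : a = 2 * Num.sqrt (1 - Num.min 1 (sqnorm (consv x s))) * x by rewrite /a gloop_crd1.
set r := Num.sqrt _ in ea; have r0 : 0 <= r := sqrtr_ge0 _.
pose r' := Num.sqrt (1 - Num.min 1 (sqnorm y)); have r0' : 0 <= r' := sqrtr_ge0 _.
have tg : tailv (gloop (x, s)) = (2 * r) *: consv x s := tailv_collapse _.
have ty : tailv (collapse y) = (2 * r') *: y by rewrite tailv_collapse.
have eaa : e * a = `|a|.
  rewrite -[LHS]ger0_norm; first by rewrite normrM; case: e1 => ->; rewrite ?normrN normr1 mul1r.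
  by rewrite ea mulrCA mulr_ge0 // mulr_ge0.
(* The s components of both tails are nonnegative multiples of s, so they can only be opposite if s
   = 0 or the multiple on the side of [gshift] vanishes. *)
have rs : r' = 0 \/ s = 0.
  have [?|rn] := eqVneq r' 0; [by left|right].
  have r'0 : 0 < r' by rewrite lt_neqAle eq_sym rn.
  apply/rowP => j; rewrite mxE.
  have := congr1 (fun v : 'rV[R]_m.+2 => v 0 (lift 0 j)) ht.
  rewrite tailv_pinchS tg ty -/a !mxE /= liftK => h.
  have : (4 * `|a| * r + 2 * r') * s 0 j = 0 by rewrite -[2 * r']opprK; lra.
  move/eqP; rewrite mulf_eq0 => /orP[/eqP|/eqP //].
  have : 0 <= 4 * `|a| * r by rewrite !mulr_ge0.
  lra.
(* If r' = 0, then [gshift] is at the base point and [ghalf] at its antipode; this forces x = e *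
   kap and s = 0, where [gshift] is at the antipode as well. *)
have [r'z|r'n] := eqVneq r' 0.
  have hy : headv (collapse y) = 1.
    move/eqP: r'z; rewrite /r' sqrtr_eq0 headv_collapse => h1.
    have : Num.min 1 (sqnorm y) <= 1 by rewrite ge_min lexx.
    lra.
  have a2 : a ^+ 2 = 1 by rewrite hy in hh; lra.
  have r2 : r ^+ 2 = 1 - Num.min 1 (sqnorm (consv x s)).
    by rewrite sqr_sqrtr // subr_ge0 ge_min lexx.
  have sx : 0 <= sqnorm s := sqnorm_ge0 s.
  have q1 : sqnorm (consv x s) = x ^+ 2 + sqnorm s by rewrite sqnorm_consv.
  have a2' : 4 * r ^+ 2 * x ^+ 2 = 1.
    by transitivity (a ^+ 2); [rewrite ea; ring|].
  have x2 : x ^+ 2 = 1 / 2 /\ sqnorm s = 0.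
    have := sqr_ge0 (2 * x ^+ 2 - 1); have := sqr_ge0 x.
    move: r2; rewrite q1; case: (lerP 1 (x ^+ 2 + sqnorm s)) => h1 r2.
      by move: a2'; rewrite r2 subrr mulr0 mul0r => /eqP; rewrite eq_sym oner_eq0.
    rewrite r2 in a2'; move: (x ^+ 2) (sqnorm s) sx h1 a2' => X Z Z0 h1 a2' X0 hX.
    have X1 : 0 < X.
      by rewrite lt_neqAle X0 andbT; apply: contra_eq_neq a2' => <-; rewrite mulr0 eq_sym oner_neq0.
    have XZ : X * Z = 0.
      have : 0 <= X * Z by rewrite mulr_ge0.
      by move=> ?; apply/eqP; rewrite eq_le; apply/andP; split; nra.
    have Z00 : Z = 0 by move/eqP: XZ; rewrite mulf_eq0 gt_eqF //= => /eqP.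
    split=> //; have /eqP : (2 * X - 1) ^+ 2 = 0.
      have -> : (2 * X - 1) ^+ 2 = 1 - 4 * (1 - (X + Z)) * X - 4 * (X * Z) by ring.
      by rewrite a2' XZ; ring.
    by rewrite sqrf_eq0 => /eqP; lra.
  have s0 : s = 0 by apply/eqP; rewrite -sqnorm_eq0 x2.2.
  have xk : x = e * kap.
    have : (e * x - kap) * (e * x + kap) = 0.
      have -> : (e * x - kap) * (e * x + kap) = e * e * x ^+ 2 - kap ^+ 2 by ring.
      by rewrite ee x2.1 kap2 [1 * _]mul1r subrr.
    move/eqP; rewrite mulf_eq0 => /orP[|/eqP h]; last first.
      have := addr_ge0 ex (ltW kap0); rewrite h => _.
      by have := ltr_wpDl ex kap0; rewrite h ltxx.
    by rewrite subr_eq0 => /eqP <-; rewrite mulrA ee mul1r.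
  by move: hy; rewrite /y xk s0 subrr hc0; lra.
case: rs => [r'e|s0]; first by rewrite r'e eqxx in r'n.
have r'0 : 0 < r' by rewrite lt_neqAle eq_sym r'n.
have := congr1 (fun v : 'rV[R]_m.+2 => v 0 0) ht.
have hg : headv (gloop (x, s)) = 2 * Num.min 1 (sqnorm (consv x s)) - 1 := headv_collapse _.
have y0 : y 0 0 = x - e * kap := consv0 _ _.
rewrite tailv_pinch0 hg -/a ty mxE [in RHS]mxE y0 => h.
have {}h : 2 * `|a| * (2 * Num.min 1 (sqnorm (consv x s)) - 1) + 2 * r' * (e * x - kap) = 0.
  transitivity (e * (2 * a * (2 * Num.min 1 (sqnorm (consv x s)) - 1)) + 2 * r' * (e * x - e * e * kap)).
    by rewrite ee mul1r -eaa; ring.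
  by rewrite h; ring.
have sq : sqnorm (consv x s) = (e * x) ^+ 2.
  rewrite sqnorm_consv s0.
  have -> : sqnorm (0 : S) = 0 by apply/eqP; rewrite sqnorm_eq0.
  by rewrite addr0 exprMn [e ^+ 2]expr2 ee mul1r.
(* Neither summand of [h] has a sign opposite to that of e x - kap, and the second one is a positive
   multiple of it. *)
have xk : e * x = kap.
  apply/eqP; rewrite -subr_eq0; apply/negPn/negP => d0.
  have a0 := normr_ge0 a; rewrite sq in h.
  have sqlt (u v : R) : 0 <= u -> u < v -> u ^+ 2 < v ^+ 2 by move=> *; nra.
  have [lt|gt|E] := ltrgtP (e * x) kap; last by rewrite E subrr eqxx in d0.
    have x2 : (e * x) ^+ 2 < 1 / 2 by rewrite -kap2; exact: sqlt.
    have l : Num.min 1 ((e * x) ^+ 2) <= (e * x) ^+ 2 by rewrite ge_min lexx orbT.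
    have lt0 : e * x - kap < 0 by rewrite subr_lt0.
    have : 2 * r' * (e * x - kap) < 0 by rewrite nmulr_llt0 // mulr_gt0.
    have : 2 * `|a| * (2 * Num.min 1 ((e * x) ^+ 2) - 1) <= 0.
      by rewrite mulr_ge0_le0 ?mulr_ge0 //; lra.
    lra.
  have x2 : 1 / 2 < (e * x) ^+ 2 by rewrite -kap2; apply: sqlt => //; exact: ltW.
  have l : 1 / 2 <= Num.min 1 ((e * x) ^+ 2) by rewrite le_min (ltW x2) andbT; lra.
  have lt0 : 0 < e * x - kap by rewrite subr_gt0.
  have : 0 < 2 * r' * (e * x - kap) by rewrite !mulr_gt0.
  have : 0 <= 2 * `|a| * (2 * Num.min 1 ((e * x) ^+ 2) - 1).
    by rewrite !mulr_ge0 //; lra.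
  lra.
apply: (last_step _ s0).
  by rewrite -xk mulrA ee mul1r.
by rewrite /y -xk mulrA ee mul1r subrr s0.
Qed.

End Loops.

Section LoopSum.
Context (R : realType) (m : nat) (Y : ptopologicalType).
Local Notation S := 'rV[R]_m.+1.
Local Notation Sn := (sphere R m.+2).
Local Notation A := (aclasses R m Y).
Implicit Types (g : pointed_map Sn Y).

Lemma ghomot_comp (G G' : R * S -> Sn) g : ghomot G G' ->
  ghomot (fun x => g (G x)) (fun x => g (G' x)).
Proof.
move=> [H [cH [r bH] H0 H1]]; have cg := @pmap_cts _ _ g.
exists (fun z => g (H z)); split=> [||x|x]; rewrite ?H0 ?H1 //; first by cts.
by exists r => a x s h; rewrite (bH a) // pmap_pt.
Qed.

Lemma is_gmap_comp (G : R * S -> Sn) g : is_gmap G -> is_gmap (fun x => g (G x)).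
Proof.
move=> [cG [c bG]]; have cg := @pmap_cts _ _ g; split; first by cts.
by exists c => x s h; rewrite bG // pmap_pt.
Qed.

Lemma is_gmap_gloop : is_gmap (@gloop R m).
Proof.
split; last by exists 1; exact: gbounded_gloop.
by apply: (@cts_gloop R m _ (fun x => x)); cts.
Qed.

Lemma is_gmap_ghalf (e : R) : e != 0 -> is_gmap (@ghalf R m e).
Proof. by move=> e0; split; [exact: cts_ghalf|exists 1; exact: gbounded_ghalf]. Qed.

(** The standard loop is translated by e / sqrt 2, and the result is joined to [ghalf e] through
    non-antipodal points. *)
Lemma whiskc_ghalf (e : R) g (a : A) : e = 1 \/ e = -1 ->
  whiskc (fun x => g (@ghalf R m e x)) a = whiskc (fun x => g (@gloop R m x)) a.
Proof.
move=> e1; have e0 : e != 0 by case: e1 => ->; rewrite ?oppr_eq0 oner_neq0.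
have ek : `|e * (Num.sqrt 2)^-1| <= 1.
  have s1 : 1 <= Num.sqrt (2 : R) by rewrite -[leLHS]sqrtr1 ler_wsqrtr //; lra.
  have : (Num.sqrt (2 : R))^-1 <= 1 by rewrite invf_le1 // (lt_le_trans ltr01).
  rewrite normrM; case: e1 => ->; rewrite ?normrN normr1 mul1r ger0_norm //;
  by rewrite invr_ge0 sqrtr_ge0.
have cgl := is_gmap_gloop.1; have cgh := @cts_ghalf R m e e0.
have bs : gbounded 2 (@gshift R m e).
  move=> x s h; apply: gbounded_gloop; case: h => h; [left|right; lra].
  by have := lerB_normD x (- (e * (Num.sqrt 2)^-1)); rewrite normrN; lra.
have csh : continuous (@gshift R m e).
  by rewrite /gshift; apply: cts_gloop; cts.
rewrite (@whiskc_ghomot _ _ _ _ (fun x => g (@gshift R m e x))).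
  apply: whiskc_ghomot; apply: ghomot_comp.
  apply: (@ghomot_itv _ _ _ (fun z : R * (R * S) =>
    @gloop R m (z.2.1 - (1 - z.1) * (e * (Num.sqrt 2)^-1), z.2.2)) 2) => [|b /andP[b0 b1]|[x s]|[x s]].
  - by apply: cts_gloop; cts.
  - move=> x s h; apply: gbounded_gloop; case: h => h; [left|right; lra].
    have := lerB_normD x (- ((1 - b) * (e * (Num.sqrt 2)^-1))).
    rewrite normrN normrM (@ger0_norm _ (1 - b)); last lra.
    by have := normr_ge0 (e * (Num.sqrt 2)^-1); nra.
  - by rewrite /= subr0 mul1r.
  - by rewrite /= subrr mul0r subr0.
apply: ghomot_comp; exists (fun z => shom z.1 (@ghalf R m e z.2) (@gshift R m e z.2)).
split=> [||x|x]; rewrite ?shom0 ?shom1 //.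
  by apply: cts_shom; [cts|cts|cts|move=> z; exact: ghalf_gshift].
exists 2 => b x s h; rewrite bs //= (@gbounded_ghalf _ _ e) ?shom_same //.
by case: h => h; [left|right]; lra.
Qed.

Lemma wdiff_ghomot (G G' : R * S -> Y) (a : A) : ghomot G G' -> wdiff G a = wdiff G' a.
Proof. by move=> h; rewrite /wdiff (whiskc_ghomot a h). Qed.

(** The two halves of [padd] are carried by x >= 0 and x <= 0 and are trivial at x = 0. Moving them
    apart by 1 gives the concatenation [star 1]. *)
Lemma wdiff_padd (g g' : pointed_map Sn Y) (a : A) :
  wdiff (fun x => padd g g' (@gloop R m x)) a =
  wdiff (fun x => g (@gloop R m x)) a + wdiff (fun x => g' (@gloop R m x)) a.
Proof.
have n1 : (1 : R) != 0 := oner_neq0 _; have n1' : (-1 : R) != 0 by rewrite oppr_eq0.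
have gP := is_gmap_comp g (is_gmap_ghalf n1).
have gQ := is_gmap_comp g' (is_gmap_ghalf n1').
have bP : gbounded 1 (fun x => g (@ghalf R m 1 x)).
  by move=> x s h; rewrite gbounded_ghalf // pmap_pt.
have bQ : gbounded 1 (fun x => g' (@ghalf R m (-1) x)).
  by move=> x s h; rewrite gbounded_ghalf // pmap_pt.
have cP := gP.1; have cQ := gQ.1.
transitivity (wdiff (star 1 (fun x => g (@ghalf R m 1 x))
                            (fun x => g' (@ghalf R m (-1) x))) a); last first.
  have e1 := whiskc_ghalf g a (or_introl (erefl (1 : R))).
  have e2 := whiskc_ghalf g' a (or_intror (erefl (-1 : R))).
  by rewrite (wdiff_star a gP gQ (lexx _) bP bQ) /wdiff e1 e2.
apply: wdiff_ghomot.
apply: (@ghomot_itv _ _ _ (fun z : R * (R * S) =>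
  if 0 <= z.2.1 then g (@ghalf R m 1 (z.2.1 - clamp z.1, z.2.2))
  else g' (@ghalf R m (-1) (z.2.1 + clamp z.1, z.2.2))) 2) => [|b /andP[b0 b1]|[x s]|[x s]].
- have cP' : continuous (fun z : R * (R * S) => g (@ghalf R m 1 (z.2.1 - clamp z.1, z.2.2))).
    by apply: (@cts_comp _ _ _ (fun z : R * (R * S) => (z.2.1 - clamp z.1, z.2.2)) _ _ cP); cts.
  have cQ' : continuous (fun z : R * (R * S) => g' (@ghalf R m (-1) (z.2.1 + clamp z.1, z.2.2))).
    by apply: (@cts_comp _ _ _ (fun z : R * (R * S) => (z.2.1 + clamp z.1, z.2.2)) _ _ cQ); cts.
  apply: cts_paste; [by cts|by cts|by cts|].
  move=> [b [x s]] /= ->; have /andP[c0 c1] := clamp_itv b.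
  have half e : e = 1 \/ e = -1 -> @ghalf R m e (- e * clamp b, s) = point.
    move=> e1; rewrite /ghalf /=.
    have -> : e * (- e * clamp b) = - clamp b by case: e1 => ->; ring.
    case: ifP => // h; have cb : clamp b = 0 by lra.
    by rewrite pinch_gloop0 //= cb mulr0.
  have := half 1 (or_introl erefl); have := half (-1) (or_intror erefl).
  by rewrite opprK mul1r mulN1r sub0r add0r => -> ->; rewrite !pmap_pt.
- move=> x s h /=; rewrite clamp_id ?b0 //; case: ifP => x0.
    apply: bP; case: h => h; [left|by right; lra].
    by move: h; rewrite ger0_norm // => h; rewrite ler_normr; apply/orP; left; lra.
  have {}x0 : x < 0 by rewrite ltNge x0.
  apply: bQ; case: h => h; [left|by right; lra].
  by move: h; rewrite ltr0_norm // => h; rewrite ler_normr; apply/orP; right; lra.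
- rewrite /= clamp_id ?lexx ?ler01 // subr0 addr0 /padd_fun gloop_crd1 /=.
  set r := 2 * _; have r0 : 0 <= r by rewrite /r mulr_ge0 // sqrtr_ge0.
  case: ifP => x0; first by rewrite mulr_ge0 // /ghalf /= mul1r x0.
  have {}x0 : x < 0 by rewrite ltNge x0.
  rewrite /ghalf /= mulN1r oppr_ge0 (ltW x0); case: ifP => // rx.
  have rx0 : r * x = 0 by apply/le_anti; rewrite rx andbT mulr_ge0_le0 // ltW.
  by rewrite pinch_equator ?pmap_pt // gloop_crd1.
- by rewrite /= clamp_id ?lexx ?ler01.
Qed.

Definition Dh (a : A) (b : hgroup R m.+2 Y) : A :=
  wdiff (fun x => repr b (@gloop R m x)) a.

Lemma DhE (a : A) g : Dh a (hclass R g) = wdiff (fun x => g (@gloop R m x)) a.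
Proof.
have /hclassP/homotopicP[H [cH H0 H1 Hp]] := hclass_repr (hclass R g).
rewrite /Dh; apply: wdiff_ghomot; have cgl := is_gmap_gloop.1.
exists (fun z => H (@gloop R m z.2, z.1)); split=> [||x|x]; rewrite ?H0 ?H1 //.
  by cts.
by exists 1 => b x s h; rewrite gbounded_gloop // Hp.
Qed.

Lemma DhD (a : A) b b' : Dh a (hadd b b') = Dh a b + Dh a b'.
Proof. by rewrite {1}/hadd DhE wdiff_padd. Qed.

Lemma Dh_hmuln (a : A) b k : Dh a (hmuln k b) = Dh a b *+ k.
Proof.
elim: k => [|k IH].
  have e := DhE a (pointed_const (sphere R m.+2) Y).
  by rewrite /hmuln /= /hzero e /wdiff whiskc_const subrr mulr0n.
by rewrite mulrS -IH; exact: DhD.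
Qed.

Lemma phi_Dh (a : A) (b b' : hgroup R m.+2 Y) (k : nat) (z : int) : hmuln k b' = b ->
  phi (a *+ k + Dh a b *~ z) = phi (a *+ k).
Proof.
move=> <-; rewrite Dh_hmuln; apply: phi_wdiff.
exact: is_gmap_comp is_gmap_gloop.
Qed.

End LoopSum.

(** * Invariants of finite degree *)

Section Locality.
Import freeg.

Lemma C0_funE (X Y : choiceType) (a : X -> Y) (D : C0 X) :
  C0_fun a D = \sum_(z <- dom D) (coeff z D) *: (<< a z >> : {freeg Y}).
Proof.
rewrite -{1}(freeg_sumE D) (raddf_sum (C0_fun a)) /=; apply: eq_bigr => z _.
by rewrite /C0_fun liftU.
Qed.

Definition toggle (k : nat) (i : 'I_k) (E : {set 'I_k}) : {set 'I_k} :=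
  if i \in E then E :\ i else i |: E.

Lemma toggleK k (i : 'I_k) : involutive (toggle i).
Proof.
move=> E; rewrite /toggle; have [iE|iE] := boolP (i \in E).
  by rewrite finset.setD11 finset.setD1K.
by rewrite finset.setU11 finset.setU1K.
Qed.

Lemma odd_toggle k (i : 'I_k) E : odd #|toggle i E| = ~~ odd #|E|.
Proof.
rewrite /toggle; have [iE|iE] := boolP (i \in E).
  by rewrite (cardsD1 i E) iE /= negbK.
by rewrite cardsU1 iE.
Qed.

Lemma in_toggle k (i j : 'I_k) E : j != i -> (j \in toggle i E) = (j \in E).
Proof.
by move=> ji; rewrite /toggle; case: ifP => _; rewrite !inE (negPf ji).
Qed.

Lemma hom_fun_sum (A B : zmodType) (I : Type) (s : seq I) (P : pred I)
    (F : I -> zhom A B) D :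
  hom_fun (\sum_(i <- s | P i) F i) D = \sum_(i <- s | P i) hom_fun (F i) D.
Proof. by apply: (big_morph (fun h : zhom A B => hom_fun h D)). Qed.

(* If the value of a E at a point only depends on whether one index belongs to
   E, then r + 1 indices suffice for the alternating sum of the r-th Cartesian
   powers to vanish. *)
Lemma local_family (X Y : choiceType) (r : nat) (a : {set 'I_r.+1} -> X -> Y)
    (iota : X -> 'I_r.+1) :
  (forall x (E E' : {set 'I_r.+1}),
     (iota x \in E) = (iota x \in E') -> a E x = a E' x) ->
  \sum_(E : {set 'I_r.+1} | odd #|E|) C0_map (map_tuple (n := r) (a E)) =
  \sum_(E : {set 'I_r.+1} | ~~ odd #|E|) C0_map (map_tuple (n := r) (a E)).
Proof.
move=> aP; apply: hom_eqP => D; rewrite !hom_fun_sum.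
have e E : hom_fun (C0_map (map_tuple (n := r) (a E))) D =
    \sum_(z <- dom D) (coeff z D) *: (<< map_tuple (n := r) (a E) z >> : {freeg _}).
  by rewrite /hom_fun /= C0_funE.
under eq_bigr do rewrite e; under [RHS]eq_bigr do rewrite e.
rewrite exchange_big [RHS]exchange_big /=; apply: eq_bigr => z _.
rewrite -!scaler_sumr; congr (_ *: _).
have [i iz] : exists i, i \notin [seq iota x | x <- z].
  apply/existsP; apply: contraT => /existsPn h.
  have : (#|'I_r.+1| <= size [seq iota x | x <- z])%N.
    apply: (leq_trans _ (card_size _)); apply: subset_leq_card; apply/fintype.subsetP => i _.
    by have := h i; rewrite negbK.
  by rewrite card_ord size_map size_tuple ltnn.
rewrite (reindex_inj (inv_inj (toggleK i))) /=.
apply: eq_big => E; first by rewrite odd_toggle.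
move=> _; congr << _ >>; apply: val_inj => /=; apply/eq_in_map => x xz.
apply: aP; apply: in_toggle; apply: contraNneq iz => <-.
by apply/mapP; exists x.
Qed.

Context (R : realType).

(** In each family the vanishing alternating sum expresses the value at the empty subset by the
    values at the others, where the two families agree. *)
Lemma local_invariant (X Y : ptopologicalType) (V : zmodType) (r : nat)
    (f : hclasses R X Y -> V) (a b : {set 'I_r.+1} -> pointed_map X Y)
    (iota iota' : X -> 'I_r.+1) :
  degree_at_most r f ->
  (forall x (E E' : {set 'I_r.+1}), (iota x \in E) = (iota x \in E') -> a E x = a E' x) ->
  (forall x (E E' : {set 'I_r.+1}), (iota' x \in E) = (iota' x \in E') -> b E x = b E' x) ->
  (forall E, E != finset.set0 -> hclass R (a E) = hclass R (b E)) ->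
  f (hclass R (a finset.set0)) = f (hclass R (b finset.set0)).
Proof.
move=> [l fl] aP bP ab.
have alt (c : {set 'I_r.+1} -> pointed_map X Y) io :
    (forall x (E E' : {set 'I_r.+1}), (io x \in E) = (io x \in E') -> c E x = c E' x) ->
    f (hclass R (c finset.set0)) = \sum_(E : {set 'I_r.+1} | odd #|E|) f (hclass R (c E)) -
      \sum_(E : {set 'I_r.+1} | ~~ odd #|E| && (E != finset.set0)) f (hclass R (c E)).
  move=> cP; have := congr1 l (@local_family _ _ r (fun E => c E) io cP).
  rewrite !(raddf_sum l); under eq_bigr do rewrite -fl.
  under [RHS]eq_bigr do rewrite -fl; move=> ->.
  rewrite (bigD1 finset.set0) ?cards0 //=. by rewrite addrK.
rewrite (alt _ _ aP) (alt _ _ bP); congr (_ - _).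
  apply: eq_bigr => E oE; rewrite ab //; apply: contraTneq oE => ->.
  by rewrite cards0.
by apply: eq_bigr => E /andP[_ E0]; rewrite ab.
Qed.

End Locality.

Section Stack.
Context (R : realType) (m : nat) (Y : ptopologicalType).
Local Notation S := 'rV[R]_m.+1.
Local Notation T := 'rV[R]_m.+2.
Local Notation X := (sphere R m.+1 * sphere R m.+2)%type.
Local Notation A := (aclasses R m Y).
Implicit Types (f g : S * T -> Y).

(** The distance doubles because adding at distance r turns the radius r into 2 r; this keeps all
    supports disjoint. *)
Fixpoint stack (r : R) f (gs : seq (S * T -> Y)) : S * T -> Y :=
  if gs is g :: gs' then stack (2 * r) (addf r f g) gs' else f.

Lemma stack_amap gs r f : 1 <= r -> is_amap f -> bounded_by r f ->
  (forall i, is_amap (nth f gs i) /\ bounded_by r (nth f gs i)) ->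
  [/\ is_amap (stack r f gs), bounded_by (2 ^+ (size gs) * r) (stack r f gs) &
      acls (stack r f gs) = acls f + \sum_(g <- gs) acls g].
Proof.
elim: gs r f => [|g gs IH] r f r1 af bf ags /=.
  by split=> //; [rewrite mul1r|rewrite big_nil addr0].
have [ag bg] := ags 0%N; rewrite /= in ag bg.
have r0 : 0 <= r by lra.
have afg := is_amap_addf af ag r0 (lexx _) bf bg.
have bfg : bounded_by (2 * r) (addf r f g).
  by rewrite (_ : 2 * r = r + r); [exact: bounded_addf|ring].
have [|//|//|i|a1 b1 c1] := IH (2 * r) (addf r f g); first by lra.
  have [isz|isz] := ltnP i (size gs); last by rewrite nth_default.
  rewrite (set_nth_default f) //; have [h1 h2] := ags i.+1.
  by split=> //; apply: bounded_by_le h2; lra.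
split=> //.
  by rewrite (_ : 2 ^+ (size gs).+1 * r = 2 ^+ size gs * (2 * r)) // exprS; ring.
by rewrite c1 (acls_add af ag bf bg r0 (lexx _)) big_cons addrA.
Qed.

(** The order of the quantifiers matters: which summand is seen at x, and at which point y, does not
    depend on the maps that are added. *)
Lemma stack_local k r x : exists j y, (j <= k)%N /\
  forall f gs, size gs = k -> stack r f gs x = nth f (f :: gs) j y.
Proof.
elim: k r => [|k IH] r; first by exists 0%N, x; split=> // f [].
have [j [y [jk h]]] := IH (2 * r).
have [j0|j0] := posnP j; last first.
  exists j.+1, y; split=> // f [//|g gs] [sz] /=; rewrite h //.
  by case: j j0 jk {h} => //= j _ jk; rewrite (set_nth_default f) // sz.
have [t0|t0] := boolP (0 <= y.2 0 0).
  exists 0%N, (y.1, y.2 - r *: ax R m); split=> // f [//|g gs] [sz] /=.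
  by rewrite h // j0 /= /addf t0.
exists 1%N, (y.1, y.2 + r *: ax R m); split=> // f [//|g gs] [sz] /=.
by rewrite h // j0 /= /addf (negPf t0).
Qed.

Definition copies (k : nat) (g : S * T -> Y) (E : {set 'I_k}) : seq (S * T -> Y) :=
  [seq if i \in E then g else fun=> point | i <- enum 'I_k].
Arguments copies : clear implicits.

Lemma copies_amap k g E f r i : is_amap f -> is_amap g -> bounded_by r f -> bounded_by r g ->
  is_amap (nth f (copies k g E) i) /\ bounded_by r (nth f (copies k g E) i).
Proof.
move=> af ag bf bg; have [ik|ik] := ltnP i (size (copies k g E)); last first.
  by rewrite nth_default.
have /mapP[j _ ->] := mem_nth f ik; case: (j \in E) => //; split=> //.
exact: is_amap_cst.
Qed.

Lemma sum_copies k g E : \sum_(h <- copies k g E) acls h = acls g *+ #|E|.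
Proof.
rewrite big_map big_enum /= -sumr_const [RHS]big_mkcond /=.
by apply: eq_bigr => i _; case: (i \in E); rewrite ?acls_point.
Qed.

(** The two families are a + |E| al and b + |E| al, made of r + 1 disjoint places for copies of al,
    of which those in E are filled. Nonempty E correspond to the multiples [al *+ k.+1] of the
    hypothesis. *)
Lemma finite_degree_phi (V : zmodType) (F : hclasses R X Y -> V) (a b al : A) :
  finite_degree F ->
  (forall k, phi (a + al *+ k.+1) = phi (b + al *+ k.+1)) -> F (phi a) = F (phi b).
Proof.
move=> [r Fr] ab; pose f := arep a; pose f' := arep b; pose g := arep al.
have [af af' ag] : [/\ is_amap f, is_amap f' & is_amap g] by split; exact: arep_amap.
have [[f1 bf] [f1' bf'] [g1 bg]] := And3 (radP af) (radP af') (radP ag).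
pose q := rad f + rad f' + rad g.
have q1 : 1 <= q by rewrite /q; lra.
have {}bf : bounded_by q f by apply: bounded_by_le bf; rewrite /q; lra.
have {}bf' : bounded_by q f' by apply: bounded_by_le bf'; rewrite /q; lra.
have {}bg : bounded_by q g by apply: bounded_by_le bg; rewrite /q; lra.
pose Q := 2 ^+ r.+1 * q; pose lam := (m.+2)%:R * Q.
have Q0 : 0 <= Q by rewrite /Q mulr_ge0 ?exprn_ge0 //; lra.
pose st u (E : {set 'I_r.+1}) := stack q u (copies r.+1 g E).
have size_copies (E : {set 'I_r.+1}) : size (copies r.+1 g E) = r.+1.
  by rewrite size_map size_enum_ord.
have main u : is_amap u -> bounded_by q u -> exists iota : X -> 'I_r.+1,
    [/\ forall x (E E' : {set 'I_r.+1}), (iota x \in E) = (iota x \in E') ->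
          mkp (Phi lam (st u E)) x = mkp (Phi lam (st u E')) x &
        forall E, hclass R (mkp (Phi lam (st u E))) = phi (acls u + al *+ #|E|)].
  move=> au bu.
  have stP E : [/\ is_amap (st u E), bounded_by Q (st u E) &
      acls (st u E) = acls u + al *+ #|E|].
    have [||//|i|h1 h2 h3] := @stack_amap (copies r.+1 g E) q u => //.
      exact: copies_amap.
    split=> //; first by rewrite size_copies in h2.
    by rewrite /st h3 sum_copies acls_rep.
  have loc x : exists j : 'I_r.+1, forall E E' : {set 'I_r.+1}, (j \in E) = (j \in E') ->
      st u E x = st u E' x.
    have [j [y [jr h]]] := stack_local r.+1 q x.
    (* Summand 0 is u, which is present for every E; the index [ord0] assigned to such a point is
       arbitrary. *)
    case: j jr h => [|j] jr h; first by exists ord0 => E E' _; rewrite /st !h.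
    exists (Ordinal jr) => E E' EE'; rewrite /st !h //= /copies.
    have e : nth (Ordinal jr) (enum 'I_r.+1) j = Ordinal jr := nth_ord_enum _ (Ordinal jr).
    by rewrite !(nth_map (Ordinal jr)) -?enumT ?size_enum_ord // e EE'.
  have [iota io] := choice (fun x : X => loc (zeta lam x.1, zeta lam x.2)).
  have mkE E : mkp (Phi lam (st u E)) = Phi lam (st u E) :> (X -> Y).
    have [[cs _] bs _] := stP E; have ws := bounded_wbounded bs.
    apply: mkpE; last by apply: (Phi_pt ws).
    have := @cts_Phi R m Y R (fun=> lam) (fun=> Q) (fun z => st u E z.2).
    move=> /(_ _ _ _ _ _)/(cts_comp (@cts_pairl R X 0)); apply=> //; by cts.
  exists iota; split=> [x E E' h|E]; first by rewrite !mkE; exact: io.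
  have [[cs _] bs <-] := stP E; rewrite phiE; last by split=> //; exists Q.
  by apply/esym; apply: PhiclsE (bounded_wbounded bs) _ _.
have [io [io1 io2]] := main f af bf; have [io' [io1' io2']] := main f' af' bf'.
have := local_invariant Fr io1 io1'; rewrite !io2 !io2' !acls_rep cards0 !mulr0n !addr0.
apply=> E E0; rewrite io2 io2' !acls_rep.
by have := ab #|E|.-1; rewrite prednK // card_gt0.
Qed.

End Stack.

(** * The Whitehead square as a linking map *)

Section Push.
Context (R : realType) (m : nat).
Local Notation S := 'rV[R]_m.+1.
Local Notation T := 'rV[R]_m.+2.

Lemma is_amap_comp (Y Y' : ptopologicalType) (g : pointed_map Y Y') (f : S * T -> Y) :
  is_amap f -> is_amap (fun x => g (f x)).
Proof.
move=> [cf [r [b1 b2]]]; have cg := @pmap_cts _ _ g; split; first by cts.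
exists r; split=> [s t h|s s' t h h']; first by rewrite b1 // pmap_pt.
by rewrite (b2 s s').
Qed.

Lemma ahomot_comp (Y Y' : ptopologicalType) (g : pointed_map Y Y') (f f' : S * T -> Y) :
  ahomot f f' -> ahomot (fun x => g (f x)) (fun x => g (f' x)).
Proof.
move=> [H [cH [r bH] H0 H1]]; have cg := @pmap_cts _ _ g.
exists (fun z => g (H z)); split=> [||x|x]; rewrite ?H0 ?H1 //; first by cts.
exists r => a; have [b1 b2] := bH a; split=> [s t h|s s' t h h'].
  by rewrite b1 // pmap_pt.
by rewrite (b2 s s').
Qed.

Definition push (Y Y' : ptopologicalType) (g : pointed_map Y Y')
    (a : aclasses R m Y) : aclasses R m Y' := acls (fun x => g (arep a x)).

Lemma pushE (Y Y' : ptopologicalType) (g : pointed_map Y Y') (f : S * T -> Y) :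
  is_amap f -> push g (acls f) = acls (fun x => g (f x)).
Proof.
move=> af; apply: (acls_lift (phi := fun u => acls (fun x => g (u x)))) => //.
- by move=> u v uv; apply: acls_homot; exact: ahomot_comp.
- exact: arep_amap.
- exact: acls_rep.
Qed.

Lemma pushD (Y Y' : ptopologicalType) (g : pointed_map Y Y') (a b : aclasses R m Y) :
  push g (a + b) = push g a + push g b.
Proof.
rewrite -(acls_rep a) -(acls_rep b); have af := arep_amap a; have ag := arep_amap b.
have [[f1 bf] [g1 bg]] := (radP af, radP ag); pose r := rad (arep a) + rad (arep b).
have bf' : bounded_by r (arep a) by apply: bounded_by_le bf; rewrite /r; lra.
have bg' : bounded_by r (arep b) by apply: bounded_by_le bg; rewrite /r; lra.
have r0 : 0 <= r by rewrite /r; lra.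
have comp_b u : bounded_by r u -> bounded_by r (fun x => g (u x)).
  move=> [b1 b2]; split=> [s t h|s s' t h h']; first by rewrite b1 // pmap_pt.
  by rewrite (b2 s s').
rewrite -(acls_add af ag bf' bg' r0 (lexx _)) !pushE //; last exact: is_amap_addf.
rewrite -(@acls_add R m Y' r r); try exact: is_amap_comp; try exact: comp_b; try by [].
by apply: acls_eq => x; rewrite /addf; case: ifP.
Qed.

Lemma push0 (Y Y' : ptopologicalType) (g : pointed_map Y Y') :
  push g (0 : aclasses R m Y) = 0.
Proof. by apply: (addrI (push g 0)); rewrite -pushD !addr0. Qed.

Lemma pushN (Y Y' : ptopologicalType) (g : pointed_map Y Y') (a : aclasses R m Y) :
  push g (- a) = - push g a.
Proof. by apply: (addrI (push g a)); rewrite -pushD !subrr push0. Qed.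

Lemma pushMz (Y Y' : ptopologicalType) (g : pointed_map Y Y') (a : aclasses R m Y) z :
  push g (a *~ z) = push g a *~ z.
Proof.
have Mn k : push g (a *+ k) = push g a *+ k.
  by elim: k => [|k IH]; rewrite ?mulr0n ?push0 // !mulrS pushD IH.
by case: z => k; rewrite -?pmulrn ?NegzE ?mulrNz -?pmulrn ?pushN Mn.
Qed.

Lemma push_homot (Y Y' : ptopologicalType) (g g' : pointed_map Y Y') (a : aclasses R m Y) :
  homotopic R g g' -> push g a = push g' a.
Proof.
move=> /homotopicP[H [cH H0 H1 Hp]]; apply: acls_homot.
have [cf [r [b1 b2]]] := arep_amap a.
exists (fun z => H (arep a z.2, z.1)); split=> [||x|x]; rewrite ?H0 ?H1 //; first by cts.
exists r => b; split=> [s t h|s s' t h h']; first by rewrite /= b1 // Hp.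
by rewrite /= (b2 s s').
Qed.

End Push.

(** * Concentrating a map to a sphere near the preimages of one direction *)

Section SphereRetraction.
Context (R : realType) (k : nat).
Implicit Types (w : 'rV[R]_k) (b e : R).

(* The map (w, b) |-> w / (e b) from the half space b > 0 to R^k, followed by the
   collapse onto S^k; the rest of R^k x R \ 0 goes to the base point. *)
Definition Kf e w b : sphere R k :=
  if enorm w - e * b <= 0 then collapse ((Num.max (e * `|b|) (enorm w))^-1 *: w)
  else point.

Lemma cts_Kf (Z : topologicalType) (e : R) (w : Z -> 'rV[R]_k) (b : Z -> R) :
  0 < e -> continuous w -> continuous b -> (forall z, w z != 0 \/ b z != 0) ->
  continuous (fun z => Kf e (w z) (b z)).
Proof.
move=> e0 cw cb wb; have m0 z : Num.max (e * `|b z|) (enorm (w z)) != 0.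
  rewrite gt_eqF // lt_max; case: (wb z) => h.
    by rewrite [X in _ || X]lt_neqAle enorm_ge0 andbT eq_sym enorm_eq0 h orbT.
  by rewrite mulr_gt0 // normr_gt0.
apply: cts_if; [by cts| |by cts|].
  apply: cts_collapse; apply: cts_scalev => //; apply: cts_inv => //.
  by cts.
move=> z /eqP; rewrite subr_eq0 => /eqP h; apply: collapse_pt.
have b0 : 0 <= b z by rewrite -(pmulr_rge0 _ e0) -h enorm_ge0.
rewrite ger0_norm // -h maxxx enormZ ?invr_ge0 ?enorm_ge0 // mulVf //.
by move: (m0 z); rewrite ger0_norm // -h maxxx.
Qed.

Lemma Kf_pt e w b : 0 < e -> b <= 0 -> w != 0 \/ b != 0 -> Kf e w b = point.
Proof.
move=> e0 b0 wb; rewrite /Kf ifF //; apply/negbTE; rewrite -ltNge.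
case: wb => h.
  have : 0 < enorm w by rewrite lt_neqAle enorm_ge0 andbT eq_sym enorm_eq0.
  have : e * b <= 0 by rewrite pmulr_rle0.
  lra.
have bn : b < 0 by rewrite lt_neqAle h.
have : e * b < 0 by rewrite pmulr_rlt0.
by have := enorm_ge0 w; lra.
Qed.

Lemma KfE e w b : 0 < e -> 0 < b -> Kf e w b = collapse ((e * b)^-1 *: w).
Proof.
move=> e0 b0; have eb : 0 < e * b by rewrite mulr_gt0.
rewrite /Kf subr_le0 ger0_norm ?(ltW b0) //; case: lerP => h //.
have ei : 0 <= (e * b)^-1 by rewrite invr_ge0 ltW.
by apply/esym/collapse_pt; rewrite (enormZ _ ei) ler_pdivlMl // mulr1 ltW.
Qed.

Lemma Kf_far e w b : 0 < e -> e * b <= enorm w -> w != 0 \/ b != 0 -> Kf e w b = point.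
Proof.
move=> e0 h wb; have [b0|b0] := ltrP 0 b; last exact: Kf_pt.
have eb : 0 < e * b by rewrite mulr_gt0.
have ei : 0 <= (e * b)^-1 by rewrite invr_ge0 ltW.
by rewrite KfE //; apply: collapse_pt; rewrite (enormZ _ ei) ler_pdivlMl // mulr1.
Qed.

Lemma KfZ e (c : R) w b : 0 < c -> Kf e (c *: w) (c * b) = Kf e w b.
Proof.
move=> c0; have cc : 0 <= c by exact: ltW.
rewrite /Kf enormZ // !subr_le0 mulrCA ler_pM2l // normrM (ger0_norm cc) mulrCA.
rewrite -maxr_pMr // scalerA invfM mulrAC mulVf ?gt_eqF // mul1r //.
Qed.

Definition tlv (v : 'rV[R]_k.+1) : 'rV[R]_k := \row_i v 0 (lift 0 i).

Lemma cts_tlv (X : topologicalType) (f : X -> 'rV[R]_k.+1) :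
  continuous f -> continuous (fun x => tlv (f x)).
Proof.
move=> cf; apply: cts_rowP => i.
by apply: (@cts_eq _ _ _ (fun x => f x 0 (lift 0 i))) => [x|]; [rewrite mxE|cts].
Qed.

Lemma tlvZ (c : R) v : tlv (c *: v) = c *: tlv v.
Proof. by apply/rowP => i; rewrite !mxE. Qed.

Lemma row_neq0 (v : 'rV[R]_k.+1) : v != 0 -> tlv v != 0 \/ v 0 0 != 0.
Proof.
move=> v0; have [h|] := eqVneq (v 0 0) 0; [left|by right].
apply: contraNneq v0 => tv; apply/eqP/rowP => i; rewrite mxE.
have [j ->|->] := unliftP 0 i; last by [].
by move/rowP: tv => /(_ j); rewrite !mxE.
Qed.

(* The antipode of the base point is sent to 0 when a = 0. *)
Definition Kv e (a : 'rV[R]_k) (v : 'rV[R]_k.+1) : sphere R k :=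
  Kf e (tlv v + v 0 0 *: a) (- v 0 0).

Lemma Kv_neq0 (a : 'rV[R]_k) (v : 'rV[R]_k.+1) : v != 0 ->
  tlv v + v 0 0 *: a != 0 \/ - v 0 0 != 0.
Proof.
move=> v0; have [h|h] := eqVneq (v 0 0) 0; last by right; rewrite oppr_eq0.
by left; rewrite h scale0r addr0; have [//|] := row_neq0 v0; rewrite h eqxx.
Qed.

Lemma cts_Kv (Z : topologicalType) e (a : Z -> 'rV[R]_k) (v : Z -> 'rV[R]_k.+1) :
  0 < e -> continuous a -> continuous v -> (forall z, v z != 0) ->
  continuous (fun z => Kv e (a z) (v z)).
Proof.
move=> e0 ca cv v0; apply: cts_Kf => //.
- by apply: cts_addv; [exact: cts_tlv|cts].
- by cts.
- by move=> z; exact: Kv_neq0.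
Qed.

Lemma KvZ e a (c : R) v : 0 < c -> Kv e a (c *: v) = Kv e a v.
Proof.
move=> c0; rewrite /Kv tlvZ mxE -scalerA -scalerDr -mulrN.
exact: KfZ.
Qed.

Lemma Kv_nsph e a v : v != 0 -> Kv e a (svec (nsph v)) = Kv e a v.
Proof.
move=> v0; rewrite svec_nsph // KvZ // invr_gt0 lt_neqAle enorm_ge0 andbT.
by rewrite eq_sym enorm_eq0.
Qed.

Lemma Kv_pt e a : 0 < e -> Kv e a (svec (point : sphere R k)) = point.
Proof.
move=> e0; have h : svec (point : sphere R k) 0 0 = 1 by rewrite svecpt mxE.
by apply: Kf_pt => //; rewrite h; [lra|right; rewrite oppr_eq0 oner_neq0].
Qed.

Lemma Kv_cts e a : 0 < e -> continuous (fun x : sphere R k => Kv e a (svec x)).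
Proof. by move=> e0; apply: (cts_Kv e0); [by cts|by cts|move=> x; exact: svec_neq0]. Qed.

Definition Kmap e a (e0 : 0 < e) : pointed_map (sphere R k) (sphere R k) :=
  PMap (@Kv_cts e a e0) (@Kv_pt e a e0).

Lemma Kv_not_antipodal e (x : sphere R k) : 0 < e -> svec (Kv e 0 (svec x)) + svec x != 0.
Proof.
move=> e0; apply/eqP => /headv_add_tail[].
rewrite /Kv scaler0 addr0 -[tlv _]/(tailv x) -[svec x 0 0]/(headv x).
have xn := row_neq0 (svec_neq0 x); rewrite -[tlv _]/(tailv x) -[svec x 0 0]/(headv x) in xn.
have [x0|x0] := ltrP (headv x) 0; last first.
  have hb : - headv x <= 0 by lra.
  have hn : tailv x != 0 \/ - headv x != 0 by case: xn => h; [left|right; rewrite oppr_eq0].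
  by rewrite (Kf_pt e0 hb hn) headv_pt => h1 _; lra.
rewrite KfE //; last lra.
set c := (e * _)^-1; have c0 : 0 < c by rewrite invr_gt0 mulr_gt0 //; lra.
rewrite headv_collapse tailv_collapse => h1 h2.
have [t0|t0] := eqVneq (tailv x) 0.
  move: h1; rewrite t0 scaler0; have -> : sqnorm (0 : 'rV[R]_k) = 0 by apply/eqP; rewrite sqnorm_eq0.
  by rewrite [Num.min _ _](min_idPr _) ?ler01 //; lra.
move: h2; set r := 2 * _; have r0 : 0 <= r by rewrite /r mulr_ge0 // sqrtr_ge0.
move=> /eqP; rewrite -addr_eq0 scalerA -{2}[tailv x]scale1r -scalerDl scaler_eq0 (negPf t0) orbF.
by rewrite gt_eqF // ltr_wpDl // mulr_ge0 // ltW.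
Qed.

(** Composition with [Kmap] keeps the homotopy class but trivializes a map away from the preimages
    of the direction (-1, a). After a has been moved to 0, the tail of the value is a nonnegative
    multiple of the tail of the argument, so the two are never antipodal. *)
Lemma Kmap_homot e a (e0 : 0 < e) : homotopic R (Kmap a e0) (pointed_id (sphere R k)).
Proof.
have h1 : homotopic R (Kmap 0 e0) (Kmap a e0).
  apply/homotopicP; exists (fun xt => Kv e (xt.2 *: a) (svec xt.1)); split.
  - by apply: (cts_Kv e0); [by cts|by cts|move=> x; exact: svec_neq0].
  - by move=> x; rewrite /= scale0r.
  - by move=> x; rewrite /= scale1r.
  - by move=> t; rewrite /= Kv_pt.
apply: homotopic_trans (homotopic_sym h1) _; apply/homotopicP.
exists (fun xt => shom xt.2 (Kv e 0 (svec xt.1)) xt.1); split.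
- apply: cts_shom; [by cts| |by cts|by move=> x; exact: Kv_not_antipodal].
  by apply: (cts_Kv e0); [by cts|by cts|move=> x; exact: svec_neq0].
- by move=> x; rewrite /= shom0.
- by move=> x; rewrite /= shom1.
- by move=> t; rewrite /= Kv_pt // shom_same.
Qed.

End SphereRetraction.

(** * The sphere as the boundary of a product of two balls *)

Section JoinCoordinates.
Context (R : realType) (m : nat).
Local Notation Q := 'rV[R]_m.+2.
Local Notation N := (m.+1 + m.+2)%N.

Definition hat k (x : 'rV[R]_k) : 'rV[R]_k := (Num.max 1 (enorm x))^-1 *: x.

Lemma hat_gt0 k (x : 'rV[R]_k) : 0 < Num.max 1 (enorm x).
Proof. by rewrite lt_max ltr01. Qed.

Lemma enorm_hat k (x : 'rV[R]_k) : enorm (hat x) = Num.min 1 (enorm x).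
Proof.
have h0 := hat_gt0 x; rewrite /hat enormZ ?invr_ge0 ?ltW //.
by case: lerP => h; [rewrite mulVf // gt_eqF // (lt_le_trans ltr01)|rewrite invr1 mul1r].
Qed.

Lemma hat_small k (x : 'rV[R]_k) : enorm x <= 1 -> hat x = x.
Proof. by move=> h; rewrite /hat (max_idPl h) invr1 scale1r. Qed.

Lemma collapse_hat k (x : 'rV[R]_k) : collapse (hat x) = collapse x.
Proof.
have [h|/ltW h] := lerP 1 (enorm x); last by rewrite hat_small.
by rewrite !collapse_pt // enorm_hat (min_idPl h).
Qed.

Lemma cts_hat (X : topologicalType) k (f : X -> 'rV[R]_k) :
  continuous f -> continuous (fun x => hat (f x)).
Proof.
move=> cf; apply: cts_scalev => //; apply: cts_inv; last by cts.
by move=> x; rewrite gt_eqF // hat_gt0.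
Qed.

Lemma coord_le_enorm k (x : 'rV[R]_k) i : `|x 0 i| <= enorm x.
Proof. exact: le_trans (le_normv _ _) (le_normv_enorm _). Qed.

Lemma crdZ k (a : R) (x : 'rV[R]_k) i : crd (a *: x) i = a * crd x i.
Proof. by rewrite /crd; case: insubP => [j _ _|_]; rewrite ?mxE ?mulr0. Qed.

(** The inverse of the linear isomorphism z |-> (wleft z, wright z). *)
Definition unw_crd (u v : Q) (i : nat) : R :=
  if i == 0%N then (crd u 0 + crd v 0) / 2
  else if (i < m.+2)%N then crd u i
  else if i == m.+2 then (crd v 0 - crd u 0) / 2 else crd v (i - m.+2).

Definition unw (u v : Q) : 'rV[R]_N.+1 := \row_(i < N.+1) unw_crd u v i.

Lemma crd_unw u v i : (i < N.+1)%N -> crd (unw u v) i = unw_crd u v i.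
Proof. exact: crd_row. Qed.

Lemma cts_unw (X : topologicalType) (f g : X -> Q) :
  continuous f -> continuous g -> continuous (fun x => unw (f x) (g x)).
Proof.
move=> cf cg; apply: (@cts_row _ _ _ (fun x i => unw_crd (f x) (g x) i)) => i.
rewrite /unw_crd; case: (_ == _); first by cts.
by case: (_ < _)%N; [cts|case: (_ == _); cts].
Qed.

Lemma wleft_scale (x : sphere R (m.+2 + m.+2).-1) (c : R) u v :
  svec x = c *: unw u v -> wleft x = c *: u.
Proof.
move=> xE; apply/rowP => i; rewrite !mxE /wleft_crd xE !crdZ.
have iN : (i < N.+1)%N by have := ltn_ord i; lia.
rewrite !crd_unw //; last by lia.
rewrite /unw_crd /= ltnn eqxx; case: (boolP (nat_of_ord i == 0%N)) => [/eqP i0|i0].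
  by rewrite -mulrBr -[i in RHS]/(i) -crdE i0; congr (_ * _); field.
by rewrite ltn_ord crdE.
Qed.

Lemma wright_scale (x : sphere R (m.+2 + m.+2).-1) (c : R) u v :
  svec x = c *: unw u v -> wright x = c *: v.
Proof.
move=> xE; apply/rowP => i; rewrite !mxE /wright_crd xE !crdZ.
have iN : (m.+2 + i < N.+1)%N by have := ltn_ord i; lia.
rewrite !crd_unw //; last by lia.
rewrite /unw_crd /= ltnn eqxx; case: (boolP (nat_of_ord i == 0%N)) => [/eqP i0|i0].
  by rewrite -mulrDr -crdE i0; congr (_ * _); field.
rewrite ifF; last by apply/negbTE; rewrite -leqNgt leq_addr.
rewrite ifF; last by apply/negbTE; move: i0; lia.
by rewrite addKn crdE.
Qed.

Lemma unw_neq0 u v : u != 0 \/ v != 0 -> unw u v != 0.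
Proof.
move=> uv; apply/eqP => h.
have z i : (i < N.+1)%N -> unw_crd u v i = 0.
  by move=> iN; rewrite -crd_unw // h /crd; case: insubP => // j _ _; rewrite mxE.
have z0 := z 0%N isT; have zm : unw_crd u v m.+2 = 0 by apply: z; lia.
rewrite /unw_crd /= in z0; rewrite /unw_crd /= ltnn eqxx in zm.
have u0 : u = 0.
  apply/rowP => i; rewrite mxE -crdE; case: (posnP i) => [->|i0]; first by lra.
  have iN : (i < N.+1)%N by have := ltn_ord i; lia.
  by have := z i iN; rewrite /unw_crd gtn_eqF // ltn_ord.
have v0 : v = 0.
  apply/rowP => i; rewrite mxE -crdE; case: (posnP i) => [->|i0]; first by lra.
  have iN : (m.+2 + i < N.+1)%N by have := ltn_ord i; lia.
  have := z _ iN; rewrite /unw_crd /= ifF; last by apply/negbTE; rewrite -leqNgt leq_addr.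
  by rewrite ifF ?addKn //; apply/negbTE; move: i0; lia.
by case: uv; rewrite ?u0 ?v0 eqxx.
Qed.

(** On the boundary of D^n x D^n the factor 1 / [wmax] undoes the normalization by [nsph], and the
    Whitehead product takes its usual form. *)
Lemma whitehead_unw (Y : ptopologicalType) (f g : pointed_map (sphere R m.+2) Y) u v :
  Num.max (enorm u) (enorm v) = 1 ->
  whitehead_fun f g (nsph (unw u v)) =
  if enorm u <= enorm v then f (collapse u) else g (collapse v).
Proof.
move=> uv1; have uv0 : unw u v != 0.
  apply: unw_neq0; have [u0|] := eqVneq u 0; last by left.
  right; apply: contra_eq_neq uv1 => v0; rewrite u0 v0 maxxx.
  have -> : enorm (0 : Q) = 0 by apply/eqP; rewrite enorm_eq0.
  by rewrite eq_sym oner_neq0.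
set c := (enorm (unw u v))^-1.
have c0 : 0 < c by rewrite invr_gt0 lt_neqAle enorm_ge0 andbT eq_sym enorm_eq0.
have e : svec (nsph (unw u v)) = c *: unw u v by rewrite svec_nsph.
have wl := wleft_scale e; have wr := wright_scale e.
have cc : 0 <= c := ltW c0.
have wm : wmax (nsph (unw u v) : sphere R (m.+2 + m.+2).-1) = c.
  by rewrite /wmax wl wr !enormZ // -maxr_pMr // uv1 mulr1.
rewrite /whitehead_fun /wside /wleft_sphere /wright_sphere wm wl wr !scalerA.
by rewrite mulVf ?gt_eqF // !scale1r !enormZ // -mulrBr pmulr_rge0 // subr_ge0.
Qed.

Lemma unw0 u v : unw u v 0 0 = (u 0 0 + v 0 0) / 2.
Proof. by rewrite mxE /unw_crd /= -!crdE. Qed.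

(** The shear by [row_mx 0 ax] undoes the mixing of u_0 and v_0: all coordinates of u and v except
    u_0 are left. This is the parameter a with which [Kv] will be applied to [link]. *)
Lemma tlv_unw u v :
  tlv (unw u v) + unw u v 0 0 *: row_mx (0 : 'rV_m.+1) (ax R m) = row_mx (tlv u) v.
Proof.
rewrite unw0; apply/rowP => i.
have e1 : unw u v 0 (lift 0 i) = unw_crd u v i.+1 by rewrite mxE lift0.
rewrite mxE [X in X + _]mxE e1 [X in _ + X]mxE.
case: (split_ordP i) => j ->; rewrite ?row_mxEl ?row_mxEr /unw_crd /=.
  by rewrite mxE mulr0 addr0 ltnS ltn_ord mxE -crdE lift0.
rewrite -addSn ltnNge leq_addr /=; case: (posnP j) => [j0|j0].
  have -> : j = 0 by apply/val_inj.
  by rewrite addn0 eqxx /= ax0 -!crdE /=; field.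
rewrite ifF; last by apply/negbTE; move: j0; lia.
rewrite addKn mxE /=.
have -> : (j == 0) = false by apply/negbTE; rewrite -val_eqE /= -lt0n.
by rewrite mulr0 addr0 crdE.
Qed.

End JoinCoordinates.

Section Linking.
Context (R : realType) (m : nat).
Local Notation S := 'rV[R]_m.+1.
Local Notation T := 'rV[R]_m.+2.
Local Notation N := (m.+1 + m.+2)%N.
Local Notation ax := (ax R m).
Implicit Types x : S * T.

Definition cut (r : R) k (v : 'rV[R]_k) : R := 1 - clamp (`|v| - r).

Lemma cut_itv r k (x : 'rV[R]_k) : 0 <= cut r x <= 1.
Proof. by have /andP[c0 c1] := clamp_itv (`|x| - r); rewrite /cut; apply/andP; split; lra. Qed.

Lemma cut_near r k (x : 'rV[R]_k) : `|x| <= r -> cut r x = 1.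
Proof.
move=> h; rewrite /cut /clamp [Num.max _ _](max_idPl _) ?subr0 //.
by rewrite ge_min; apply/orP; right; lra.
Qed.

Lemma cut_far r k (x : 'rV[R]_k) : r + 1 <= `|x| -> cut r x = 0.
Proof.
move=> h; rewrite /cut /clamp [Num.min _ _](min_idPl _); last lra.
by rewrite [Num.max _ _](max_idPr _) ?subrr ?ler01.
Qed.

Lemma cts_cut (X : topologicalType) r k (f : X -> 'rV[R]_k) :
  continuous f -> continuous (fun z => cut r (f z)).
Proof. by move=> cf; rewrite /cut; cts. Qed.

(* The level of t around the point 4 ax, increased for s at infinity. *)
Definition lk0 (x : S * T) : R := `|x.2 - 4 *: ax| - 2 + Num.max 0 (`|x.1| - 1).
Definition lkp (x : S * T) : T := consv (lk0 x) ((cut 4 x.1 * cut 8 x.2) *: x.1).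

(* The folding of R^n along t_0 = 0, shifted to vanish at t = 4 ax and t = - 4 ax,
   and made constant at infinity. *)
Definition lkq0 (x : S * T) : R := `|x.2 0 0| - 4 + 10 * Num.max 0 (`|x.2| - 8).
Definition lkq (x : S * T) : T := consv (lkq0 x) (cut 8 x.2 *: tlv x.2).

(** By [link_ge1] one of the two vectors lies outside of the open unit ball, so the retracted pair
    is on the boundary of D^n x D^n, a sphere of dimension 2n - 1. The constants leave room for
    balls of radius 1 around 4 ax and -4 ax and for the collar 1 <= |t - 4 ax| <= 3 of the first
    one, all within |t| < 8. *)
Definition link (x : S * T) : sphere R N := nsph (unw (hat (lkp x)) (hat (lkq x))).

Lemma enorm_consvl k (a : R) (v : 'rV[R]_k) : `|a| <= enorm (consv a v).
Proof. exact: le_trans (norm_consvl _ _) (le_normv_enorm _). Qed.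

Lemma enorm_consvr k (a : R) (v : 'rV[R]_k) : `|v| <= enorm (consv a v).
Proof. exact: le_trans (norm_consvr _ _) (le_normv_enorm _). Qed.

Lemma le_max0 (a : R) : a <= Num.max 0 a /\ 0 <= Num.max 0 a.
Proof. by rewrite !le_max !lexx orbT. Qed.

Lemma consv_tlv (t : T) : consv (t 0 0) (tlv t) = t.
Proof.
apply/rowP => i; have [j ->|->] := unliftP 0 i; last by rewrite consv0.
by rewrite consvS mxE.
Qed.

Lemma fold_consv (t : T) (a : R) : fold t - a *: ax = consv (`|t 0 0| - a) (tlv t).
Proof.
apply/rowP => i; have [j ->|->] := unliftP 0 i; last by rewrite consv0 !mxE !eqxx mulr1.
by rewrite consvS !mxE /= mulr0 subr0.
Qed.

Lemma lk0_ge x : 1 <= `|x.1| -> `|x.1| - 3 <= lk0 x.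
Proof.
move=> h; rewrite /lk0; have [h1 h2] := le_max0 (`|x.1| - 1).
by have := normr_ge0 (x.2 - 4 *: ax); lra.
Qed.

Lemma shift4_far (t : T) : 8 <= `|t| -> `|t| - 4 <= `|t - 4 *: ax|.
Proof. by move=> h; apply: shift_far; rewrite ger0_norm; lra. Qed.

Lemma lk0_far x : 8 <= `|x.2| -> 2 <= lk0 x.
Proof.
move=> h; rewrite /lk0; have [h1 h2] := le_max0 (`|x.1| - 1).
by have := shift4_far h; lra.
Qed.

Lemma lkp_s x : 1 <= `|x.1| -> 1 <= enorm (lkp x).
Proof.
move=> h; have h3 := lk0_ge h.
have [t8|t8] := lerP 8 `|x.2|.
  apply: le_trans (enorm_consvl _ _); rewrite ger0_norm; have := lk0_far t8; lra.
have [s4|s4] := lerP `|x.1| 4.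
  by apply: le_trans (enorm_consvr _ _); rewrite (cut_near s4) (cut_near (ltW t8)) mulr1 scale1r.
apply: le_trans (enorm_consvl _ _); rewrite ger0_norm; lra.
Qed.

Lemma lkp_near x : `|x.2 - 4 *: ax| <= 1 -> 1 <= enorm (lkp x).
Proof.
move=> h; have [s1|s1] := lerP 1 `|x.1|; first exact: lkp_s.
apply: le_trans (enorm_consvl _ _); rewrite /lk0 [Num.max _ _](max_idPl _); last lra.
by rewrite ler0_norm; lra.
Qed.

Lemma lkp_neg x : x.2 0 0 <= 0 -> 2 <= lk0 x.
Proof.
move=> h; rewrite /lk0; have [h1 h2] := le_max0 (`|x.1| - 1).
have := shift_ge x.2 4; rewrite ler0_norm; lra.
Qed.

Lemma lkq_far x : 8 <= `|x.2| -> 1 <= enorm (lkq x).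
Proof.
move=> h; have [h1 h2] := le_max0 (`|x.2| - 8).
have [h3|h3] := lerP (1 / 2) (`|x.2| - 8).
  apply: le_trans (enorm_consvl _ _); rewrite /lkq0; have := normr_ge0 (x.2 0 0) => n0.
  by rewrite ger0_norm; lra.
have c1 : 1 / 2 <= cut 8 x.2.
  by rewrite /cut clamp_id; [|apply/andP; split]; lra.
have : `|x.2| <= Num.max `|x.2 0 0| `|tlv x.2|.
  apply: normv_le => [|i]; first by rewrite le_max normr_ge0.
  have [j ->|->] := unliftP 0 i; rewrite le_max; last by rewrite lexx.
  by apply/orP; right; have := le_normv (tlv x.2) j; rewrite mxE.
rewrite le_max => /orP[h4|h4].
  by apply: le_trans (enorm_consvl _ _); rewrite /lkq0 ger0_norm; lra.
apply: le_trans (enorm_consvr _ _); rewrite normrZ ger0_norm; last lra.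
by have := normr_ge0 (tlv x.2); nra.
Qed.

Lemma lkq_near x : `|x.2| <= 8 -> lkq x = fold x.2 - 4 *: ax.
Proof.
move=> h; rewrite /lkq /lkq0 cut_near // scale1r fold_consv.
by rewrite [Num.max _ _](max_idPl _) ?mulr0 ?addr0 //; lra.
Qed.

Lemma link_ge1 x : 1 <= enorm (lkp x) \/ 1 <= enorm (lkq x).
Proof.
have [t8|t8] := lerP 8 `|x.2|; first by right; exact: lkq_far.
have [t0|t0] := lerP (x.2 0 0) 0.
  left; apply: le_trans (enorm_consvl _ _); rewrite ger0_norm; have := lkp_neg t0; lra.
have [h|/ltW h] := lerP `|x.2 - 4 *: ax| 1; first by left; exact: lkp_near.
right; rewrite (lkq_near (ltW t8)) (fold_pos (ltW t0)). by apply: (le_trans h); exact: le_normv_enorm.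
Qed.

Lemma link_max x : Num.max (enorm (hat (lkp x))) (enorm (hat (lkq x))) = 1.
Proof.
rewrite !enorm_hat; case: (link_ge1 x) => h; rewrite (min_idPl h).
  by apply/max_idPl; rewrite ge_min lexx.
by apply/max_idPr; rewrite ge_min lexx.
Qed.

Lemma link_unw_neq0 x : unw (hat (lkp x)) (hat (lkq x)) != 0.
Proof.
apply: unw_neq0; rewrite -!enorm_eq0 !enorm_hat.
by case: (link_ge1 x) => h; [left|right]; rewrite (min_idPl h) oner_neq0.
Qed.

Lemma link_whitehead (Y : ptopologicalType) (f g : pointed_map (sphere R m.+2) Y) x :
  whitehead_fun f g (link x) =
  if 1 <= enorm (lkq x) then f (collapse (lkp x)) else g (collapse (lkq x)).
Proof.
rewrite /link whitehead_unw ?link_max // !collapse_hat !enorm_hat.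
have [h|h] := lerP 1 (enorm (lkq x)).
  by rewrite ge_min lexx.
have [h1|h1] := link_ge1 x; last by have := lt_le_trans h h1; rewrite ltxx.
by rewrite (min_idPl h1) leNgt h.
Qed.

Lemma cts_link : continuous link.
Proof.
apply: cts_nsph; first exact: link_unw_neq0.
have cc4 : continuous (fun x : S * T => cut 4 x.1) by apply: cts_cut; cts.
have cc8 : continuous (fun x : S * T => cut 8 x.2) by apply: cts_cut; cts.
have ctl : continuous (fun x : S * T => tlv x.2) by apply: cts_tlv; cts.
apply: cts_unw; apply: cts_hat; apply: cts_consv.
- by rewrite /lk0; cts.
- by cts.
- by rewrite /lkq0; cts.
- by cts.
Qed.

Lemma hat_consv (a : R) : 1 <= a -> hat (consv a (0 : S)) = consv 1 0 :> T.
Proof.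
move=> a1; have e : enorm (consv a (0 : S)) = a.
  rewrite /enorm sqnorm_consv; have -> : sqnorm (0 : S) = 0 by apply/eqP; rewrite sqnorm_eq0.
  by rewrite addr0 sqrtr_sqr ger0_norm; lra.
rewrite /hat e (max_idPr a1); apply/rowP => i; rewrite mxE.
have [j ->|->] := unliftP 0 i; last by rewrite !consv0 mulVf // gt_eqF //; lra.
by rewrite !consvS !mxE mulr0.
Qed.

Lemma hat_lkp_t x : 9 <= `|x.2| -> hat (lkp x) = consv 1 0.
Proof.
move=> h; rewrite /lkp (@cut_far 8) ?mulr0 ?scale0r; last lra.
by apply: hat_consv; have := @lk0_far x; lra.
Qed.

Lemma hat_lkp_s x : 5 <= `|x.1| -> hat (lkp x) = consv 1 0.
Proof.
move=> h; rewrite /lkp (@cut_far 4) ?mul0r ?scale0r; last lra.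
by apply: hat_consv; have := @lk0_ge x; lra.
Qed.

Lemma hat_lkq_t x : 9 <= `|x.2| -> hat (lkq x) = consv 1 0.
Proof.
move=> h; rewrite /lkq (@cut_far 8) ?scale0r; last lra.
apply: hat_consv; rewrite /lkq0; have [h1 h2] := le_max0 (`|x.2| - 8).
by have := normr_ge0 (x.2 0 0); lra.
Qed.

(** [lkw] and [lkb] are the arguments that [Kv] passes to [Kf] at [link x]. The point (0, 4 ax) is
    sent to the centre of that projection, and [lkz] is the affine model of [lkw] there. *)
Definition lkb (x : S * T) : R := - ((hat (lkp x) 0 0 + hat (lkq x) 0 0) / 2).
Definition lkw (x : S * T) : 'rV[R]_N := row_mx (tlv (hat (lkp x))) (hat (lkq x)).
Definition lkz (x : S * T) : 'rV[R]_N := row_mx x.1 (x.2 - 4 *: ax).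

Lemma Kv_link (x : S * T) : Kv 1 (row_mx 0 ax) (svec (link x)) = Kf 1 (lkw x) (lkb x).
Proof. by rewrite Kv_nsph ?link_unw_neq0 // /Kv tlv_unw unw0. Qed.

Lemma hat_coord_le (x : T) : `|hat x 0 0| <= 1.
Proof.
by apply: le_trans (coord_le_enorm _ _) _; rewrite enorm_hat ge_min lexx.
Qed.

Lemma lkb_itv x : -1 <= lkb x <= 1.
Proof.
have := hat_coord_le (lkp x); have := hat_coord_le (lkq x).
by rewrite !ler_norml /lkb => /andP[h1 h2] /andP[h3 h4]; apply/andP; split; lra.
Qed.

Lemma enorm_consv0 (v : T) : tlv v = 0 -> enorm v = `|v 0 0|.
Proof.
move=> h; rewrite -{1}(consv_tlv v) h /enorm sqnorm_consv.
have -> : sqnorm (0 : S) = 0 by apply/eqP; rewrite sqnorm_eq0.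
by rewrite addr0 sqrtr_sqr.
Qed.

Lemma row_mx_neq0 (a : S) (b : T) : row_mx a b = 0 -> a = 0 /\ b = 0.
Proof. by rewrite -[0]row_mx0 => /eq_row_mx. Qed.

(** For c = 0, a zero has [lkq] = 0, so [hat (lkp x)] is a unit vector on the first axis and [lkb]
    is 1/2 or -1/2. For c > 0, the coordinates of s and of [tlv t] in [lkw] are nonnegative
    multiples of those in [lkz], so a zero lies on the axis s = 0, [tlv t] = 0. If t_0 < 0, then
    [lkb] is negative; otherwise the signs of the two terms leave t_0 = 4 only, where [lkb] is
    1/2. *)
Lemma link_stage x (c : R) : 0 <= c <= 1 ->
  (1 - c) *: lkw x + c *: lkz x != 0 \/ lkb x != 0.
Proof.
move=> /andP[c0 c1]; have [w0|] := eqVneq ((1 - c) *: lkw x + c *: lkz x) 0; last by left.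
right; move: w0; rewrite /lkw /lkz !scale_row_mx add_row_mx => /row_mx_neq0[ws wt].
have [cz|cn] := eqVneq c 0.
  move: ws wt; rewrite cz subr0 !scale1r !scale0r !addr0 => ws wt.
  have hp : enorm (hat (lkp x)) = 1.
    have := link_max x; rewrite wt; have -> : enorm (0 : T) = 0 by apply/eqP; rewrite enorm_eq0.
    by rewrite (max_idPl (enorm_ge0 _)).
  have z0 : (0 : T) 0 0 = 0 by rewrite mxE.
  rewrite /lkb wt oppr_eq0 z0 addr0 mulf_neq0 ?invr_eq0 ?pnatr_eq0 //.
  by rewrite -normr_eq0 -enorm_consv0 // hp oner_neq0.
have {}c0 : 0 < c by rewrite lt_neqAle eq_sym cn.
have c1' : 0 <= 1 - c by lra.
have pos k (y : 'rV[R]_k) (a : R) : 0 <= a -> (1 - c) *: (a *: y) + c *: y = 0 -> y = 0.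
  move=> a0; rewrite scalerA -scalerDl => /eqP; rewrite scaler_eq0 gt_eqF ?orFb; first by move/eqP.
  by rewrite ltr_wpDl // mulr_ge0.
have gp := hat_gt0 (lkp x); have gq := hat_gt0 (lkq x).
have tconsv (a : R) (v : S) : tlv (consv a v) = v.
  by apply/rowP => i; rewrite mxE consvS.
have s0 : x.1 = 0.
  move: ws; rewrite /hat tlvZ /lkp tconsv scalerA; apply: pos.
  have /andP[h1 _] := cut_itv 4 x.1; have /andP[h2 _] := cut_itv 8 x.2.
  by rewrite mulr_ge0 ?mulr_ge0 // invr_ge0 ltW.
have t'0 : tlv x.2 = 0.
  have := congr1 (@tlv R _) wt; rewrite {1}/hat.
  have -> : tlv ((1 - c) *: ((Num.max 1 (enorm (lkq x)))^-1 *: lkq x) + c *: (x.2 - 4 *: ax)) =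
     (1 - c) *: (((Num.max 1 (enorm (lkq x)))^-1 * cut 8 x.2) *: tlv x.2) + c *: tlv x.2.
    by apply/rowP => i; rewrite !mxE /= !liftK !mxE; ring.
  have -> : tlv (0 : T) = 0 by apply/rowP => i; rewrite !mxE.
  apply: pos; have /andP[h2 _] := cut_itv 8 x.2.
  by rewrite mulr_ge0 // invr_ge0 ltW.
have p0 : lkp x = consv (lk0 x) 0 by rewrite /lkp s0 scaler0.
have k0 : lk0 x = `|x.2 - 4 *: ax| - 2.
  by rewrite /lk0 s0 normr0 [Num.max _ _](max_idPl _) ?addr0 //; lra.
have w00 : (1 - c) * (hat (lkq x) 0 0) + c * (x.2 0 0 - 4) = 0.
  have := congr1 (fun v : T => v 0 0) wt.
  by rewrite !mxE eqxx /= mulr1 => <-.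
have hq0 : hat (lkq x) 0 0 = (Num.max 1 (enorm (lkq x)))^-1 * lkq0 x.
  by rewrite mxE consv0.
have gi : 0 < (Num.max 1 (enorm (lkq x)))^-1 by rewrite invr_gt0.
have [h1 h2] := le_max0 (`|x.2| - 8).
have [tneg|tpos] := ltrP (x.2 0 0) 0.
  have hq : 0 < hat (lkq x) 0 0.
    rewrite ltNge; apply/negP => h.
    have : (1 - c) * (hat (lkq x) 0 0) <= 0 by rewrite mulr_ge0_le0.
    have : c * (x.2 0 0 - 4) < 0 by rewrite pmulr_rlt0 //; lra.
    lra.
  have -> : lkb x = - ((1 + hat (lkq x) 0 0) / 2).
    by rewrite /lkb p0 hat_consv ?consv0 //; have l2 := lkp_neg (ltW tneg); lra.
  by rewrite oppr_eq0 gt_eqF //; lra.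
have q0 : lkq0 x = x.2 0 0 - 4 + 10 * Num.max 0 (`|x.2| - 8) by rewrite /lkq0 ger0_norm.
have te : x.2 0 0 = 4.
  have [h|h|//] := ltrgtP (x.2 0 0) 4.
    have n8 : `|x.2| <= 4.
      apply: normv_le => // i; have [j ->|->] := unliftP 0 i; last by rewrite ger0_norm // ltW.
      by have := congr1 (fun v : S => v 0 j) t'0; rewrite !mxE => ->; rewrite normr0.
    have q0' : lkq0 x = x.2 0 0 - 4.
      by rewrite q0 [Num.max _ _](max_idPl _) ?mulr0 ?addr0 //; lra.
    have : (1 - c) * (hat (lkq x) 0 0) <= 0.
      by rewrite mulr_ge0_le0 // hq0 pmulr_rle0 // q0'; lra.
    have : c * (x.2 0 0 - 4) < 0 by rewrite pmulr_rlt0 //; lra.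
    lra.
  have : 0 <= (1 - c) * (hat (lkq x) 0 0).
    by rewrite mulr_ge0 // hq0 pmulr_rge0 // q0; lra.
  have : 0 < c * (x.2 0 0 - 4) by rewrite mulr_gt0 //; lra.
  lra.
have x2 : x.2 = 4 *: ax.
  apply/rowP => i; rewrite mxE; have [j ->|->] := unliftP 0 i; last by rewrite ax0 mulr1.
  have := congr1 (fun v : S => v 0 j) t'0; rewrite !mxE => ->.
  by rewrite /= mulr0.
have q00 : hat (lkq x) 0 0 = 0.
  have n4 : `|x.2| = 4 by rewrite x2 norm_ax.
  rewrite hq0 q0 te n4 [Num.max 0 _](max_idPl _); last lra.
  by rewrite subrr mulr0 addr0 mulr0.
have pe : enorm (lkp x) = 2.
  rewrite p0 /enorm sqnorm_consv; have -> : sqnorm (0 : S) = 0 by apply/eqP; rewrite sqnorm_eq0.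
  by rewrite addr0 sqrtr_sqr k0 x2 subrr normr0 sub0r normrN ger0_norm.
rewrite /lkb q00 addr0 mxE pe p0 consv0 k0 x2 subrr normr0 sub0r.
by rewrite (max_idPr _) ?oppr_eq0 ?mulf_neq0 ?invr_eq0 ?oppr_eq0 ?pnatr_eq0 //; lra.
Qed.

End Linking.

Section LinkingClass.
Context (R : realType) (m : nat).
Local Notation S := 'rV[R]_m.+1.
Local Notation T := 'rV[R]_m.+2.
Local Notation N := (m.+1 + m.+2)%N.
Local Notation ax := (ax R m).
Implicit Types x : S * T.

Lemma link_far x : 9 <= `|x.2| -> link x = point.
Proof.
move=> h; rewrite /link hat_lkp_t // hat_lkq_t //.
have e : unw (consv 1 (0 : S)) (consv 1 0) = svec (point : sphere R N).
  apply/rowP => i; rewrite svecpt mxE mxE /unw_crd.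
  have c0 : crd (consv 1 (0 : S)) 0 = 1 by rewrite -[0%N]/(val (0 : 'I_m.+2)) crdE consv0.
  have cS j : (0 < j)%N -> crd (consv 1 (0 : S)) j = 0.
    move=> j0; rewrite /crd; case: insubP => // k _ kj.
    have [k' ->|k0] := unliftP 0 k; first by rewrite consvS mxE.
    by move: j0; rewrite -kj k0.
  rewrite c0; case: (posnP i) => [/= i0|/= i0]; first by rewrite mulr1n; lra.
  rewrite mulr0n; case: ifP => [_|h1]; first by rewrite cS.
  case: ifP => [_|h2]; first by rewrite subrr mul0r.
  by rewrite cS // subn_gt0; move: h1 h2; lia.
by rewrite e nsph_svec.
Qed.

Lemma bounded_link : bounded_by 9 (@link R m).
Proof.
split=> [s t h|s s' t h h']; first exact: link_far.
by rewrite /link !hat_lkp_s //=; lra.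
Qed.

Lemma is_amap_link : is_amap (@link R m).
Proof. by split; [exact: cts_link|exists 9; exact: bounded_link]. Qed.

Definition ball1 (x : S * T) : sphere R N := collapse (row_mx x.1 x.2).

Lemma norm_row_mxl (s : S) (t : T) : `|s| <= `|row_mx s t|.
Proof. by apply: normv_le => // i; rewrite -(row_mxEl s t) le_normv. Qed.

Lemma norm_row_mxr (s : S) (t : T) : `|t| <= `|row_mx s t|.
Proof. by apply: normv_le => // i; rewrite -(row_mxEr s t) le_normv. Qed.

Lemma cts_lk : continuous (@lkw R m) /\ continuous (@lkb R m).
Proof.
have cc4 : continuous (fun x : S * T => cut 4 x.1) by apply: cts_cut; cts.
have cc8 : continuous (fun x : S * T => cut 8 x.2) by apply: cts_cut; cts.
have ctl : continuous (fun x : S * T => tlv x.2) by apply: cts_tlv; cts.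
have cp : continuous (fun x : S * T => hat (lkp x)).
  by apply: cts_hat; apply: cts_consv; [rewrite /lk0; cts|cts].
have cq : continuous (fun x : S * T => hat (lkq x)).
  by apply: cts_hat; apply: cts_consv; [rewrite /lkq0; cts|cts].
split; first exact: cts_row_mx (cts_tlv cp) cq.
apply: cts_opp; apply: cts_mul; last exact: cts_cst.
exact: cts_add (cts_coord cp) (cts_coord cq).
Qed.

(** After composition with [Kmap], only the zero of [lkz] matters: [lkw] is deformed to [lkz] along
    a segment, then [lkb] to 1, which is possible since it is positive at that zero, and the centre
    4 ax is moved to 0. The linear part of [lkz] is the identity, so the top cell appears with
    multiplicity exactly 1. *)
Lemma acls_link : acls (@link R m) = acls ball1.
Proof.
have [cw cb] := cts_lk; have al := is_amap_link.
have l01 : (0 : R) < 1 := ltr01.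
have e1 : acls (@link R m) = acls (fun x => Kf 1 (lkw x) (lkb x)).
  have := push_homot (acls (@link R m)) (Kmap_homot (row_mx (0 : S) ax) l01).
  rewrite !pushE //= => <-; apply: acls_eq => x; exact: Kv_link.
have cz : continuous (@lkz R m) by rewrite /lkz; cts.
have b1 x : lkb x <= 1 by have /andP[] := lkb_itv x.
have e2 : acls (fun x => Kf 1 (lkw x) (lkb x)) = acls (fun x => Kf 1 (lkz x) (lkb x)).
  apply: acls_homot; apply: (@ahomot_itv _ _ _ _ _ (fun z : R * (S * T) =>
    Kf 1 ((1 - clamp z.1) *: lkw z.2 + clamp z.1 *: lkz z.2) (lkb z.2)) 9).
  - apply: cts_Kf => //; [by cts|by cts|].
    by move=> [a x]; apply: link_stage; exact: clamp_itv.
  - move=> a _; have st := link_stage _ (clamp_itv a).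
    have pt x : lkb x <= 0 -> Kf 1 ((1 - clamp a) *: lkw x + clamp a *: lkz x) (lkb x) = point.
      by move=> h; apply: Kf_pt => //; exact: st.
    split=> [s t h|s s' t h h'] /=.
      by apply: pt; rewrite /lkb hat_lkp_t // hat_lkq_t // consv0; lra.
    have neg u : 9 <= `|u| -> lkb (u, t) <= 0.
      move=> hu; rewrite /lkb hat_lkp_s /=; last lra.
      rewrite consv0; have := hat_coord_le (lkq (u, t)); rewrite ler_norml => /andP[h1 _].
      by lra.
    by rewrite !pt //; apply: neg.
  - by move=> x /=; rewrite clamp_id ?lexx ?ler01 // subr0 scale1r scale0r addr0.
  - by move=> x /=; rewrite clamp_id ?lexx ?ler01 // subrr scale0r scale1r add0r.
have nz x : lkz x != 0 \/ lkb x != 0.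
  have := @link_stage _ _ x 1; rewrite subrr scale0r scale1r add0r; apply.
  by rewrite lexx ler01.
have posb x : lkz x = 0 -> 0 < lkb x.
  move=> /row_mx_neq0[s0 /eqP]; rewrite subr_eq0 => /eqP t0.
  have [|q1] := eqVneq (lkb x) 0; first by have [/eqP|/eqP] := nz x; rewrite /lkz ?s0 ?t0 ?subrr ?row_mx0.
  have tp : 0 <= x.2 0 0 by rewrite t0 mxE ax0 mulr1.
  have n4 : `|x.2| = 4 by rewrite t0 norm_ax.
  have qz : lkq x = 0 by rewrite lkq_near ?fold_pos ?n4 -?t0 ?subrr //; lra.
  have k0 : lk0 x = -2.
    by rewrite /lk0 s0 t0 subrr !normr0 [Num.max _ _](max_idPl _); lra.
  have pz : lkp x 0 0 = -2 by rewrite consv0.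
  have hq : hat (lkq x) 0 0 = 0 by rewrite qz /hat scaler0 mxE.
  have hp : hat (lkp x) 0 0 <= 0.
    by rewrite mxE pz mulr_ge0_le0 ?invr_ge0 ?ltW ?hat_gt0 //; lra.
  rewrite lt_neqAle eq_sym q1 /lkb hq addr0; lra.
have far x : 1 <= `|lkz x| -> forall a, 0 <= a <= 1 ->
    Kf 1 (lkz x) ((1 - a) * lkb x + a) = point.
  move=> h a /andP[a0 a1]; have hz := le_trans h (le_normv_enorm _).
  apply: Kf_far => //; last first.
    by left; rewrite -enorm_eq0 gt_eqF // (lt_le_trans ltr01).
  by apply: le_trans hz; have := b1 x; nra.
have zb a : 0 <= a <= 1 -> bounded_by 5 (fun x => Kf 1 (lkz x) ((1 - a) * lkb x + a)).
  move=> a01; split=> [s t h|s s' t h h'].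
    apply: far => //; apply: le_trans (norm_row_mxr _ _).
    by apply: shift_far; rewrite ger0_norm; lra.
  by rewrite !far //; apply: le_trans (norm_row_mxl _ _); lra.
have e3 : acls (fun x => Kf 1 (lkz x) (lkb x)) = acls (fun x => Kf 1 (lkz x) 1).
  apply: acls_homot; apply: (@ahomot_itv _ _ _ _ _ (fun z : R * (S * T) =>
    Kf 1 (lkz z.2) ((1 - clamp z.1) * lkb z.2 + clamp z.1)) 5).
  - apply: cts_Kf => //; [by cts|by cts|].
    move=> [a x] /=; have [z0|] := eqVneq (lkz x) 0; [right|by left].
    have := posb x z0; have /andP[a0 a1] := clamp_itv a => h.
    by rewrite gt_eqF //; have := b1 x; nra.
  - by move=> a _; exact: (zb _ (clamp_itv a)).
  - by move=> x /=; rewrite clamp_id ?lexx ?ler01 // subr0 mul1r addr0.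
  - by move=> x /=; rewrite clamp_id ?lexx ?ler01 // subrr mul0r add0r.
rewrite e1 e2 e3; apply: acls_homot.
apply: (@ahomot_itv _ _ _ _ _ (fun z : R * (S * T) =>
    collapse (row_mx z.2.1 (z.2.2 - (4 * (1 - z.1)) *: ax))) 5).
- by cts.
- move=> a /andP[a0 a1]; split=> [s t h|s s' t h h'] /=.
    apply: collapse_far; apply: le_trans (norm_row_mxr _ _).
    by apply: shift_far; rewrite ger0_norm; nra.
  by rewrite !collapse_far //; apply: le_trans (norm_row_mxl _ _); lra.
- by move=> x; rewrite KfE // mulr1 invr1 scale1r subr0 mulr1.
- by move=> x; rewrite /= subrr mulr0 scale0r subr0.
Qed.

Section Fibre.
Context (Y : ptopologicalType) (l : pointed_map (sphere R m.+2) Y).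

Definition fibre (x : S * T) : Y := l (collapse x.2).

Lemma bounded_fibre : bounded_by 1 fibre.
Proof. by split=> // s t h; rewrite /fibre collapse_far // pmap_pt. Qed.

Lemma is_amap_fibre : is_amap fibre.
Proof.
split; last by exists 1; exact: bounded_fibre.
by have cl := @pmap_cts _ _ l; rewrite /fibre; cts.
Qed.

(** An equality of maps, not only a homotopy. Where [lkq] has norm less than 1, t is close to 4 ax
    or -4 ax, and the fibre or its reflection appears. Elsewhere the map is l after
    [collapse (lkp x)], which is the collar at the level |t - 4 ax| - 2 of [hstd 1 1]. *)
Lemma link_fibre x : l (whitehead_fun (pointed_id (sphere R m.+2)) (pointed_id (sphere R m.+2)) (link x)) =
  addf 4 (whisk 1 (hstd 1 1) (fun y => l (gloop y)) fibre) (oppf fibre) x.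
Proof.
case: x => s t; rewrite link_whitehead /addf /oppf whisk_stdE /fibre /=.
have pq : 1 <= enorm (lkp (s, t)) -> 1 <= enorm (lkq (s, t)) ->
    l (if 1 <= enorm (lkq (s, t)) then collapse (lkp (s, t)) else collapse (lkq (s, t))) = point.
  by move=> hp ->; rewrite collapse_pt // pmap_pt.
have [t8|/ltW t8] := lerP `|t| 8; last first.
  rewrite pq; [|apply: le_trans (enorm_consvl _ _)|exact: lkq_far]; last first.
    by rewrite ger0_norm; have := @lk0_far _ _ (s, t) t8; lra.
  have h4 := shift4_far t8; case: ifP => t0.
    rewrite ifF; last by apply/negbTE; rewrite -ltNge; lra.
    rewrite gbounded_gloop ?pmap_pt //; left; rewrite ler_normr; apply/orP; left; lra.
  rewrite collapse_far ?pmap_pt // norm_refl shiftN; apply: shift_far.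
  by rewrite normrN ger0_norm; lra.
have q := @lkq_near _ _ (s, t) t8; rewrite /= in q.
case: (boolP (0 <= t 0 0)) => t0.
  rewrite fold_pos // in q; case: (boolP (`|t - 4 *: ax| <= 1)) => h1.
    have hp := @lkp_near _ _ (s, t) h1; case: (lerP 1 (enorm (lkq (s, t)))) => hq.
      by rewrite (collapse_pt hp) -q (collapse_pt hq).
    by rewrite q.
  have h1' : 1 <= `|t - 4 *: ax| by rewrite leNgt; apply: contra h1 => /ltW.
  have hq : 1 <= enorm (lkq (s, t)).
    by rewrite q; apply: le_trans h1' _; exact: le_normv_enorm.
  rewrite hq; have [s1|/ltW s1] := lerP `|s| 1.
    have -> : lkp (s, t) = consv (`|t - 4 *: ax| - 1 - 1) s; last by [].
    have c4 : `|s| <= 4 by lra.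
    have e0 : lk0 (s, t) = `|t - 4 *: ax| - 1 - 1 by rewrite /lk0 /= [Num.max _ _](max_idPl _); lra.
    by rewrite /lkp e0 /= (cut_near c4) (cut_near t8) mulr1 scale1r.
  by rewrite (@gbounded_gloop _ _ _ s) ?(collapse_pt (@lkp_s _ _ (s, t) s1)) //; right.
have {}t0 : t 0 0 <= 0 by rewrite ltW // ltNge.
have hp : 1 <= enorm (lkp (s, t)).
  apply: le_trans (enorm_consvl _ _); have := @lkp_neg _ _ (s, t) t0.
  by move=> h; rewrite ger0_norm; lra.
rewrite -fold_shift_neg // -q; case: (lerP 1 (enorm (lkq (s, t)))) => hq //.
by rewrite !collapse_pt.
Qed.

Lemma acls_fibre_link : acls (fun x => l (whitehead_fun (pointed_id (sphere R m.+2)) (pointed_id (sphere R m.+2)) (link x))) =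
  Dh (acls fibre) (hclass R l).
Proof.
rewrite (acls_eq link_fibre).
have gG := is_gmap_comp l (@is_gmap_gloop R m).
have bG : gbounded 1 (fun y : R * S => l (gloop y)).
  by move=> x s h; rewrite gbounded_gloop // pmap_pt.
have l11 : (1 : R) <= 1 := lexx 1.
have ws := whiskable_std bG l11 bounded_fibre.
have aw := is_amap_whisk gG.1 is_amap_fibre ws.
have bw := bounded_whisk_std bG l11 (@ler01 R) bounded_fibre.
have bw4 : bounded_by 4 (whisk 1 (hstd 1 1) (fun y => l (gloop y)) fibre).
  by apply: bounded_by_le bw; lra.
have bo4 : bounded_by 4 (oppf fibre).
  by apply: bounded_oppf; apply: bounded_by_le bounded_fibre; lra.
have r40 : (0 : R) <= 4 by lra.
rewrite (acls_add aw (is_amap_oppf is_amap_fibre) bw4 bo4 r40 (lexx _)).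
by rewrite acls_opp; [rewrite (whiskcE gG is_amap_fibre ws) DhE|exact: is_amap_fibre].
Qed.

End Fibre.

Lemma push_ball1 (Y : ptopologicalType) (l : pointed_map (sphere R m.+2) Y)
    (g : pointed_map (sphere R N) Y) (h h' : (0 < m.+2)%N) :
  (forall z, g z = l (@whitehead R m.+2 m.+2 h h' (sphere R m.+2) (pointed_id _) (pointed_id _) z)) ->
  push g (acls ball1) = Dh (acls (fibre l)) (hclass R l).
Proof.
move=> gE; rewrite -acls_link pushE; last exact: is_amap_link.
by rewrite -acls_fibre_link; apply: acls_eq => x; rewrite gE.
Qed.

End LinkingClass.

(** * Linear charts *)

Section MatrixPaths.
Context (R : realType).

Lemma cts_prod (X : topologicalType) (I : Type) (r : seq I) (F : I -> X -> R) :
  (forall i, continuous (F i)) -> continuous (fun x => \prod_(i <- r) F i x).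
Proof.
move=> cF; elim: r => [|i r IH].
  by under eq_fun do rewrite big_nil; exact: cts_cst.
by under eq_fun do rewrite big_cons; apply: cts_mul.
Qed.

Lemma cts_det (X : topologicalType) k (A : X -> 'M[R]_k) :
  (forall i j, continuous (fun x => A x i j)) -> continuous (fun x => \det (A x)).
Proof.
move=> cA; rewrite /determinant; apply: cts_sum => s.
by apply: cts_mul; [exact: cts_cst|apply: cts_prod => i; exact: cA].
Qed.

Lemma cts_adj (X : topologicalType) k (A : X -> 'M[R]_k) i j :
  (forall i j, continuous (fun x => A x i j)) -> continuous (fun x => \adj (A x) i j).
Proof.
move=> cA; apply: (@cts_eq _ _ _ (fun x => (-1) ^+ (j + i) * \det (row' j (col' i (A x))))).
  by move=> x; rewrite mxE.
apply: cts_mul; first exact: cts_cst.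
apply: cts_det => a b; apply: (@cts_eq _ _ _ (fun x => A x (lift j a) (lift i b))) => //.
by move=> x; rewrite !mxE.
Qed.

Lemma cts_mulmx (X : topologicalType) k l (f : X -> 'rV[R]_k) (A : X -> 'M[R]_(k, l)) :
  continuous f -> (forall i j, continuous (fun x => A x i j)) ->
  continuous (fun x => f x *m A x).
Proof.
move=> cf cA; apply: cts_rowP => j.
apply: (@cts_eq _ _ _ (fun x => \sum_i f x 0 i * A x i j)) => [x|]; first by rewrite mxE.
by apply: cts_sum => i; apply: cts_mul; [exact: cts_coord|exact: cA].
Qed.

Lemma norm_mulmx k l (x : 'rV[R]_k) (A : 'M[R]_(k, l)) :
  `|x *m A| <= `|x| * \sum_i \sum_j `|A i j|.
Proof.
have s0 : 0 <= \sum_i \sum_j `|A i j| by apply: sumr_ge0 => i _; apply: sumr_ge0.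
apply: normv_le => [|j]; first exact: mulr_ge0.
rewrite mxE; apply: le_trans (ler_norm_sum _ _ _) _; rewrite mulr_sumr.
apply: ler_sum => i _; rewrite normrM; apply: ler_pM => //; first exact: le_normv.
by rewrite (bigD1 j) //= lerDl; apply: sumr_ge0.
Qed.

(** By the adjugate formula the inverses depend continuously on the parameter, so they are bounded
    on the unit interval. The bound gives a common radius for the maps along a path of charts. *)
Lemma mulmx_lower_bound k (M : R -> 'M[R]_k) :
  (forall i j, continuous (fun a => M a i j)) ->
  (forall a, 0 <= a <= 1 -> M a \in unitmx) ->
  exists2 c, 0 < c & forall a (x : 'rV[R]_k), 0 <= a <= 1 -> c * `|x| <= `|x *m M a|.
Proof.
move=> cM uM.
pose I a := (\det (M (clamp a)))^-1 *: \adj (M (clamp a)).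
have IE a : 0 <= a <= 1 -> invmx (M a) = I a.
  by move=> a01; rewrite /invmx uM // /I clamp_id.
have cMc i j : continuous (fun a => M (clamp a) i j).
  by apply: (@cts_comp _ _ _ (@clamp R) (fun a => M a i j)) => //; apply: cts_clamp; cts.
have cI : continuous (fun a => \sum_i \sum_j `|I a i j|).
  apply: cts_sum => i; apply: cts_sum => j.
  apply: cts_norm; apply: (@cts_eq _ _ _ (fun a => (\det (M (clamp a)))^-1 * \adj (M (clamp a)) i j)).
    by move=> a; rewrite mxE.
  apply: cts_mul; last exact: cts_adj.
  apply: cts_inv; last exact: cts_det.
  by move=> a; have := uM _ (clamp_itv a); rewrite unitmxE unitfE.
have [a0 _ ub] := EVT_max ler01 (continuous_subspaceT cI).
set b := \sum_i _ in ub.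
have b0 : 0 <= b by apply: sumr_ge0 => i _; apply: sumr_ge0.
exists (1 + b)^-1 => [|a x a01]; first by rewrite invr_gt0; lra.
rewrite ler_pdivrMl; last lra.
rewrite -{1}[x](mulmxK (uM _ a01)) IE //.
apply: le_trans (norm_mulmx (x *m M a) (I a)) _; rewrite mulrC ler_wpM2r //; apply: le_trans (ub a _) _; last lra.
by rewrite in_itv.
Qed.

End MatrixPaths.

Section LinearCharts.
Context (R : realType) (m : nat).
Local Notation S := 'rV[R]_m.+1.
Local Notation T := 'rV[R]_m.+2.
(** K + 1 and N are convertible; the LUP decomposition is stated for matrices whose size is a
    successor. *)
Local Notation K := (m + m.+2)%N.
Local Notation N := (m.+1 + m.+2)%N.
Implicit Types M A B : 'M[R]_K.+1.

Definition chart M (z : 'rV[R]_N) (x : S * T) : sphere R N :=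
  collapse ((row_mx x.1 x.2 - z) *m (M : 'M[R]_N)).

Lemma chart_path (M : R -> 'M[R]_K.+1) z :
  (forall i j, continuous (fun a => M a i j)) ->
  (forall a, 0 <= a <= 1 -> M a \in unitmx) ->
  acls (chart (M 0) z) = acls (chart (M 1) 0).
Proof.
move=> cM uM; have [c c0 lb] := mulmx_lower_bound cM uM.
apply: acls_homot; apply: (@ahomot_itv _ _ _ _ _ (fun ax : R * (S * T) =>
  chart (M ax.1) ((1 - ax.1) *: z) ax.2) (c^-1 + `|z|)).
- apply: cts_collapse; apply: cts_mulmx; first by cts.
  by move=> i j; apply: (@cts_comp _ _ _ (@fst R (S * T)) (fun a => M a i j)); [cts|exact: cM].
- move=> a /[dup] a01 /andP[a0 a1].
  have far s t : c^-1 + `|z| <= `|row_mx s t| -> chart (M a) ((1 - a) *: z) (s, t) = point.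
    move=> h; apply: collapse_far; apply: le_trans (lb _ _ a01).
    rewrite -ler_pdivrMl // mulr1; apply: le_trans (lerB_dist _ _).
    have : `|(1 - a) *: z| <= `|z| by rewrite normrZ ger0_norm ?ler_piMl //; lra.
    by rewrite /=; lra.
  split=> [s t h|s s' t h h'].
    by apply: far; apply: le_trans (norm_row_mxr _ _).
  by rewrite !far //; apply: le_trans (norm_row_mxl _ _).
- by move=> x /=; rewrite subr0 scale1r.
- by move=> x /=; rewrite subrr scale0r.
Qed.

Lemma chart_move M z : M \in unitmx -> acls (chart M z) = acls (chart M 0).
Proof. by move=> uM; apply: (@chart_path (fun=> M)) => // i j; exact: cts_cst. Qed.

Lemma chart_segment C A B M : C \in unitmx -> M \in unitmx ->
  (forall a, 0 <= a <= 1 -> (1 - a) *: A + a *: B \in unitmx) ->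
  acls (chart (C *m A *m M) 0) = acls (chart (C *m B *m M) 0).
Proof.
move=> uC uM uAB; pose D a := C *m ((1 - a) *: A + a *: B) *m M.
have D0 : D 0 = C *m A *m M by rewrite /D subr0 scale1r scale0r addr0.
have D1 : D 1 = C *m B *m M by rewrite /D subrr scale1r scale0r add0r.
rewrite -D0 -D1; apply: (@chart_path D 0) => [i j|a a01]; last by rewrite !unitmx_mul uM uC uAB.
apply: (@cts_eq _ _ (fun a => D a i j) (fun a =>
    \sum_l (\sum_k C i k * ((1 - a) * A k l + a * B k l)) * M l j)).
  move=> a; rewrite mxE; apply: eq_bigr => l _; rewrite mxE; congr (_ * _).
  by apply: eq_bigr => k _; rewrite !mxE.
apply: cts_sum => l; apply: cts_mul; last exact: cts_cst.
by apply: cts_sum => k; cts; apply: cts_opp; exact: cts_id.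
Qed.

Local Notation chi M := (acls (chart M 0)).
Local Notation E i j := (delta_mx i j : 'M[R]_K.+1).

Lemma unit_mul A B : A \in unitmx -> B \in unitmx -> A *m B \in unitmx.
Proof. by rewrite unitmx_mul => -> ->. Qed.

Definition flip i : 'M[R]_K.+1 := 1%:M - 2 *: E i i.

Lemma flip_flip i : flip i *m flip i = 1%:M.
Proof.
rewrite /flip mulmxBl mul1mx -scalemxAl mulmxBr mulmx1 -scalemxAr mul_delta_mx.
by apply/matrixP => a b; rewrite !mxE; lra.
Qed.

Lemma flip_unit i : flip i \in unitmx.
Proof. by have [] := mulmx1_unit (flip_flip i). Qed.

Lemma chi_transvection i j (c : R) M : i != j -> M \in unitmx ->
  chi ((1%:M + c *: E i j) *m M) = chi M.
Proof.
move=> ij uM; rewrite -[in RHS](mul1mx M) -[_ *m M in LHS]mul1mx -[_ *m M in RHS]mul1mx !mulmxA.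
apply: chart_segment => // [|a _]; first exact: unitmx1.
have -> : (1 - a) *: (1%:M + c *: E i j) + a *: 1%:M = 1%:M + ((1 - a) * c) *: E i j.
  by rewrite scalerDr scalerA addrAC -scalerDl subrK scale1r.
set d := _ * c.
have := @mulmx1_unit _ _ (1%:M + d *: E i j) (1%:M - d *: E i j); case=> //.
rewrite mulmxDl mul1mx -scalemxAl mulmxBr mulmx1 -scalemxAr mul_delta_mx_0 1?eq_sym //.
by rewrite !scaler0 subr0 subrK.
Qed.

Lemma transvection_unit i j (c : R) : i != j -> 1%:M + c *: E i j \in unitmx.
Proof.
move=> ij; have [|//] := @mulmx1_unit _ _ (1%:M + c *: E i j) (1%:M - c *: E i j).
rewrite mulmxDl mul1mx -scalemxAl mulmxBr mulmx1 -scalemxAr mul_delta_mx_0 1?eq_sym //.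
by rewrite !scaler0 subr0 subrK.
Qed.

(** The quarter turn in the plane (i, j), written as three transvections, each of which can be
    contracted to the identity. *)
Definition quarter i j : 'M[R]_K.+1 :=
  (1%:M + 1 *: E i j) *m (1%:M + (-1) *: E j i) *m (1%:M + 1 *: E i j).

Lemma quarterE i j : i != j -> quarter i j = 1%:M - E i i - E j j + E i j - E j i.
Proof.
move=> ij; rewrite /quarter scaleN1r !scale1r; set a := E i j; set b := E j i.
have aa : a *m a = 0 by rewrite mul_delta_mx_0 // eq_sym.
have ab : a *m b = E i i by exact: mul_delta_mx.
have ba : b *m a = E j j by exact: mul_delta_mx.
have ia : E i i *m a = a by exact: mul_delta_mx.
rewrite !(mulmxDl, mulmxDr, mulNmx, mulmxN, mul1mx, mulmx1) ab aa ba ia.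
by apply/matrixP => k l; rewrite !mxE; lra.
Qed.

Lemma chi_quarter i j M : i != j -> M \in unitmx -> chi (quarter i j *m M) = chi M.
Proof.
move=> ij uM; have ji : j != i by rewrite eq_sym.
have u1 := transvection_unit 1 ij; have u2 := transvection_unit (-1) ji.
have uM1 : (1%:M + 1 *: E i j) *m M \in unitmx by rewrite unitmx_mul u1.
have uM2 : (1%:M + (-1) *: E j i) *m ((1%:M + 1 *: E i j) *m M) \in unitmx by rewrite unitmx_mul u2.
rewrite /quarter -!mulmxA; apply: etrans (chi_transvection 1 ij uM2) _.
exact: etrans (chi_transvection (-1) ji uM1) (chi_transvection 1 ij uM).
Qed.

Lemma quarter_unit i j : i != j -> quarter i j \in unitmx.
Proof.
by move=> ij; rewrite !unitmx_mul !transvection_unit // eq_sym.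
Qed.

Lemma quarter_mul i j : i != j ->
  [/\ quarter i j *m E i i = - E j i, quarter i j *m E j j = E i j,
      quarter i j *m E i j = - E j j & quarter i j *m E j i = E i i].
Proof.
move=> ij; have ji : j != i by rewrite eq_sym.
have z1 k l : E k i *m E j l = 0 by exact: mul_delta_mx_0.
have z2 k l : E k j *m E i l = 0 by exact: mul_delta_mx_0.
have d k l n : E k l *m E l n = E k n by exact: mul_delta_mx.
rewrite quarterE //; split; rewrite !(mulmxDl, mulNmx, mul1mx) ?z1 ?z2 ?d;
  by apply/matrixP => k l; rewrite !mxE; lra.
Qed.

Lemma tperm_quarter i j : i != j -> tperm_mx i j = quarter i j *m flip i.
Proof.
move=> ij; have [e _ _ _] := quarter_mul ij.
rewrite /flip mulmxBr mulmx1 -scalemxAr e quarterE //.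
apply/matrixP => a b; rewrite !mxE.
case: tpermP => [->|->|/eqP ai /eqP aj].
- by rewrite eqxx (negbTE ij) /= ![_ == b]eq_sym; case: (b == i); case: (b == j) => /=; lra.
- by rewrite eqxx [j == i]eq_sym (negbTE ij) /= ![_ == b]eq_sym; case: (b == i); case: (b == j) => /=; lra.
- by rewrite (negbTE ai) (negbTE aj) /=; lra.
Qed.

Lemma flip_flip_quarter i j : i != j -> flip i *m flip j = quarter i j *m quarter i j.
Proof.
move=> ij; have [e1 e2 e3 e4] := quarter_mul ij.
rewrite [X in _ = _ *m X]quarterE // !(mulmxDr, mulmxN, mulmx1) e1 e2 e3 e4 quarterE //.
rewrite /flip !(mulmxDl, mulmxDr, mulNmx, mulmxN, mul1mx, mulmx1) -scalemxAl -scalemxAr.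
by rewrite mul_delta_mx_0 //; apply/matrixP => a b; rewrite !mxE; lra.
Qed.

(** Two different flips differ by a half turn, the square of a quarter turn. *)
Lemma chi_flip i j M : M \in unitmx -> chi (flip i *m M) = chi (flip j *m M).
Proof.
move=> uM; have [->//|ij] := eqVneq i j.
have uF : flip j *m M \in unitmx := unit_mul (flip_unit j) uM.
have uQ : quarter i j *m (flip j *m M) \in unitmx := unit_mul (quarter_unit ij) uF.
have <- : quarter i j *m (quarter i j *m (flip j *m M)) = flip i *m M.
  by rewrite mulmxA -flip_flip_quarter // -mulmxA (mulmxA (flip j)) flip_flip mul1mx.
exact: etrans (chi_quarter ij uQ) (chi_quarter ij uF).
Qed.

Lemma chi_tperm i j k M : i != j -> M \in unitmx ->
  chi (tperm_mx i j *m M) = chi (flip k *m M).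
Proof.
move=> ij uM; rewrite tperm_quarter // -mulmxA.
have uF : flip i *m M \in unitmx := unit_mul (flip_unit i) uM.
exact: etrans (chi_quarter ij uF) (chi_flip i k uM).
Qed.

Lemma chart_id : chart 1%:M 0 =1 @ball1 R m.
Proof. by move=> x; rewrite /chart subr0 mulmx1. Qed.

Lemma chart_flip : chart (flip (rshift m.+1 0)) 0 =1 oppf (@ball1 R m).
Proof.
move=> [s t]; rewrite /chart /oppf /ball1 /= subr0; congr collapse.
apply/rowP => j; rewrite /flip mulmxBr mulmx1 -scalemxAr mxE [X in _ + X]mxE [X in - X]mxE.
rewrite (_ : (row_mx s t *m _) 0 j = t 0 0 * (rshift m.+1 0 == j)%:R); last first.
  rewrite mxE (bigD1 (rshift m.+1 0)) //= big1 ?addr0 => [|k k0]; last first.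
    by rewrite [delta_mx _ _ _ _]mxE (negbTE k0) mulr0.
  by rewrite row_mxEr mxE eqxx /= eq_sym.
case: (split_ordP j) => i ->; first by rewrite !row_mxEl eq_rlshift /= mulr0n; lra.
rewrite !row_mxEr mxE eq_rshift [0 == i]eq_sym.
by case: eqP => [->|_] /=; rewrite ?mulr1n ?mulr0n; lra.
Qed.

Local Notation o := (rshift m.+1 0 : 'I_K.+1).

(** M and [flip o *m M] are considered together because [chi] is not known to be multiplicative;
    multiplying M by a flip or a transposition exchanges the two values. *)
Definition chi_std M :=
  (chi M = chi 1%:M /\ chi (flip o *m M) = chi (flip o)) \/
  (chi M = chi (flip o) /\ chi (flip o *m M) = chi 1%:M).

Lemma chi_std1 : chi_std 1%:M.
Proof. by left; rewrite mulmx1. Qed.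

Lemma chi_std_swap M M' : chi M' = chi (flip o *m M) -> chi (flip o *m M') = chi M ->
  chi_std M -> chi_std M'.
Proof. by move=> e1 e2 [[h1 h2]|[h1 h2]]; [right|left]; rewrite e1 e2. Qed.

Lemma chi_std_flip i M : M \in unitmx -> chi_std M -> chi_std (flip i *m M).
Proof.
move=> uM; apply: chi_std_swap; first exact: chi_flip.
have uF : flip i *m M \in unitmx := unit_mul (flip_unit i) uM.
by apply: etrans (chi_flip o i uF) _; rewrite mulmxA flip_flip mul1mx.
Qed.

Lemma tperm_unit i j : tperm_mx i j \in @unitmx R K.+1.
Proof. exact: unitmx_perm. Qed.

Lemma chi_std_tperm i j M : i != j -> M \in unitmx -> chi_std M -> chi_std (tperm_mx i j *m M).
Proof.
move=> ij uM; apply: chi_std_swap; first exact: chi_tperm.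
have uF : tperm_mx i j *m M \in unitmx := unit_mul (tperm_unit i j) uM.
apply: etrans (esym (chi_tperm o ij uF)) _.
by rewrite mulmxA -perm_mxM tperm2 perm_mx1 mul1mx.
Qed.

Lemma chi_std_perm s M : M \in unitmx -> chi_std M -> chi_std (perm_mx s *m M).
Proof.
move=> uM; have [ts -> {s}] := prod_tpermP s.
elim: ts => [|[i j] ts IH] /=; first by rewrite big_nil perm_mx1 mul1mx.
move=> /andP[ij dts] sM; rewrite big_cons perm_mxM -mulmxA.
by apply: chi_std_tperm; [|rewrite unitmx_mul unitmx_perm|exact: IH].
Qed.

Definition signs (r : seq 'I_K.+1) : 'M[R]_K.+1 := diag_mx (\row_i (-1) ^+ (i \in r)).

Lemma signs_cons i r : i \notin r -> signs (i :: r) = flip i *m signs r.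
Proof.
move=> ir; have -> : flip i = diag_mx (\row_j (-1) ^+ (j == i)).
  apply/matrixP => a b; rewrite !mxE.
  case: (eqVneq a b) => [->|ab]; last first.
    by case: (eqVneq a i) => [ai|_] /=; rewrite ?mulr0n; last lra; rewrite -ai eq_sym (negbTE ab) /=; lra.
  by rewrite andbb; case: (b == i); rewrite ?mulr1n ?mulr0n ?expr1 ?expr0; lra.
rewrite mulmx_diag; congr diag_mx; apply/rowP => j; rewrite !mxE in_cons.
by case: eqP => [->|_]; rewrite ?(negbTE ir) /= ?expr1 ?expr0 ?mulr1 ?mul1r.
Qed.

Lemma signs_std r : uniq r -> chi_std (signs r) /\ signs r \in unitmx.
Proof.
elim: r => [_|i r IH /= /andP[ir /IH[h u]]].
  have -> : signs [::] = 1%:M by rewrite -diag_const_mx; congr diag_mx; apply/rowP => i; rewrite !mxE.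
  by split; [exact: chi_std1|exact: unitmx1].
by rewrite signs_cons //; split; [exact: chi_std_flip|exact: unit_mul (flip_unit i) u].
Qed.

Lemma unit_lower A : (forall i j : 'I_K.+1, (i < j)%N -> A i j = 0) ->
  (forall i, A i i != 0) -> A \in unitmx.
Proof.
move=> A0 Ai; rewrite unitmxE unitfE det_trig; last exact/is_trig_mxP.
by apply/prodf_neq0 => i _.
Qed.

Lemma unit_upper A : (forall i j : 'I_K.+1, (j < i)%N -> A i j = 0) ->
  (forall i, A i i != 0) -> A \in unitmx.
Proof.
move=> A0 Ai; rewrite -unitmx_tr; apply: unit_lower => [i j ij|i]; rewrite mxE //.
exact: A0.
Qed.

(** In M = P^-1 L U the unitriangular L contracts to 1, and U moves along a segment to the diagonal
    matrix of the signs of its diagonal; triangularity keeps both segments invertible. What remains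
    is a product of transpositions and flips. *)
Lemma chi_unit M : M \in unitmx -> chi M = chi 1%:M \/ chi M = chi (flip o).
Proof.
move=> uM.
have := cormen_lup_correct M; have := cormen_lup_perm M; have := cormen_lup_lower M.
have := cormen_lup_upper M.
case: (cormen_lup M) => [[P L] U] /= U0 L0 /is_perm_mxP[s ->] PM.
have uP : perm_mx s \in @unitmx R K.+1 by exact: unitmx_perm.
have uL : L \in unitmx.
  apply: unit_lower => [i j ij|i]; last by rewrite (L0 i i (leqnn _)) eqxx oner_neq0.
  by rewrite (L0 i j (ltnW ij)) -val_eqE /= (ltn_eqF ij).
have uU : U \in unitmx.
  have := unit_mul uP uM; rewrite (PM : perm_mx s *m M = L *m U) unitmx_mul.
  by case/andP.
have Ui i : U i i != 0.
  move: uU; rewrite -unitmx_tr unitmxE unitfE det_trig; last first.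
    by apply/is_trig_mxP => a b ab; rewrite mxE (U0 _ _ ab).
  by move=> /prodf_neq0/(_ i isT); rewrite mxE.
have ME : M = perm_mx s^-1 *m L *m U.
  by rewrite -mulmxA -(PM : perm_mx s *m M = L *m U) mulmxA -perm_mxM mulVg perm_mx1 mul1mx.
pose r := [seq i <- enum 'I_K.+1 | U i i < 0].
have [|sr ur] := @signs_std r; first by rewrite filter_uniq ?enum_uniq.
have -> : chi M = chi (perm_mx s^-1 *m signs r).
  rewrite ME (chart_segment (B := 1%:M)) ?unitmx_perm //; last first.
    move=> a a01; apply: unit_lower => [i j ij|i].
      by rewrite !mxE (L0 i j (ltnW ij)) -val_eqE /= (ltn_eqF ij) mulr0n !mulr0 addr0.
    by rewrite !mxE (L0 i i (leqnn _)) !eqxx !mulr1n; apply/eqP; lra.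
  rewrite mulmx1 -[perm_mx _ *m U]mulmx1 -[_ *m signs r]mulmx1.
  apply: chart_segment; rewrite ?unitmx_perm ?unitmx1 // => a /andP[a0 a1].
  apply: unit_upper => [i j ij|i].
    by rewrite !mxE (U0 i j ij) -val_eqE /= (gtn_eqF ij) mulr0n !mulr0 addr0.
  rewrite !mxE eqxx mulr1n mem_filter mem_enum andbT.
  have u0 := Ui i; have [un|up] := ltrP (U i i) 0.
    by rewrite expr1 lt_eqF //; nra.
  by rewrite expr0 gt_eqF //; have : 0 < U i i; [rewrite lt_neqAle eq_sym u0|move=> ?; nra].
by case: (chi_std_perm s^-1 ur sr) => [[]|[]]; [left|right].
Qed.

Lemma chart_class M z : M \in unitmx ->
  acls (chart M z) = acls (@ball1 R m) \/ acls (chart M z) = - acls (@ball1 R m).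
Proof.
move=> uM; rewrite chart_move //.
have ab : is_amap (@ball1 R m).
  split; first by rewrite /ball1; cts.
  exists 1; split=> [s t h|s s' t h h']; rewrite /ball1.
    by apply: collapse_far; apply: le_trans h (norm_row_mxr _ _).
  by rewrite !collapse_far //; [apply: le_trans h' (norm_row_mxl _ _)|apply: le_trans h (norm_row_mxl _ _)].
rewrite -acls_opp // -(acls_eq chart_id) -(acls_eq chart_flip).
exact: chi_unit.
Qed.

End LinearCharts.

(** * Piecewise affine maps and their zeros *)

Section PiecewiseAffine.
Context (R : realType).

Lemma poly_nonroot (p : {poly R}) : p != 0 -> exists n : nat, ~~ root p n%:R.
Proof.
move=> p0; apply: contrapT => /forallNP h.
pose rs := [seq (n%:R : R) | n <- iota 0 (size p)].
have : (size rs < size p)%N.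
  apply: max_poly_roots => //; last first.
    by rewrite map_inj_uniq ?iota_uniq // => i j /eqP; rewrite eqr_nat => /eqP.
  by apply/allP => _ /mapP[n _ ->]; apply/negPn/negP; exact: h.
by rewrite size_map size_iota ltnn.
Qed.

(** A point of the moment curve: a linear form that is not zero vanishes at finitely many of them
    only, so one of them avoids any finite set of hyperplanes. They provide generic directions
    without measure or category. For k > 0 the coordinate 0 is 1. *)
Definition moment k (n : nat) : 'rV[R]_k := \row_i n%:R ^+ i.

Lemma moment_avoid k (us : seq 'cV[R]_k) : (forall u, u \in us -> u != 0) ->
  exists n, forall u, u \in us -> moment k n *m u != 0.
Proof.
move=> us0; pose p (u : 'cV[R]_k) := \poly_(i < k) (if insub i is Some j then u j 0 else 0).
have pE u n : (p u).[n%:R] = (moment k n *m u) 0 0.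
  rewrite horner_poly mxE; apply: eq_bigr => i _; rewrite mxE mulrC.
  by rewrite (_ : insub (i : nat) = Some i) // valK.
have p0 u : u \in us -> p u != 0.
  move=> /us0; apply: contra => /eqP pu; apply/eqP/colP => i; rewrite mxE.
  have := coef_poly k (fun i => if insub i is Some j then u j 0 else 0) i.
  by rewrite -/(p u) pu coef0 ltn_ord valK.
have /poly_nonroot[n nr] : \prod_(u <- us) p u != 0.
  by rewrite prodf_seq_neq0; apply/allP => u /p0.
exists n => u uu; apply: contraNneq nr => mu.
by rewrite /root horner_prod prodf_seq_eq0; apply/hasP; exists u; rewrite //= pE mu mxE.
Qed.

Lemma singular_col k (A : 'M[R]_k) : A \notin unitmx -> exists2 u : 'cV_k, u != 0 & A *m u = 0.
Proof.
rewrite -unitmx_tr -row_free_unit -kermx_eq0 => /rowV0Pn[v /sub_kermxP vA v0].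
by exists v^T; [rewrite trmx_eq0|apply: trmx_inj; rewrite trmx_mul trmxK vA trmx0].
Qed.

Lemma moment_avoid_row k (Bs : seq 'M[R]_k) : (forall B, B \in Bs -> B \notin unitmx) ->
  exists n, forall B y, B \in Bs -> y *m B <> moment k n.
Proof.
move=> uB; have /choice[g gP] B : exists u : 'cV_k, B \in Bs -> u != 0 /\ B *m u = 0.
  have [/uB/singular_col[u u0 Bu]|nB] := boolP (B \in Bs); first by exists u.
  by exists 0.
have [|n hn] := @moment_avoid k [seq g B | B <- Bs].
  by move=> _ /mapP[B /gP[g0 _] ->].
exists n => B y BB yB; have := hn (g B) (map_f _ BB).
by rewrite -yB -mulmxA (gP _ BB).2 mulmx0 eqxx.
Qed.

Context (k : nat).
Implicit Types (A : 'M[R]_k.+1) (x y : 'rV[R]_k).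

Definition wv (a : 'rV[R]_k) (v : 'rV[R]_k.+1) : 'rV[R]_k := tlv v + v 0 0 *: a.

Lemma wvD a u v : wv a (u + v) = wv a u + wv a v.
Proof. by apply/rowP => i; rewrite !mxE; ring. Qed.

Lemma wv_eq0 a v : wv a v = 0 -> v = v 0 0 *: consv 1 (- a).
Proof.
move=> /rowP w0; apply/rowP => i; rewrite mxE.
have [j ->|->] := unliftP 0 i; last by rewrite consv0 mulr1.
by have := w0 j; rewrite consvS !mxE; lra.
Qed.

Lemma scale_consv0 c r x : (c *: consv r x) 0 0 = c * r.
Proof. by rewrite mxE consv0. Qed.

Lemma consv_sub x y : consv 1 y = consv 1 x + consv 0 (y - x).
Proof.
apply/rowP => i; rewrite [RHS]mxE; have [j ->|->] := unliftP 0 i.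
  by rewrite !consvS !mxE; lra.
by rewrite !consv0 addr0.
Qed.

Definition linear_part (a : 'rV[R]_k) A : 'M[R]_k :=
  \matrix_(i, j) (A (lift 0 i) (lift 0 j) + A (lift 0 i) 0 * a 0 j).

Lemma linear_partE a A x : wv a (consv 0 x *m A) = x *m linear_part a A.
Proof.
have e j : (consv 0 x *m A) 0 j = \sum_i x 0 i * A (lift 0 i) j.
  rewrite mxE big_ord_recl consv0 mul0r add0r.
  by apply: eq_bigr => i _; rewrite consvS.
apply/rowP => j; rewrite mxE [X in X + _]mxE [X in _ + X]mxE !e [RHS]mxE mulr_suml -big_split /=.
by apply: eq_bigr => i _; rewrite mxE; ring.
Qed.

(* A continuous F with this property is piecewise affine; the cells are left implicit. *)
Definition affine_selection (F : 'rV[R]_k -> 'rV[R]_k.+1) (As : seq 'M[R]_k.+1) :=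
  forall x, exists2 A, A \in As & F x = consv 1 x *m A.

Lemma near_seq (I : eqType) (s : seq I) (P : I -> 'rV[R]_k -> Prop) x :
  (forall i, i \in s -> \forall y \near x, P i y) ->
  \forall y \near x, forall i, i \in s -> P i y.
Proof.
elim: s => [|i s IH] h; first exact: filterE.
have h1 := h i (mem_head _ _).
have /IH h2 : forall j, j \in s -> \forall y \near x, P j y.
  by move=> j js; apply: h; rewrite in_cons js orbT.
by apply: filterS2 h1 h2 => y p1 p2 j; rewrite in_cons => /orP[/eqP ->|/p2].
Qed.

Lemma affine_selection_near F As A x : continuous F -> affine_selection F As ->
  F x = consv 1 x *m A ->
  (forall A', A' \in As -> A' != A -> F x <> consv 1 x *m A') ->
  \forall y \near x, F y = consv 1 y *m A.
Proof.
move=> cF sF Fx FA.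
have cA A' : continuous (fun y : 'rV[R]_k => `|F y - consv 1 y *m A'|).
  apply: cts_normv; apply: cts_addv => //; apply: cts_oppv.
  by apply: cts_mulmx => [|i j]; [apply: cts_consv; cts|exact: cts_cst].
have : \forall y \near x, forall A', A' \in [seq A' <- As | A' != A] -> 0 < `|F y - consv 1 y *m A'|.
  apply: near_seq => A'; rewrite mem_filter => /andP[AA' A's].
  have h : `|F x - consv 1 x *m A'| > 0.
    by rewrite normr_gt0 subr_eq0; apply/eqP/FA.
  exact: (cA A' x _ (lt_nbhsr h)).
apply: filterS => y hy; have [A' A's FA'] := sF y.
have [<-//|AA'] := eqVneq A' A.
by have := hy A'; rewrite mem_filter AA' A's FA' subrr normr0 ltxx => /(_ isT).
Qed.

(** A zero is a point x where F x lies on the line of v0 = (1, -a). By the choice of v0 exactly one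
    piece A of the list represents F there, and A is invertible, so F agrees with this piece nearby.
    The zeros are finitely many because an invertible A sends at most one vector [consv 1 x] to that
    line. *)
Lemma affine_selection_zeros F As : continuous F -> affine_selection F As ->
  (forall x, F x != 0) ->
  exists a, exists Z : seq 'rV[R]_k, (forall x, wv a (F x) = 0 <-> x \in Z) /\
    forall z, z \in Z -> exists2 M, M \in unitmx &
      \forall y \near z, wv a (F y) = (y - z) *m M.
Proof.
move=> cF sF F0.
(* A target outside of the row spaces of these matrices has no preimage on a
   degenerate piece, nor on a hyperplane where two pieces may meet. *)
pose Bs := [seq A <- As | A \notin unitmx] ++
  [seq B <- [seq kermx (col c (p.1 - p.2)) *m p.1 |
     p : 'M[R]_k.+1 * 'M[R]_k.+1 <- [seq (A, A') | A <- As, A' <- As],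
     c : 'I_k.+1 <- enum 'I_k.+1] | B \notin unitmx].
have [|n hn] := @moment_avoid_row _ Bs.
  by move=> B; rewrite mem_cat !mem_filter => /orP[] /andP[].
pose v0 := moment k.+1 n; pose a := - tlv v0.
have v0E : consv 1 (- a) = v0.
  apply/rowP => i; have [j ->|->] := unliftP 0 i; first by rewrite consvS opprK mxE.
  by rewrite consv0 mxE expr0.
have zE x : wv a (F x) = 0 -> F x = F x 0 0 *: v0 /\ F x 0 0 != 0.
  move=> /wv_eq0; rewrite v0E => e; split=> //.
  by apply: contraNneq (F0 x) => e0; rewrite e e0 scale0r.
have zA x A : wv a (F x) = 0 -> A \in As -> F x = consv 1 x *m A -> A \in unitmx /\
    forall A', A' \in As -> A' != A -> F x <> consv 1 x *m A'.
  move=> /zE[Fx b0] As1 FA; set b := F x 0 0 in Fx b0.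
  have e : (b^-1 *: consv 1 x) *m A = v0.
    by rewrite -scalemxAl -FA Fx scalerA mulVf // scale1r.
  split=> [|A' As' AA' FA'].
    apply/negPn/negP => nu; apply: (hn A (b^-1 *: consv 1 x)) e.
    by rewrite mem_cat mem_filter nu As1.
  (* The points where A and A' coincide satisfy the linear equation given by a nonzero column of A -
     A'. The image of its solutions under A is a proper subspace, which v0 avoids. *)
  have [c c0] : exists c, col c (A - A') != 0.
    apply: contrapT => /forallNP h; move/eqP: AA'; apply; apply/esym/eqP.
    rewrite -subr_eq0; apply/eqP/matrixP => i j; rewrite [RHS]mxE.
    have /negP/negPn/eqP/colP/(_ i) := h j; by rewrite [LHS]mxE [RHS]mxE.
  have : (consv 1 x <= kermx (col c (A - A')))%MS.
    apply/sub_kermxP; rewrite colE mulmxA mulmxBr -FA -FA' subrr mul0mx //.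
  move=> /submxP[d dE].
  have nu : kermx (col c (A - A')) *m A \notin unitmx.
    apply/negP; rewrite unitmx_mul => /andP[uk _]; move/eqP: c0; apply.
    by rewrite -[col _ _](mulKmx uk) mulmx_ker mulmx0.
  apply: (hn (kermx (col c (A - A')) *m A) (b^-1 *: d)).
    rewrite mem_cat [X in _ || X]mem_filter nu /=; apply/orP; right.
    apply/allpairsP; exists ((A, A'), c); rewrite mem_enum; split=> //=.
    by apply/allpairsP; exists (A, A').
  by rewrite mulmxA -scalemxAl -dE e.
(* The default 0 is returned for a piece without zeros; Z keeps it only if it happens to be a
   zero. *)
pose zA_ A := xget 0 [set x | wv a (F x) = 0 /\ F x = consv 1 x *m A].
pose Z := [seq z <- [seq zA_ A | A <- As] | wv a (F z) == 0].
exists a, Z; split=> [x|z].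
  split=> [Fx|]; last by rewrite mem_filter => /andP[/eqP].
  rewrite mem_filter Fx eqxx /=; have [A As1 FA] := sF x.
  apply/mapP; exists A => //.
  have [] : [set x | wv a (F x) = 0 /\ F x = consv 1 x *m A] (zA_ A).
    by apply: (@xgetPex _ 0 [set x | wv a (F x) = 0 /\ F x = consv 1 x *m A]); exists x.
  set y := zA_ A => Fy FyA.
  have [uA _] := zA _ _ Fx As1 FA; have [Ex bx] := zE _ Fx; have [Ey by_] := zE _ Fy.
  have e : F y 0 0 *: consv 1 x = F x 0 0 *: consv 1 y.
    apply: (can_inj (mulmxK uA)); rewrite -!scalemxAl -FA -FyA.
    by rewrite [F x in LHS]Ex [F y in RHS]Ey !scalerA mulrC.
  have e0 : F y 0 0 = F x 0 0 by move/rowP/(_ 0): e; rewrite !scale_consv0 !mulr1.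
  move: e; rewrite e0 => /(scalerI bx) e; apply/rowP => i.
  by move/rowP/(_ (lift 0 i)): e; rewrite !consvS.
rewrite mem_filter => /andP[/eqP Fz _]; have [A As1 FA] := sF z.
have [uA nA] := zA _ _ Fz As1 FA; have [Ez bz] := zE _ Fz.
(* If h is in the kernel, A sends both [consv 0 h] and [consv 1 z] to the line of v0; they are
   proportional, and comparing first coordinates gives h = 0. *)
exists (linear_part a A).
  rewrite -row_free_unit -kermx_eq0; apply/rowV0P => h /sub_kermxP.
  rewrite -linear_partE => /wv_eq0; rewrite v0E; set c := (_ 0 0) => e.
  have e1 : F z 0 0 *: consv 0 h = c *: consv 1 z.
    apply: (can_inj (mulmxK uA)); rewrite -!scalemxAl -FA e.
    by rewrite [F z in RHS]Ez !scalerA mulrC.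
  have c0 : c = 0 by move/rowP/(_ 0): e1; rewrite !scale_consv0 mulr0 mulr1.
  move: e1; rewrite c0 scale0r => /eqP; rewrite scaler_eq0 (negbTE bz) /= => /eqP e1.
  by apply/rowP => i; move/rowP/(_ (lift 0 i)): e1; rewrite consvS !mxE.
apply: filterS (affine_selection_near cF sF FA nA) => y Fy.
by rewrite -linear_partE Fy (consv_sub z) mulmxDl wvD -FA Fz add0r.
Qed.

End PiecewiseAffine.

Section UniformContinuity.
Context (R : realType).

Lemma closed_bounded_ge k (A : set 'rV[R]_k) (f : 'rV[R]_k -> R) (r : R) :
  closed A -> (forall x, A x -> `|x| <= r) -> continuous f -> (forall x, A x -> 0 < f x) ->
  exists2 c, 0 < c & forall x, A x -> c <= f x.
Proof.
move=> clA bA cf fpos; have [->|/set0P A0] := eqVneq A set0; first by exists 1.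
have cA : compact A.
  apply: bounded_closed_compact => //; exists r; split; first exact: num_real.
  by move=> M rM x Ax; apply: le_trans (bA x Ax) (ltW rM).
have [x Ax fx] := compact_EVT_min A0 cA (continuous_subspaceT cf).
by exists (f x) => [|y Ay]; [exact/fpos/set_mem|apply/fx/mem_set].
Qed.

Definition clampv k (u : 'rV[R]_k) : 'rV[R]_k := \row_i Num.max (-1) (Num.min 1 (u 0 i)).

Lemma norm_clampv k (u : 'rV[R]_k) : `|clampv u| <= 1.
Proof.
apply: normv_le => // i; rewrite mxE ler_norml le_max lexx /= ge_max ge_min lexx /=.
by rewrite andbT; lra.
Qed.

Lemma clampv_id k (u : 'rV[R]_k) : `|u| <= 1 -> clampv u = u.
Proof.
move=> u1; apply/rowP => i; rewrite mxE.
have := le_trans (le_normv u i) u1; rewrite ler_norml => /andP[h1 h2].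
by rewrite (min_idPr h2) (max_idPr h1).
Qed.

Lemma clampv_dist k (u v : 'rV[R]_k) : `|clampv u - clampv v| <= `|u - v|.
Proof.
apply: normv_le => // i; apply: le_trans (le_normv (u - v) i); rewrite !mxE.
move: (u 0 i) (v 0 i) => a b; rewrite ler_norml.
have := ler_norm (a - b); have := ler_norm (- (a - b)); rewrite normrN.
move: (`|a - b|) => d h1 h2.
case: (lerP (-1) (Num.min 1 a)); case: (lerP (-1) (Num.min 1 b));
  case: (lerP 1 a) => ha; case: (lerP 1 b) => hb hb' ha'; apply/andP; split; lra.
Qed.

Lemma normv_attained k (u : 'rV[R]_k.+1) : exists i, `|u| = `|u 0 i|.
Proof.
have [i _ h] := @arg_maxP _ _ _ (0 : 'I_k.+1) xpredT (fun i => `|u 0 i|) isT.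
exists i; apply/le_anti; rewrite le_normv andbT; apply: normv_le => // j.
exact: h.
Qed.

Lemma clampv_far k (u : 'rV[R]_k.+1) : 1 <= `|u| -> 1 <= `|clampv u|.
Proof.
have [i ->] := normv_attained u => h; apply: le_trans (le_normv _ i); rewrite mxE.
move: (u 0 i) h => a; have [a0|a0] := lerP 0 a; [rewrite ger0_norm //|rewrite ltr0_norm //] => h.
  by rewrite (min_idPl h) [Num.max _ _](max_idPr _) ?normr1 //; lra.
rewrite [Num.min _ _](min_idPr _); last lra.
by rewrite [Num.max _ _](max_idPl _) ?normrN1 //; lra.
Qed.

(** C factors through the clamping of both arguments to unit cubes. On the compact set of pairs of
    points whose values are at least e apart, the distance of the two points has a positive lower
    bound. *)
Lemma wbounded_uniform k l q (C : 'rV[R]_k.+1 * 'rV[R]_l.+1 -> 'rV[R]_q) (e : R) :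
  continuous C ->
  (forall s s' t, 1 <= `|s| -> 1 <= `|s'| -> C (s, t) = C (s', t)) ->
  (forall s t t', 1 <= `|t| -> 1 <= `|t'| -> C (s, t) = C (s, t')) -> 0 < e ->
  exists2 d, 0 < d & forall s s' t t',
    `|s - s'| <= d -> `|t - t'| <= d -> `|C (s, t) - C (s', t')| <= e.
Proof.
move=> cC C1 C2 e0.
have CE s t : C (s, t) = C (clampv s, clampv t).
  transitivity (C (clampv s, t)).
    have [h|/ltW h] := lerP `|s| 1; first by rewrite (clampv_id h).
    by apply: C1 => //; exact: clampv_far.
  have [h|/ltW h] := lerP `|t| 1; first by rewrite (clampv_id h).
  by apply: C2 => //; exact: clampv_far.
pose n := (k.+1 + l.+1)%N.
pose g (z : 'rV[R]_(n + n)) : R :=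
  `|C (lsubmx (lsubmx z), rsubmx (lsubmx z)) - C (lsubmx (rsubmx z), rsubmx (rsubmx z))|.
have cl : continuous (fun z : 'rV[R]_(n + n) => lsubmx z) by apply: cts_lsubmx; exact: cts_id.
have cr : continuous (fun z : 'rV[R]_(n + n) => rsubmx z) by apply: cts_rsubmx; exact: cts_id.
have ca := cts_comp (cts_pair (cts_lsubmx cl) (cts_rsubmx cl)) cC.
have cb := cts_comp (cts_pair (cts_lsubmx cr) (cts_rsubmx cr)) cC.
have cg : continuous g by exact: cts_normv (cts_addv ca (cts_oppv cb)).
pose A := [set z : 'rV[R]_(n + n) | `|z| <= 1] `&` [set z | e <= g z].
have clA : closed A.
  apply: closedI.
    have cn : continuous (fun z : 'rV[R]_(n + n) => `|z|) by cts.
    by apply: (@preimage_closed _ _ (fun z : 'rV[R]_(n + n) => `|z|) [set y | y <= 1]); [move=> x _; exact: cn|exact: closed_le].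
  by apply: (@preimage_closed _ _ g [set y | e <= y]); [move=> x _; exact: cg|exact: closed_ge].
have [||z [_ gz]|c c0 hc] := @closed_bounded_ge _ A (fun z => `|lsubmx z - rsubmx z|) 1 clA.
- by move=> x [].
- exact: cts_normv (cts_addv cl (cts_oppv cr)).
- rewrite normr_gt0 subr_eq0; apply: contraTneq gz => h.
  by rewrite /= /g h subrr normr0 -ltNge.
exists (c / 2) => [|s s' t t' hs ht]; first lra.
rewrite leNgt; apply/negP => ge.
pose z : 'rV[R]_(n + n) := row_mx (row_mx (clampv s) (clampv t)) (row_mx (clampv s') (clampv t')).
have nrm a b (u : 'rV[R]_a) (v : 'rV[R]_b) (r : R) : 0 <= r -> `|u| <= r -> `|v| <= r -> `|row_mx u v| <= r.
  move=> r0 hu hv; apply: normv_le => // i.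
  by case: (split_ordP i) => j ->; rewrite ?row_mxEl ?row_mxEr; apply: le_trans (le_normv _ _) _.
have Az : A z.
  split; first by apply: (nrm _ _ _ _ 1 ler01); apply: (nrm _ _ _ _ 1 ler01); exact: norm_clampv.
  by rewrite /= /g /z !(row_mxKl, row_mxKr) -!CE ltW.
have := hc _ Az; rewrite row_mxKl row_mxKr opp_row_mx add_row_mx => h.
have : `|row_mx (clampv s - clampv s') (clampv t - clampv t')| <= c / 2.
  by apply: nrm; [lra|exact: le_trans (clampv_dist _ _) hs|exact: le_trans (clampv_dist _ _) ht].
lra.
Qed.

End UniformContinuity.

Section PiecewiseAffineScalars.
Context (R : realType) (k : nat).
Implicit Types f g : 'rV[R]_k -> R.

(** Only membership in a finite list of affine functions at each point is recorded. Closure under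
    minima and maxima then takes no subdivision of cells, and continuity is kept apart. *)
Definition pa f := exists As : seq 'cV[R]_k.+1,
  forall x, exists2 A, A \in As & f x = (consv 1 x *m A) 0 0.

Lemma pa_sel (I : eqType) (s : seq I) (g : I -> 'rV[R]_k -> R) f :
  (forall i, i \in s -> pa (g i)) -> (forall x, exists2 i, i \in s & f x = g i x) -> pa f.
Proof.
elim: s f => [|i s IH] f gs fE; first by exists [::] => x; have [] := fE x.
have [As hA] := gs i (mem_head _ _).
(* Where f agrees with [g i], its value is changed to that of another function of the list, so that
   the induction hypothesis applies to the tail. *)
pose f' x := if f x == g i x then if s is j :: _ then g j x else 0 else f x.
have [Bs hB] : exists Bs : seq 'cV[R]_k.+1, forall x, f x <> g i x ->
    exists2 A, A \in Bs & f x = (consv 1 x *m A) 0 0.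
  case: s IH gs fE @f' => [|j s] IH gs fE f'.
    by exists [::] => x; have [j] := fE x; rewrite inE => /eqP ->.
  have [|x|Bs hB] := IH f'; first by move=> l ls; apply: gs; rewrite in_cons ls orbT.
    rewrite /f'; case: eqP => fx; first by exists j; rewrite ?mem_head.
    by have [l] := fE x; rewrite in_cons => /orP[/eqP -> //|ls fl]; exists l.
  exists Bs => x fx; have [A As1] := hB x; rewrite /f'; case: eqP => // _ fA.
  by exists A.
exists (As ++ Bs) => x; have [fx|fx] := eqVneq (f x) (g i x).
  by have [A A1 e] := hA x; exists A; rewrite ?mem_cat ?A1 // fx.
by have [A A1 e] := hB x (elimN eqP fx); exists A; rewrite ?mem_cat ?A1 ?orbT.
Qed.

Lemma pa_cst (c : R) : pa (fun=> c).
Proof.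
exists [:: \col_i (if i == 0 then c else 0)] => x; eexists; first exact: mem_head.
rewrite mxE big_ord_recl consv0 [X in 1 * X]mxE eqxx mul1r big1 ?addr0 // => i _.
by rewrite [X in _ * X]mxE mulr0.
Qed.

Lemma pa_coord i : pa (fun x => x 0 i).
Proof.
exists [:: delta_mx (lift 0 i) 0] => x; eexists; first exact: mem_head.
by rewrite -colE mxE consvS.
Qed.

Lemma pa_add f g : pa f -> pa g -> pa (fun x => f x + g x).
Proof.
move=> [As hA] [Bs hB]; exists [seq A + B | A <- As, B <- Bs] => x.
have [A A1 ->] := hA x; have [B B1 ->] := hB x; exists (A + B).
  by apply/allpairsP; exists (A, B).
by rewrite mulmxDr [RHS]mxE.
Qed.

Lemma pa_scale (c : R) f : pa f -> pa (fun x => c * f x).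
Proof.
move=> [As hA]; exists [seq c *: A | A <- As] => x; have [A A1 ->] := hA x.
by exists (c *: A); [exact: map_f|rewrite -scalemxAr [RHS]mxE].
Qed.

Lemma pa_eq f g : f =1 g -> pa f -> pa g.
Proof. by move=> /funext ->. Qed.

Lemma pa_opp f : pa f -> pa (fun x => - f x).
Proof. by move=> /(pa_scale (-1)); apply: pa_eq => x; rewrite mulN1r. Qed.

Lemma pa_sub f g : pa f -> pa g -> pa (fun x => f x - g x).
Proof. by move=> pf pg; apply: pa_add => //; exact: pa_opp. Qed.

Lemma pa_or f g h : pa f -> pa g -> (forall x, h x = f x \/ h x = g x) -> pa h.
Proof.
move=> pf pg hfg; apply: (@pa_sel _ [:: true; false] (fun b => if b then f else g)).
  by move=> [].
by move=> x; case: (hfg x) => ->; [exists true|exists false].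
Qed.

Lemma pa_min f g : pa f -> pa g -> pa (fun x => Num.min (f x) (g x)).
Proof. by move=> pf pg; apply: pa_or pf pg _ => x; case: lerP; [left|right]. Qed.

Lemma pa_max f g : pa f -> pa g -> pa (fun x => Num.max (f x) (g x)).
Proof. by move=> pf pg; apply: pa_or pf pg _ => x; case: lerP; [right|left]. Qed.

Lemma pa_normv l (u : 'rV[R]_k -> 'rV[R]_l.+1) :
  (forall i, pa (fun x => u x 0 i)) -> pa (fun x => `|u x|).
Proof.
move=> pu; apply: (@pa_sel _ (enum 'I_l.+1) (fun i x => `|u x 0 i|)) => [i _|x].
  apply: pa_or (pu i) (pa_opp (pu i)) _ => x.
  by have [h|h] := lerP 0 (u x 0 i); [left; rewrite ger0_norm|right; rewrite ltr0_norm].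
by have [i e] := normv_attained (u x); exists i; rewrite ?mem_enum.
Qed.

Lemma pa_bigmin (I : Type) (s : seq I) (g : I -> 'rV[R]_k -> R) (c : R) :
  (forall i, pa (g i)) -> pa (fun x => \big[Num.min/c]_(i <- s) g i x).
Proof.
move=> pg; elim: s => [|i s IH].
  by apply: pa_eq (pa_cst c) => x; rewrite big_nil.
by apply: pa_eq (pa_min (pg i) IH) => x; rewrite big_cons.
Qed.

Lemma pa_affine_selection (F : 'rV[R]_k -> 'rV[R]_k.+1) :
  (forall j, pa (fun x => F x 0 j)) -> exists As, affine_selection F As.
Proof.
move=> /choice[L hL]; pose s := flatten [seq L j | j <- enum 'I_k.+1].
exists [seq (\matrix_(i, j) (nth 0 s (h j)) i 0) | h : {ffun 'I_k.+1 -> 'I_(size s)} <- enum {: {ffun 'I_k.+1 -> 'I_(size s)}}].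
move=> x.
have /choice[h hg] j : exists i : 'I_(size s), F x 0 j = (consv 1 x *m nth 0 s i) 0 0.
  have [A A1 e] := hL j x; have As : A \in s.
    by apply/flatten_mapP; exists j; rewrite ?mem_enum.
  have is_ : (index A s < size s)%N by rewrite index_mem.
  by exists (Ordinal is_); rewrite nth_index.
exists (\matrix_(i, j) (nth 0 s ([ffun j => h j] j)) i 0).
  by apply/mapP; exists [ffun j => h j] => //; rewrite mem_enum.
apply/rowP => j; rewrite hg [LHS]mxE [RHS]mxE.
by apply: eq_bigr => i _; rewrite [X in _ = _ * X]mxE ffunE.
Qed.

End PiecewiseAffineScalars.

(** * Piecewise affine approximation *)

Section CollapsedDistance.
Context (R : realType) (k : nat).
Implicit Types u v : 'rV[R]_k.+1.

(* A substitute for the quotient distance of the space in which the outside of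
   the ball of radius 2 is collapsed. *)
Definition cdist u v : R :=
  Num.min `|u - v| (Num.max 0 (2 - `|u|) + Num.max 0 (2 - `|v|)).

Lemma cdist_le u v : cdist u v <= `|u - v|.
Proof. by rewrite /cdist ge_min lexx. Qed.

Lemma cdist_ge0 u v : 0 <= cdist u v.
Proof. by rewrite /cdist le_min normr_ge0 /= addr_ge0 // le_max lexx. Qed.

Lemma cdist_far u u' v : 2 <= `|u| -> 2 <= `|u'| -> cdist u v = cdist u' v.
Proof.
move=> h h'; suff e w : 2 <= `|w| -> cdist w v = Num.max 0 (2 - `|v|) by rewrite !e.
move=> hw; rewrite /cdist [Num.max 0 (2 - `|w|)](max_idPl _) ?add0r; last lra.
rewrite (min_idPr _) //; have := lerB_dist w v; rewrite ge_max normr_ge0 /= => ?; lra.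
Qed.

Lemma cts_cdist (X : topologicalType) (f : X -> 'rV[R]_k.+1) v :
  continuous f -> continuous (fun x => cdist (f x) v).
Proof. by move=> cf; rewrite /cdist; cts. Qed.

Lemma cdist_close u v d : d <= 1 -> cdist u v <= d ->
  `|u - v| <= d \/ (1 <= `|u| /\ 1 <= `|v|).
Proof.
move=> d1; rewrite /cdist ge_min => /orP[|]; [by left|right].
have a0 : 0 <= Num.max 0 (2 - `|u|) by rewrite le_max lexx.
have b0 : 0 <= Num.max 0 (2 - `|v|) by rewrite le_max lexx.
have a1 : 2 - `|u| <= Num.max 0 (2 - `|u|) by rewrite le_max lexx orbT.
have b1 : 2 - `|v| <= Num.max 0 (2 - `|v|) by rewrite le_max lexx orbT.
by split; lra.
Qed.

Lemma pa_cdist n (f : 'rV[R]_n -> 'rV[R]_k.+1) v :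
  (forall i, pa (fun x => f x 0 i)) -> pa (fun x => cdist (f x) v).
Proof.
move=> pf; apply: pa_min.
  apply: pa_normv => i; apply: (@pa_eq _ _ (fun x => f x 0 i - v 0 i)) => [x|].
    by rewrite [RHS]mxE [X in _ = _ + X]mxE.
  exact: pa_sub (pf i) (pa_cst _ _).
apply: pa_add; last exact: pa_cst.
apply: pa_max; first exact: pa_cst.
by apply: pa_sub; [exact: pa_cst|exact: pa_normv].
Qed.

Lemma cdist_net (d : R) : 0 < d ->
  exists s : seq 'rV[R]_k.+1, forall u, exists2 v, v \in s & cdist u v <= d.
Proof.
(* A grid of mesh d in the cube of radius 2; all points beyond this cube are represented by
   [const_mx 2], since [cdist] does not distinguish them. *)
move=> d0; pose Q := (Num.truncn (4 / d)).+1.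
pose p (f : {ffun 'I_k.+1 -> 'I_Q}) : 'rV[R]_k.+1 := \row_i (d * (f i)%:R - 2).
exists [seq p f | f <- enum {: {ffun 'I_k.+1 -> 'I_Q}}] => u.
have near w : `|w| <= 2 -> exists2 v, v \in [seq p f | f <- enum {: {ffun 'I_k.+1 -> 'I_Q}}] &
    `|w - v| <= d.
  move=> w2; have /choice[h hP] i : exists j : 'I_Q, `|w 0 i - (d * j%:R - 2)| <= d.
    have := le_trans (le_normv w i) w2; move: (w 0 i) => a; rewrite ler_norml => /andP[h1 h2].
    have q0 : 0 <= (a + 2) / d by apply: divr_ge0; lra.
    have /andP[t1 t2] := truncn_itv q0.
    have tQ : (Num.truncn ((a + 2) / d) < Q)%N.
      rewrite /Q ltnS le_truncn //; apply: ler_wpM2r; last lra.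
      by rewrite invr_ge0 ltW.
    exists (Ordinal tQ) => /=.
    rewrite ler_pdivlMr // in t1; rewrite ltr_pdivrMr // -natr1 in t2.
    rewrite ler_norml; apply/andP; split; lra.
  exists (p [ffun i => h i]); first by apply: map_f; rewrite mem_enum.
  by apply: normv_le => [|i]; [exact: ltW|rewrite !mxE ffunE].
have [u2|/ltW u2] := lerP `|u| 2.
  by have [v vs e] := near u u2; exists v => //; apply: le_trans (cdist_le _ _) e.
have c2 : `|const_mx 2 : 'rV[R]_k.+1| = 2 by rewrite normv_const.
have [|v vs e] := near (const_mx 2); first by rewrite c2.
exists v => //; rewrite (@cdist_far _ (const_mx 2)) ?c2 //.
exact: le_trans (cdist_le _ _) e.
Qed.

End CollapsedDistance.

Section PiecewiseAffineApproximation.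
Context (R : realType) (k l : nat).
Local Notation S := 'rV[R]_k.+1.
Local Notation T := 'rV[R]_l.+1.
Local Notation n := (k.+1 + l.+1)%N.

Definition xdist (x y : S * T) : R := Num.max (cdist x.1 y.1) (cdist x.2 y.2).

Lemma xdist_net (d : R) : 0 < d ->
  exists s : seq (S * T), forall x, exists2 v, v \in s & xdist x v <= d.
Proof.
move=> d0; have [s1 h1] := cdist_net k d0; have [s2 h2] := cdist_net l d0.
exists [seq (u, v) | u <- s1, v <- s2] => -[s t].
have [u us e1] := h1 s; have [v vs e2] := h2 t; exists (u, v).
  by apply/allpairsP; exists (u, v).
by rewrite /xdist ge_max e1.
Qed.

Lemma bigmin_le_mem (I : eqType) (s : seq I) (f : I -> R) c i :
  i \in s -> \big[Num.min/c]_(i <- s) f i <= f i.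
Proof.
elim: s => // j s IH; rewrite in_cons big_cons ge_min => /orP[/eqP ->|/IH ->].
  by rewrite lexx.
by rewrite orbT.
Qed.

Lemma le_bigmin_seq (I : Type) (s : seq I) (f : I -> R) c a :
  a <= c -> (forall i, a <= f i) -> a <= \big[Num.min/c]_(i <- s) f i.
Proof.
by move=> ac af; elim: s => [|i s IH]; rewrite ?big_nil // big_cons le_min af.
Qed.

(* McShane's extension of the restriction of c to a finite net *)
Lemma pa_approx_scalar (c : S * T -> R) (e d : R) :
  0 < e -> 0 < d -> (forall x, `|c x| <= 1) ->
  (forall x y, xdist x y <= d -> `|c x - c y| <= e) ->
  exists f : S * T -> R, [/\ continuous f, forall x, `|f x - c x| <= 2 * e,
    forall s s' t, 2 <= `|s| -> 2 <= `|s'| -> f (s, t) = f (s', t),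
    forall s t t', 2 <= `|t| -> 2 <= `|t'| -> f (s, t) = f (s, t') &
    pa (fun w : 'rV[R]_n => f (lsubmx w, rsubmx w))].
Proof.
(* As c varies by at most 2, the slope 2 / d prevents net points farther than d from pulling the
   minimum below c x. The mesh d' makes the loss L d' at most e. The initial value 1 of the minimum
   is an upper bound of c. *)
move=> e0 d0 c1 cd; pose L := 2 / d; have L0 : 0 < L by apply: divr_gt0; lra.
pose d' := Num.min d (e / L).
have d'0 : 0 < d' by rewrite lt_min d0 divr_gt0.
have d'd : d' <= d by rewrite ge_min lexx.
have Ld' : L * d' <= e by rewrite -ler_pdivlMl // mulrC ge_min lexx orbT.
have [net netP] := xdist_net d'0.
pose f s (x : S * T) := \big[Num.min/1]_(v <- s) (c v + L * xdist x v).
have cf s : continuous (f s).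
  elim: s => [|v s IH].
    by apply: (@cts_eq _ _ (f [::]) (fun=> 1 : R)) => [x|]; [rewrite /f big_nil|exact: cts_cst].
  apply: (@cts_eq _ _ _ (fun x => Num.min (c v + L * xdist x v) (f s x))) => [x|].
    by rewrite /f big_cons.
  apply: cts_min => //; apply: cts_add; first exact: cts_cst.
  apply: cts_mul; first exact: cts_cst.
  by rewrite /xdist; apply: cts_max; apply: cts_cdist; cts.
exists (f net); split=> //.
- move=> x; have [v vnet xv] := netP x; have := c1 x; rewrite !ler_norml => /andP[l1 l2].
  apply/andP; split.
    suff : c x - e <= f net x by lra.
    apply: le_bigmin_seq => [|w]; first lra.
    have [xw|xw] := lerP (xdist x w) d.
      have := cd _ _ xw; rewrite ler_norml => /andP[? ?].
      have : 0 <= L * xdist x w by apply: mulr_ge0; [exact: ltW|rewrite /xdist le_max cdist_ge0].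
      lra.
    have : 2 < L * xdist x w by rewrite /L mulrAC ltr_pdivlMr // ltr_pM2l.
    have := c1 w; rewrite ler_norml => /andP[? ?]; lra.
  have := bigmin_le_mem (fun v => c v + L * xdist x v) 1 vnet; rewrite -/(f net x).
  have := cd _ _ (le_trans xv d'd); rewrite ler_norml => /andP[? ?].
  have : L * xdist x v <= L * d' by rewrite ler_pM2l.
  lra.
- move=> s s' t h h'; apply: eq_bigr => v _.
  by rewrite /xdist /= (cdist_far _ h h').
- move=> s t t' h h'; apply: eq_bigr => v _.
  by rewrite /xdist /= (cdist_far _ h h').
- apply: pa_bigmin => v; apply: pa_add; first exact: pa_cst.
  apply: pa_scale; apply: pa_max; apply: pa_cdist => i.
    apply: (@pa_eq _ _ (fun x => x 0 (lshift l.+1 i))) => [x|]; first by rewrite mxE.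
    exact: pa_coord.
  apply: (@pa_eq _ _ (fun x => x 0 (rshift k.+1 i))) => [x|]; first by rewrite mxE.
  exact: pa_coord.
Qed.

(** C is constant beyond radius 1, while [cdist] collapses only what is beyond radius 2. The margin
    ensures that two points which are close merely through infinity both have norm at least 1
    ([cdist_close]). *)
Lemma pa_approx q (C : S * T -> 'rV[R]_q) (e : R) :
  continuous C -> (forall x, `|C x| <= 1) ->
  (forall s s' t, 1 <= `|s| -> 1 <= `|s'| -> C (s, t) = C (s', t)) ->
  (forall s t t', 1 <= `|t| -> 1 <= `|t'| -> C (s, t) = C (s, t')) -> 0 < e ->
  exists F : S * T -> 'rV[R]_q, [/\ continuous F, forall x, `|F x - C x| <= e,
    forall s s' t, 2 <= `|s| -> 2 <= `|s'| -> F (s, t) = F (s', t),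
    forall s t t', 2 <= `|t| -> 2 <= `|t'| -> F (s, t) = F (s, t') &
    forall j, pa (fun w : 'rV[R]_n => F (lsubmx w, rsubmx w) 0 j)].
Proof.
move=> cC C1 Cs Ct e0; have e40 : 0 < e / 4 by lra.
have [d0 d00 dP] := wbounded_uniform cC Cs Ct e40.
pose d := Num.min 1 d0.
have dd0 : 0 < d by rewrite lt_min ltr01.
have dle : d <= d0 by rewrite ge_min lexx orbT.
have d1 : d <= 1 by rewrite ge_min lexx.
have close x y : xdist x y <= d -> `|C x - C y| <= e / 2.
  case: x y => [s t] [s' t']; rewrite /xdist ge_max /= => /andP[/(cdist_close d1) hs /(cdist_close d1) ht].
  have a1 : `|C (s, t) - C (s', t)| <= e / 4.
    case: hs => [hs|[h1 h2]]; last by rewrite (Cs s s' t h1 h2) subrr normr0 ltW.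
    by apply: dP; [exact: le_trans hs dle|rewrite subrr normr0 ltW].
  have a2 : `|C (s', t) - C (s', t')| <= e / 4.
    case: ht => [ht|[h1 h2]]; last by rewrite (Ct s' t t' h1 h2) subrr normr0 ltW.
    by apply: dP; [rewrite subrr normr0 ltW|exact: le_trans ht dle].
  by have := ler_distD (C (s', t)) (C (s, t)) (C (s', t')); lra.
have /choice[f fP] (j : 'I_q) : exists f : S * T -> R, [/\ continuous f,
    forall x, `|f x - C x 0 j| <= 2 * (e / 2),
    forall s s' t, 2 <= `|s| -> 2 <= `|s'| -> f (s, t) = f (s', t),
    forall s t t', 2 <= `|t| -> 2 <= `|t'| -> f (s, t) = f (s, t') &
    pa (fun w : 'rV[R]_n => f (lsubmx w, rsubmx w))].
  apply: (@pa_approx_scalar _ _ d) => // [|x|x y /close h]; first lra.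
    exact: le_trans (le_normv _ _) (C1 x).
  by apply: le_trans h; have := le_normv (C x - C y) j; rewrite !mxE.
exists (fun x => \row_j f j x); split.
- by apply: cts_row => j; have [] := fP j.
- move=> x; apply: normv_le => [|j]; first exact: ltW.
  by rewrite !mxE; have [_ h _ _ _] := fP j; have := h x; lra.
- by move=> s s' t h h'; apply/rowP => j; rewrite !mxE; have [_ _ g _ _] := fP j; exact: g.
- by move=> s t t' h h'; apply/rowP => j; rewrite !mxE; have [_ _ _ g _] := fP j; exact: g.
- by move=> j; have [_ _ _ _] := fP j; apply: pa_eq => w; rewrite mxE.
Qed.

End PiecewiseAffineApproximation.

(** * Degree *)

Section Localization.
Context (R : realType) (m : nat) (Y : ptopologicalType).
Local Notation S := 'rV[R]_m.+1.
Local Notation T := 'rV[R]_m.+2.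
Local Notation N := (m.+1 + m.+2)%N.
Local Notation ax := (ax R m).
Implicit Types (f g P : S * T -> Y) (x : S * T).

Definition xrow x : 'rV[R]_N := row_mx x.1 x.2.

Lemma cts_xrow (X : topologicalType) (h : X -> S * T) :
  continuous h -> continuous (fun y => xrow (h y)).
Proof. by move=> ch; rewrite /xrow; cts. Qed.

Lemma bounded_xrow r f : (forall x, r <= `|xrow x| -> f x = point) -> bounded_by r f.
Proof.
move=> h; split=> [s t ht|s s' t hs hs'].
  by apply: h; apply: le_trans ht (norm_row_mxr _ _).
by rewrite !h //; [exact: le_trans hs' (norm_row_mxl _ _)|exact: le_trans hs (norm_row_mxl _ _)].
Qed.

(* The wall l = tau is turned into t_0 = 0 while f and g are moved apart along t_0. *)
Lemma acls_cut (l : S * T -> R) (c r tau : R) f g :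
  continuous l -> 1 <= c -> (forall s t d, l (s, t + d *: ax) = l (s, t) + c * d) ->
  continuous f -> continuous g -> 0 <= r ->
  (forall x, r <= `|xrow x| -> f x = point) -> (forall x, r <= `|xrow x| -> g x = point) ->
  (forall x, l x <= tau -> f x = point) -> (forall x, tau <= l x -> g x = point) ->
  acls (fun x => if 0 <= l x - tau then f x else g x) = acls f + acls g.
Proof.
move=> cl c1 lE cf cg r0 ff fg lf lg.
have bf := bounded_xrow ff; have bg := bounded_xrow fg.
rewrite -(@acls_add _ _ _ r r) //; last 2 first.
- by split=> //; exists r.
- by split=> //; exists r.
(* On the wall k = 0 the shifted f is trivial: either the shift brings l down to tau, or it brings
   t_0 down to -r. The slope c >= 1 excludes a third case. The argument for g is symmetric. *)
pose k (ax : R * (S * T)) := (1 - clamp ax.1) * (l ax.2 - tau) + clamp ax.1 * ax.2.2 0 0.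
apply: acls_homot; apply: (@ahomot_itv _ _ _ _ _ (fun z : R * (S * T) =>
  if 0 <= k z then f (z.2.1, z.2.2 - (clamp z.1 * r) *: ax)
  else g (z.2.1, z.2.2 + (clamp z.1 * r) *: ax)) (r + r)).
- apply: cts_paste; [by rewrite /k; cts|by cts|by cts|].
  move=> [b [s t]]; rewrite /k /=; have /andP[a0 a1] := clamp_itv b.
  move: (clamp b) a0 a1 => a a0 a1 k0.
  have lE1 : l (s, t - (a * r) *: ax) = l (s, t) - c * (a * r).
    by rewrite -scaleNr lE mulrN.
  have t1 : (t - (a * r) *: ax) 0 0 = t 0 0 - a * r.
    by rewrite [LHS]mxE [X in _ + X]mxE [X in - X]mxE ax0 mulr1.
  have t2 : (t + (a * r) *: ax) 0 0 = t 0 0 + a * r.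
    by rewrite [LHS]mxE [X in _ + X]mxE ax0 mulr1.
  have nf (u : T) : r <= `|u 0 0| -> r <= `|xrow (s, u)|.
    by move=> h; apply: le_trans h (le_trans (le_normv _ _) (norm_row_mxr _ _)).
  have ar : 0 <= a * r by exact: mulr_ge0.
  have car : a * r <= c * (a * r) by rewrite ler_peMl.
  have ta : (1 - a) * (a * r) <= (1 - a) * (c * (a * r)) by apply: ler_wpM2l => //; lra.
  rewrite [LHS](_ : _ = point); last first.
    have [h|h] := lerP (l (s, t) - c * (a * r)) tau; first by apply: lf; rewrite lE1.
    have [h'|h'] := lerP (t 0 0 - a * r) (- r).
      by apply: ff; apply: nf; rewrite t1 ler0_norm; lra.
    exfalso; have [a1'|a1'] := ltrP a 1.
      have : (1 - a) * (c * (a * r)) < (1 - a) * (l (s, t) - tau) by rewrite ltr_pM2l; lra.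
      have : a * (a * r - r) <= a * t 0 0 by apply: ler_wpM2l => //; lra.
      by nra.
    have e : a = 1 by lra.
    by move: k0 h'; rewrite e !mul1r; lra.
  rewrite [RHS](_ : _ = point) //.
  have [h|h] := lerP tau (l (s, t) + c * (a * r)); first by apply: lg; rewrite lE.
  have [h'|h'] := lerP r (t 0 0 + a * r).
    by apply: fg; apply: nf; rewrite t2 ger0_norm; lra.
  exfalso; have [a1'|a1'] := ltrP a 1.
    have : (1 - a) * (l (s, t) - tau) < (1 - a) * (- (c * (a * r))) by rewrite ltr_pM2l; lra.
    have : a * t 0 0 <= a * (r - a * r) by apply: ler_wpM2l => //; lra.
    by nra.
  have e : a = 1 by lra.
  by move: k0 h'; rewrite e !mul1r; lra.
- move=> b _; have /andP[] := clamp_itv b; rewrite /k /=; move: (clamp b) => a a0 a1.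
  have ar : 0 <= a * r by exact: mulr_ge0.
  have ar1 : a * r <= r by rewrite ler_piMl.
  split=> [s t h|s s' t h h'] /=.
    rewrite bf.1; last by apply: shift_far; rewrite ger0_norm //; lra.
    rewrite bg.1 ?if_same // -[X in _ + X]opprK -scaleNr; apply: shift_far.
    by rewrite normrN ger0_norm //; lra.
  have far (u : S) (v : T) : r + r <= `|u| -> r <= `|xrow (u, v)|.
    by move=> hu; apply: le_trans (norm_row_mxl _ _); rewrite /=; lra.
  by rewrite !ff ?fg ?if_same //; exact: far.
- by move=> x; rewrite /k clamp_id ?lexx ?ler01 // subr0 !mul1r !mul0r !scale0r addr0 subr0 -surjective_pairing; rewrite addr0; case: x.
- by move=> x; rewrite /k /= clamp_id ?lexx ?ler01 // subrr !mul1r !mul0r add0r.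
Qed.

Definition restrict (P : S * T -> Y) (d : R) (z : 'rV[R]_N) x : Y :=
  if `|xrow x - z| - d <= 0 then P x else point.

(** Induction on the zeros in decreasing order of l: a wall l = tau cuts off the ball around the
    highest one, and [acls_cut] turns the cut into a sum. Q stands for a property that is stable
    under sums. *)
Lemma acls_localize (l : 'rV[R]_N -> R) (c d L r : R) (Q : aclasses R m Y -> Prop) :
  continuous (fun x => l (xrow x)) -> 1 <= c ->
  (forall s t d, l (xrow (s, t + d *: ax)) = l (xrow (s, t)) + c * d) ->
  0 < L -> (forall u v, `|l u - l v| <= L * `|u - v|) -> 0 < d ->
  Q 0 -> (forall a b, Q a -> Q b -> Q (a + b)) ->
  forall (Z : seq 'rV[R]_N) P,
  uniq Z -> (forall z, z \in Z -> `|z| + d <= r) ->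
  (forall z z', z \in Z -> z' \in Z -> z != z' -> 2 * L * d < `|l z - l z'|) ->
  continuous P -> (forall x, (forall z, z \in Z -> d <= `|xrow x - z|) -> P x = point) ->
  (forall z, z \in Z -> Q (acls (restrict P d z))) -> Q (acls P).
Proof.
move=> cl c1 lE L0 lL d0 Q0 QD Z.
have near u v : `|u - v| <= d -> l u <= l v + L * d /\ l v - L * d <= l u.
  move=> h; have := lL u v; have : L * `|u - v| <= L * d by rewrite ler_pM2l.
  by rewrite ler_norml => ? /andP[? ?]; split; lra.
have near' u v : `|u - v| < d -> l u < l v + L * d /\ l v - L * d < l u.
  move=> h; have := lL u v; have : L * `|u - v| < L * d by rewrite ltr_pM2l.
  by rewrite ler_norml => ? /andP[? ?]; split; lra.
suff main : forall (Z : seq 'rV[R]_N) P, path.sorted (fun u v => l v <= l u) Z ->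
    uniq Z -> (forall z, z \in Z -> `|z| + d <= r) ->
    (forall z z', z \in Z -> z' \in Z -> z != z' -> 2 * L * d < `|l z - l z'|) ->
    continuous P -> (forall x, (forall z, z \in Z -> d <= `|xrow x - z|) -> P x = point) ->
    (forall z, z \in Z -> Q (acls (restrict P d z))) -> Q (acls P).
  move=> P uZ hr hg cP sP hQ.
  pose Z' := sort (fun u v => l v <= l u) Z.
  have mZ z : (z \in Z') = (z \in Z) by rewrite mem_sort.
  apply: (main Z' P) => //.
  - by apply: sort_sorted => u v; exact: le_total.
  - by rewrite sort_uniq.
  - by move=> z; rewrite mZ; exact: hr.
  - by move=> z z'; rewrite !mZ; exact: hg.
  - by move=> x h; apply: sP => z; rewrite -mZ; exact: h.
  - by move=> z; rewrite mZ; exact: hQ.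
move=> {}Z; elim: Z => [|z Z IH] P sZ uZ hr hg cP sP hQ.
  by rewrite (acls_eq (g := fun=> point)) // => x; exact: sP.
have zmax z' : z' \in Z -> l z' + 2 * L * d < l z.
  move=> z'Z; have le_ : l z' <= l z.
    have tr : transitive (fun u v : 'rV[R]_N => l v <= l u).
      by move=> u v w /= h1 h2; exact: le_trans h2 h1.
    by have /allP/(_ _ z'Z) := order_path_min tr sZ.
  have zz' : z != z' by apply: contraTneq uZ => ->; rewrite /= z'Z.
  have := hg z z' (mem_head _ _) (mem_behead (s := z :: Z) z'Z) zz'.
  by rewrite ger0_norm; lra.
(* The lower edge of the slab |l - l z| <= L d, which contains the ball of radius d about z; all the
   other balls lie below it. *)
pose tau := l z - L * d.
pose g x := if 0 <= l (xrow x) - tau then point else P x.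
have Ppt x : d <= `|xrow x - z| -> tau <= l (xrow x) -> P x = point.
  move=> h1 h2; apply: sP => z'; rewrite in_cons => /orP[/eqP ->//|z'Z].
  rewrite leNgt; apply/negP => /near'[h _]; have := zmax _ z'Z; rewrite /tau in h2; lra.
have Ptau x : l (xrow x) = tau -> P x = point.
  move=> h; apply: Ppt; rewrite ?h // leNgt; apply/negP => /near'[_].
  by rewrite h /tau ltxx.
have cg : continuous g.
  by apply: cts_paste => //; [cts|exact: cts_cst|move=> x /subr0_eq h; rewrite Ptau].
have cf : continuous (restrict P d z).
  apply: cts_if => //; [|exact: cts_cst|].
    by apply: cts_sub; [apply: cts_normv; apply: cts_addv; [apply: cts_xrow; exact: cts_id|exact: cts_cst]|exact: cts_cst].
  move=> x /subr0_eq h; have hd : `|xrow x - z| <= d by rewrite h.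
  have [_ h2] := near _ _ hd.
  by apply: Ppt => //; rewrite h.
have PE x : P x = if 0 <= l (xrow x) - tau then restrict P d z x else g x.
  rewrite /g /restrict !subr_ge0 subr_le0; case: (lerP tau) => // h.
  by case: lerP => // h'; apply: Ppt => //; exact: ltW.
have Pr x : r <= `|xrow x| -> P x = point.
  move=> h; apply: sP => z' z'Z; have := hr _ z'Z; have := lerB_dist (xrow x) z'; lra.
rewrite (acls_eq PE) (@acls_cut (fun x => l (xrow x)) c r tau) //; last 5 first.
- by apply: le_trans (hr _ (mem_head _ _)); rewrite addr_ge0 // ltW.
- by move=> x h; rewrite /restrict; case: ifP => // _; exact: Pr.
- by move=> x h; rewrite /g; case: ifP => // _; exact: Pr.
- move=> x h; rewrite /restrict subr_le0; case: ifP => // h'.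
  have [_ h2] := near _ _ h'; apply: Ptau; apply/le_anti; rewrite h /=; exact: h2.
- by move=> x h; rewrite /g subr_ge0 h.
apply: QD; first exact: hQ (mem_head _ _).
apply: IH => //.
- exact: path_sorted sZ.
- by case/andP: uZ.
- by move=> z' z'Z; apply: hr; rewrite in_cons z'Z orbT.
- by move=> u v uZ' vZ'; apply: hg; rewrite in_cons ?uZ' ?vZ' orbT.
- move=> x h; rewrite /g subr_ge0; case: ifP => // h'; apply: sP => z'.
  rewrite in_cons => /orP[/eqP ->|]; last exact: h.
  rewrite leNgt; apply/negP => /near'[_]; rewrite -/tau => h2.
  by move: h'; rewrite (ltW h2).
- move=> z' z'Z; have := hQ z' (mem_behead (s := z :: Z) z'Z).
  congr (Q _); apply: acls_eq => x; rewrite /restrict subr_le0; case: ifP => // h.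
  rewrite /g subr_ge0 ifF //; apply/negbTE; rewrite -ltNge.
  by have [h1 _] := near _ _ h; have := zmax _ z'Z; rewrite /tau; lra.
Qed.

End Localization.

Section SeparatingFunctional.
Context (R : realType) (m : nat).
Local Notation S := 'rV[R]_m.+1.
Local Notation T := 'rV[R]_m.+2.
Local Notation N := (m.+1 + m.+2)%N.
Local Notation ax := (ax R m).
Local Notation o := (rshift m.+1 0 : 'I_N).

(** A moment functional, with 1 added to the coefficient at [o] so that the slope along [ax] is at
    least 1, as [acls_cut] requires. *)
Definition ell (k : nat) (w : 'rV[R]_N) : R := w 0 o + \sum_(i < N) k%:R ^+ i.+1 * w 0 i.

Lemma ellB k u v : ell k (u - v) = ell k u - ell k v.
Proof.
rewrite /ell [(u - v) 0 o]mxE [(- v) 0 o]mxE.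
under eq_bigr do rewrite mxE [(- v) 0 _]mxE mulrBr.
by rewrite sumrB; ring.
Qed.

Lemma ell_le k u v : `|ell k u - ell k v| <= (1 + \sum_(i < N) k%:R ^+ i.+1) * `|u - v|.
Proof.
rewrite -ellB; apply: le_trans (ler_normD _ _) _; rewrite mulrDl mul1r.
apply: lerD; first exact: le_normv.
apply: le_trans (ler_norm_sum _ _ _) _; rewrite mulr_suml; apply: ler_sum => i _.
by rewrite normrM ger0_norm ?exprn_ge0 // ler_wpM2l ?exprn_ge0 // le_normv.
Qed.

Lemma cts_ell k (X : topologicalType) (f : X -> 'rV[R]_N) :
  continuous f -> continuous (fun x => ell k (f x)).
Proof.
move=> cf; apply: cts_add; first exact: cts_coord.
by apply: cts_sum => i; apply: cts_mul; [exact: cts_cst|exact: cts_coord].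
Qed.

Lemma ell_shift k (s : S) (t : T) d :
  ell k (xrow (s, t + d *: ax)) = ell k (xrow (s, t)) + (1 + k%:R ^+ (m.+1).+1) * d.
Proof.
suff : ell k (xrow (s, t + d *: ax) - xrow (s, t)) = (1 + k%:R ^+ (m.+1).+1) * d.
  by rewrite ellB; lra.
rewrite /xrow opp_row_mx add_row_mx subrr [t + _]addrC addrK.
have cE i : row_mx 0 (d *: ax) 0 i = d * (i == o :> 'I_N)%:R.
  case: (split_ordP i) => j ->; first by rewrite row_mxEl mxE eq_lrshift mulr0.
  by rewrite row_mxEr !mxE eqxx eq_rshift.
rewrite /ell cE eqxx mulr1 (bigD1 o) //= big1 => [|i io].
  by rewrite cE eqxx addr0 mulr1 addn0; ring.
by rewrite cE (negbTE io) !mulr0.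
Qed.

Lemma ell_separates (Z : seq 'rV[R]_N) :
  exists k, forall u v, u \in Z -> v \in Z -> u != v -> ell k u != ell k v.
Proof.
(* Repeating the coordinate w_o in front turns [ell k] into a pairing with a point of the moment
   curve in dimension N + 1. *)
pose ext (w : 'rV[R]_N) : 'cV[R]_N.+1 := (consv (w 0 o) w)^T.
have extE k w : (moment R N.+1 k *m ext w) 0 0 = ell k w.
  rewrite mxE big_ord_recl mxE expr0 mul1r [X in X + _]mxE consv0; congr (_ + _).
  by apply: eq_bigr => i _; rewrite mxE [X in _ * X]mxE consvS lift0.
have [|k hk] := @moment_avoid _ _ [seq ext (u - v) | u <- Z, v <- [seq v <- Z | u != v]].
  move=> y /allpairsPdep[u [v [uZ]]]; rewrite mem_filter => /andP[uv _] ->.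
  apply: contraNneq uv => e; rewrite -subr_eq0; apply/eqP/rowP => i.
  by move/colP/(_ (lift 0 i)): e; rewrite mxE consvS => ->; rewrite !mxE.
exists k => u v uZ vZ uv; apply: contraTneq (hk (ext (u - v)) _) => [e|]; last first.
  by apply/allpairsPdep; exists u, v; rewrite mem_filter uv.
by rewrite negbK; apply/eqP/rowP => i; rewrite (ord1 i) extE ellB e subrr mxE.
Qed.

End SeparatingFunctional.

Section RegularZero.
Context (R : realType) (m : nat).
Local Notation S := 'rV[R]_m.+1.
Local Notation T := 'rV[R]_m.+2.
Local Notation N := (m.+1 + m.+2)%N.

Definition ball_multiple (a : aclasses R m (sphere R N)) :=
  exists k : int, a = acls (@ball1 R m) *~ k.

Lemma ball_multiple0 : ball_multiple 0.
Proof. by exists 0. Qed.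

Lemma ball_multipleD a b : ball_multiple a -> ball_multiple b -> ball_multiple (a + b).
Proof. by move=> [k ->] [l ->]; exists (k + l); rewrite mulrzDr. Qed.

(** If b z < 0, the zero lies over the opposite direction and contributes nothing. Otherwise b is
    deformed to its upper bound 2, which leaves the linear chart M / (2 e). The scale factor never
    drops below 1 / (2 e), so the hypothesis on [h *m M] keeps the support within distance d of
    z. *)
Lemma regular_zero_class (w : 'rV[R]_N -> 'rV[R]_N) (b : 'rV[R]_N -> R)
    (M : 'M[R]_N) z d e :
  0 < e -> 0 < d -> continuous b -> M \in unitmx ->
  (forall y, `|y - z| <= d -> w y = (y - z) *m M) ->
  (forall h : 'rV[R]_N, d <= `|h| -> 2 * e <= `|h *m M|) ->
  (forall y, b y <= 2) -> b z != 0 ->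
  (forall y, `|y - z| <= d -> `|b y - b z| <= `|b z| / 2) ->
  ball_multiple (acls (restrict (fun x : S * T => Kf e (w (xrow x)) (b (xrow x))) d z)).
Proof.
move=> e0 d0 cb uM wE wM b2 bz0 bz; pose c := b z / 2.
have [bn|bp] := ltrP (b z) 0.
  exists 0; rewrite mulr0z -acls_point; apply: acls_eq => x; rewrite /restrict subr_le0.
  case: ifP => // /bz; rewrite (ltr0_norm bn) ler_norml => /andP[h1 h2].
  by apply: Kf_pt => //; [lra|right; apply/eqP; lra].
have {}bp : 0 < b z by rewrite lt_neqAle eq_sym bz0.
have c0 : 0 < c by rewrite divr_gt0.
have c2 : c <= 2 by have := b2 z; rewrite /c; lra.
(* The maximum with c keeps the factor positive far from z, where b is not controlled; near z it
   equals b. *)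
pose h (x : S * T) : R := (e * Num.max (b (xrow x)) c)^-1.
have hpos x : 0 < e * Num.max (b (xrow x)) c by rewrite mulr_gt0 // lt_max c0 orbT.
have hge x : (2 * e)^-1 <= h x.
  rewrite /h lef_pV2 ?posrE // ?mulr_gt0 // mulrC ler_pM2r // ge_max b2 //.
have e2 : 0 < 2 * e by rewrite mulr_gt0.
have ch : continuous h.
  apply: cts_inv => [x|]; first by rewrite gt_eqF.
  apply: cts_mul; first exact: cts_cst.
  apply: cts_max; last exact: cts_cst.
  by apply: (@cts_comp _ _ _ (@xrow R m) b) => //; apply: cts_xrow; exact: cts_id.
have far (r : R) x : (2 * e)^-1 <= r -> d <= `|xrow x - z| ->
    collapse (r *: ((xrow x - z) *m M)) = point.
  move=> hr /wM hM; apply: collapse_far; rewrite normrZ ger0_norm; last first.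
    by apply: le_trans hr; rewrite invr_ge0 ltW.
  have h1 : (2 * e)^-1 * (2 * e) <= r * `|(xrow x - z) *m M|.
    by apply: ler_pM => //; rewrite ?invr_ge0 ltW.
  by apply: le_trans h1; rewrite mulVf ?gt_eqF.
rewrite (acls_eq (g := fun x => collapse (h x *: ((xrow x - z) *m M)))) => [|x]; last first.
  rewrite /restrict subr_le0; case: ifP => hd; last first.
    by rewrite far //; apply: ltW; rewrite ltNge hd.
  have := bz _ hd; rewrite (ger0_norm (ltW bp)) ler_norml => /andP[h1 h2].
  have bc : c <= b (xrow x) by rewrite /c; lra.
  rewrite KfE //; last by lra.
  by rewrite wE // /h (max_idPl bc).
suff -> : acls (fun x => collapse (h x *: ((xrow x - z) *m M))) =
    acls (chart (((2 * e)^-1 *: M) : 'M[R]_N) z).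
  have uM' : (2 * e)^-1 *: M \in unitmx by rewrite unitmxZ // unitfE invr_eq0 gt_eqF.
  by have [->|->] := chart_class z uM'; [exists 1|exists (-1); rewrite mulrNz].
have cM (X : topologicalType) (f : X -> S * T) : continuous f ->
    continuous (fun y => (xrow (f y) - z) *m M).
  move=> cf; apply: cts_mulmx => [|i j]; last exact: cts_cst.
  by apply: cts_addv; [exact: cts_xrow|exact: cts_cst].
apply: acls_homot; apply: (@ahomot_itv _ _ _ _ _ (fun ax : R * (S * T) =>
  collapse (((1 - ax.1) * h ax.2 + ax.1 * (2 * e)^-1) *: ((xrow ax.2 - z) *m M))) (d + `|z|)).
- apply: cts_collapse; apply: cts_scalev; last by apply: cM; exact: cts_snd.
  by cts.
- move=> a /andP[a0 a1]; apply: bounded_xrow => x hx /=; apply: far.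
    have := hge x; move: (h x) ((2 * e)^-1) => u v uv.
    have : (1 - a) * v <= (1 - a) * u by apply: ler_wpM2l => //; lra.
    by lra.
  by have := lerB_dist (xrow x) z; lra.
- by move=> x /=; rewrite subr0 mul1r mul0r addr0.
- by move=> x /=; rewrite subrr mul1r mul0r add0r /chart -scalemxAr.
Qed.

End RegularZero.

Section RegularApproximation.
Context (R : realType) (m : nat).
Local Notation S := 'rV[R]_m.+1.
Local Notation T := 'rV[R]_m.+2.
Local Notation N := (m.+1 + m.+2)%N.

Lemma small_seq (I : eqType) (s : seq I) (P : I -> R -> Prop) :
  (forall i, i \in s -> exists2 d0, 0 < d0 & forall d, 0 < d <= d0 -> P i d) ->
  exists2 d0, 0 < d0 & forall i, i \in s -> forall d, 0 < d <= d0 -> P i d.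
Proof.
elim: s => [|i s IH] h; first by exists 1.
have [d1 d10 h1] := h i (mem_head _ _).
have [|d2 d20 h2] := IH; first by move=> j js; apply: h; rewrite in_cons js orbT.
exists (Num.min d1 d2) => [|j]; first by rewrite lt_min d10.
rewrite in_cons => /orP[/eqP ->|js] d /andP[d0]; rewrite le_min => /andP[l1 l2].
  by apply: h1; rewrite d0.
by apply: h2; rewrite ?d0.
Qed.

Lemma near_radius k (z : 'rV[R]_k) (P : 'rV[R]_k -> Prop) :
  (\forall y \near z, P y) ->
  exists2 d0, 0 < d0 & forall d, 0 < d <= d0 -> forall y, `|y - z| <= d -> P y.
Proof.
move=> /nbhs_normP[d /= d0 h]; exists (d / 2); first by rewrite divr_gt0.
move=> d' /andP[d'0 d'd] y hy; apply: h => /=; rewrite distrC.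
by apply: le_lt_trans hy _; lra.
Qed.

Lemma norm_lsubmx k l (w : 'rV[R]_(k + l)) : `|lsubmx w| <= `|w|.
Proof. by apply: normv_le => // i; rewrite mxE le_normv. Qed.

Lemma norm_rsubmx k l (w : 'rV[R]_(k + l)) : `|rsubmx w| <= `|w|.
Proof. by apply: normv_le => // i; rewrite mxE le_normv. Qed.

Definition clamp2 k (u : 'rV[R]_k) : 'rV[R]_k := 2 *: clampv (2^-1 *: u).

Lemma norm_clamp2 k (u : 'rV[R]_k) : `|clamp2 u| <= 2.
Proof. by rewrite normrZ ger0_norm //; have := norm_clampv (2^-1 *: u); lra. Qed.

Lemma clamp2_id k (u : 'rV[R]_k) : `|u| <= 2 -> clamp2 u = u.
Proof.
move=> h; rewrite /clamp2 clampv_id ?scalerA ?mulfV ?scale1r ?pnatr_eq0 //.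
by rewrite normrZ ger0_norm ?invr_ge0 //; lra.
Qed.

Lemma clamp2_far k (u : 'rV[R]_k.+1) : 2 <= `|u| -> 2 <= `|clamp2 u|.
Proof.
move=> h; have : 1 <= `|clampv (2^-1 *: u)|.
  by apply: clampv_far; rewrite normrZ ger0_norm ?invr_ge0 //; lra.
by rewrite /clamp2 normrZ [`|2|]ger0_norm //; lra.
Qed.

Context (F : S * T -> 'rV[R]_N.+1)
  (cF : continuous F) (F0 : forall x, F x != 0) (F2 : forall x, - 2 <= F x 0 0)
  (Fs : forall s s' t, 2 <= `|s| -> 2 <= `|s'| -> F (s, t) = F (s', t))
  (Ft : forall s t t', 2 <= `|t| -> 2 <= `|t'| -> F (s, t) = F (s, t'))
  (pF : forall j, pa (fun w : 'rV[R]_N => F (lsubmx w, rsubmx w) 0 j)).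

Let G (w : 'rV[R]_N) := F (lsubmx w, rsubmx w).

Let cG : continuous G.
Proof.
have cl : continuous (fun z : 'rV[R]_N => lsubmx z) by apply: cts_lsubmx; exact: cts_id.
have cr : continuous (fun z : 'rV[R]_N => rsubmx z) by apply: cts_rsubmx; exact: cts_id.
by rewrite /G; cts.
Qed.

Let GE x : F x = G (xrow x).
Proof. by case: x => s t; rewrite /G /xrow row_mxKl row_mxKr. Qed.

Let G_clamp w : G w = G (row_mx (clamp2 (lsubmx w)) (clamp2 (rsubmx w))).
Proof.
rewrite /G row_mxKl row_mxKr; move: (lsubmx w) (rsubmx w) => s t.
transitivity (F (clamp2 s, t)).
  have [h|/ltW h] := lerP `|s| 2; first by rewrite (clamp2_id h).
  by apply: Fs => //; exact: clamp2_far.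
have [h|/ltW h] := lerP `|t| 2; first by rewrite (clamp2_id h).
by apply: Ft => //; exact: clamp2_far.
Qed.

(* Otherwise F is constant on a segment from z, and z is not an isolated zero. *)
Let zero_bounded (w : 'rV[R]_N.+1 -> 'rV[R]_N) (M : 'M[R]_N) (z : 'rV[R]_N) : M \in unitmx ->
  (\forall y \near z, w (G y) = (y - z) *m M) -> `|lsubmx z| < 2 /\ `|rsubmx z| < 2.
Proof.
move=> uM /near_radius[d d0 /(_ d)]; rewrite d0 lexx => /(_ isT) h.
have inj y : `|y - z| <= d -> G y = G z -> y = z.
  move=> hy Gy; have := h y hy; have : `|z - z| <= d by rewrite subrr normr0 ltW.
  move=> /h; rewrite subrr mul0mx Gy => -> /esym/(congr1 (mulmx^~ (invmx M))).
  by rewrite mul0mx mulmxK // => /eqP; rewrite subr_eq0 => /eqP.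
pose r := d / (1 + `|z|); have z0 : 0 < 1 + `|z| by have := normr_ge0 z; lra.
have r0 : 0 < r by rewrite divr_gt0.
have rz k (u : 'rV[R]_k) : `|u| <= `|z| -> `|r *: u| <= d.
  move=> hu; rewrite normrZ gtr0_norm // /r -mulrA ler_piMr ?(ltW d0) //.
  by rewrite mulrC ler_pdivrMr // mul1r; lra.
have nz k (u : 'rV[R]_k) : 2 <= `|u| -> r *: u <> 0.
  move=> hu /eqP; rewrite scaler_eq0 gt_eqF //= => /eqP u0.
  by move: hu; rewrite u0 normr0; lra.
have big k (u : 'rV[R]_k) : 2 <= `|u| -> 2 <= `|u + r *: u|.
  move=> hu; rewrite -{1}[u]scale1r -scalerDl normrZ gtr0_norm; last lra.
  by rewrite mulrDl mul1r; have := mulr_ge0 (ltW r0) (normr_ge0 u); lra.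
split; rewrite ltNge; apply/negP => hz.
  have := inj (z + row_mx (r *: lsubmx z) 0); rewrite addrAC subrr add0r => e.
  have : z + row_mx (r *: lsubmx z) 0 = z.
    apply: e.
      apply: normv_le; first exact: ltW.
      move=> i; case: (split_ordP i) => j ->; rewrite ?row_mxEl ?row_mxEr ?mxE ?normr0 ?(ltW d0) //.
      by apply: le_trans (rz _ _ (norm_lsubmx z)); have := le_normv (r *: lsubmx z) j; rewrite !mxE.
    rewrite /G !linearD /= row_mxKl row_mxKr addr0.
    by apply: Fs => //; exact: big.
  move/(congr1 lsubmx); rewrite linearD /= row_mxKl => /eqP.
  by rewrite -subr_eq0 addrAC subrr add0r => /eqP; exact: nz.
have := inj (z + row_mx 0 (r *: rsubmx z)); rewrite addrAC subrr add0r => e.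
have : z + row_mx 0 (r *: rsubmx z) = z.
  apply: e.
    apply: normv_le; first exact: ltW.
    move=> i; case: (split_ordP i) => j ->; rewrite ?row_mxEl ?row_mxEr ?mxE ?normr0 ?(ltW d0) //.
    by apply: le_trans (rz _ _ (norm_rsubmx z)); have := le_normv (r *: rsubmx z) j; rewrite !mxE.
  rewrite /G !linearD /= row_mxKl row_mxKr addr0.
  by apply: Ft => //; exact: big.
move/(congr1 rsubmx); rewrite linearD /= row_mxKr => /eqP.
by rewrite -subr_eq0 addrAC subrr add0r => /eqP; exact: nz.
Qed.

Lemma regular_value_class : exists (a : 'rV[R]_N) (e : R),
  [/\ 0 < e, is_amap (fun x => Kv e a (F x)) & ball_multiple (acls (fun x => Kv e a (F x)))].
Proof.
have [As sel] := pa_affine_selection pF.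
have G0 w : G w != 0 by exact: F0.
have [a [Z0 [Z0E Z0M]]] := affine_selection_zeros cG sel G0.
pose Z := undup Z0; pose w y := wv a (G y); pose b y := - G y 0 0.
have ZE y : w y = 0 <-> y \in Z by rewrite mem_undup; exact: Z0E.
have ZM z : z \in Z -> exists2 M, M \in unitmx & \forall y \near z, w y = (y - z) *m M.
  by rewrite mem_undup; exact: Z0M.
have cb : continuous b by rewrite /b; cts.
have cw : continuous w.
  by rewrite /w /wv; apply: cts_addv; [exact: cts_tlv|cts].
have b2 y : b y <= 2 by rewrite /b; have := F2 (lsubmx y, rsubmx y); rewrite -/(G y); lra.
have wb y : w y != 0 \/ b y != 0 by exact: Kv_neq0.
have [k kP] := ell_separates Z.
pose L := 1 + \sum_(i < N) (k%:R : R) ^+ i.+1.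
have L0 : 0 < L by rewrite ltr_pwDl // sumr_ge0 // => i _; rewrite exprn_ge0.
have [d d0 dP] : exists2 d, 0 < d & forall z, z \in Z ->
    [/\ `|lsubmx z| + d <= 2 /\ `|rsubmx z| + d <= 2,
      exists2 M, M \in unitmx & forall y, `|y - z| <= d -> w y = (y - z) *m M,
      b z != 0 /\ forall y, `|y - z| <= d -> `|b y - b z| <= `|b z| / 2 &
      forall z', z' \in Z -> z != z' -> 2 * L * d < `|ell k z - ell k z'|].
  suff [d d0 h] : exists2 d0, 0 < d0 & forall z, z \in Z -> forall d, 0 < d <= d0 ->
    [/\ `|lsubmx z| + d <= 2 /\ `|rsubmx z| + d <= 2,
      exists2 M, M \in unitmx & forall y, `|y - z| <= d -> w y = (y - z) *m M,
      b z != 0 /\ forall y, `|y - z| <= d -> `|b y - b z| <= `|b z| / 2 &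
      forall z', z' \in Z -> z != z' -> 2 * L * d < `|ell k z - ell k z'|].
    by exists d => // z zZ; apply: h => //; rewrite d0 lexx.
  apply: small_seq => z zZ; have [M uM nM] := ZM z zZ.
  have [zl zr] := zero_bounded uM nM.
  have [d1 d10 h1] := near_radius nM.
  have bz : b z != 0 by have [|//] := wb z; rewrite ((ZE z).2 zZ) eqxx.
  have cbz : continuous (fun y => `|b y - b z|) by cts.
  have /near_radius[d2 d20 h2] : \forall y \near z, `|b y - b z| < `|b z| / 2.
    apply: (cbz z _ (lt_nbhsl _)); rewrite subrr normr0 divr_gt0 // normr_gt0 //.
  have [d3 d30 h3] : exists2 d0, 0 < d0 & forall z', z' \in Z -> forall d, 0 < d <= d0 ->
      z != z' -> 2 * L * d < `|ell k z - ell k z'|.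
    apply: small_seq => z' z'Z; have [->|zz'] := eqVneq z z'; first by exists 1.
    have e0 : 0 < `|ell k z - ell k z'| by rewrite normr_gt0 subr_eq0; exact: kP.
    exists (`|ell k z - ell k z'| / (4 * L)); first by rewrite divr_gt0 // mulr_gt0.
    move=> d /andP[dd]; rewrite ler_pdivlMr ?mulr_gt0 // => hd _.
    by have := mulr_gt0 L0 dd; lra.
  exists (Num.min (Num.min (2 - `|lsubmx z|) (2 - `|rsubmx z|)) (Num.min d1 (Num.min d2 d3))).
    by rewrite !lt_min !subr_gt0 zl zr d10 d20 d30.
  move=> d /andP[d0]; rewrite !le_min => /andP[/andP[l1 l2] /and3P[l3 l4 l5]]; split.
  - by split; lra.
  - by exists M => // y; apply: h1; rewrite d0.
  - by split=> // y hy; apply/ltW/(h2 d) => //; rewrite d0.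
  - by move=> z' z'Z; apply: h3 => //; rewrite d0.
have near (u v : 'rV[R]_N) : `|u - v| <= d -> ell k u <= ell k v + L * d /\ ell k v - L * d <= ell k u.
  move=> h; have := ell_le k u v; rewrite -/L; have : L * `|u - v| <= L * d by rewrite ler_pM2l.
  by rewrite ler_norml => ? /andP[? ?]; split; lra.
have sep (y z z' : 'rV[R]_N) : z \in Z -> z' \in Z -> `|y - z| <= d -> `|y - z'| <= d -> z = z'.
  move=> zZ z'Z /near[h1 h2] /near[h3 h4]; apply/eqP; apply: contraT => zz'.
  have [_ _ _ /(_ z' z'Z zz')] := dP z zZ.
  have : 0 < L * d by rewrite mulr_gt0.
  by rewrite lter_normr => ? /orP[]; lra.
pose A := [set y : 'rV[R]_N | `|y| <= 2] `&` [set y | forall z, z \in Z -> d <= `|y - z|].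
have clA : closed A.
  apply: closedI.
    have cn : continuous (fun z : 'rV[R]_N => `|z|) by cts.
    by apply: (@preimage_closed _ _ (fun z : 'rV[R]_N => `|z|) [set y | y <= 1 + 1]); [move=> x _; exact: cn|exact: closed_le].
  have -> : [set y | forall z, z \in Z -> d <= `|y - z|] =
      \bigcap_(z in [set z | z \in Z]) [set y | d <= `|y - z|].
    by apply/seteqP; split=> y h z; exact: h.
  apply: closed_bigI => z _; have cn : continuous (fun y : 'rV[R]_N => `|y - z|) by cts.
  by apply: (@preimage_closed _ _ (fun y : 'rV[R]_N => `|y - z|) [set y | d <= y]); [move=> x _; exact: cn|exact: closed_ge].
have [||y [_ hy]|mu mu0 hmu] := @closed_bounded_ge _ _ A (fun y => `|w y|) 2 clA.
- by move=> y [].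
- by cts.
- rewrite normr_gt0; apply/eqP => /ZE yZ; have := hy _ yZ.
  by rewrite subrr normr0 leNgt d0.
(* The bound extends beyond the cube: w only depends on the clamped coordinates, and a point of norm
   2 in one factor is not within d of any zero, since the balls lie in the cube. *)
have {}hmu (y : 'rV[R]_N) : (forall z, z \in Z -> d <= `|y - z|) -> mu <= `|w y|.
  move=> hy; pose y' : 'rV[R]_N := row_mx (clamp2 (lsubmx y)) (clamp2 (rsubmx y)).
  have -> : w y = w y' by rewrite /w G_clamp.
  apply: hmu; split=> [|z zZ] /=.
    apply: normv_le => // i; case: (split_ordP i) => j ->; rewrite ?row_mxEl ?row_mxEr;
      exact: le_trans (le_normv _ _) (norm_clamp2 _).
  have [[zl zr] _ _ _] := dP z zZ.
  have [hl|/ltW/clamp2_far hl] := lerP `|lsubmx y| 2; last first.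
    apply: le_trans (norm_lsubmx _); rewrite linearB /= row_mxKl.
    by have := lerB_dist (clamp2 (lsubmx y)) (lsubmx z); lra.
  have [hr|/ltW/clamp2_far hr] := lerP `|rsubmx y| 2; last first.
    apply: le_trans (norm_rsubmx _); rewrite linearB /= row_mxKr.
    by have := lerB_dist (clamp2 (rsubmx y)) (rsubmx z); lra.
  by rewrite /y' !clamp2_id // hsubmxK; exact: hy.
(* As b <= 2, [Kf e] is trivial wherever w has norm at least 2 e = mu, that is, outside of the
   balls. *)
pose e := mu / 2; have e0 : 0 < e by rewrite divr_gt0.
have e2 : 2 * e = mu by rewrite mulrC divfK ?pnatr_eq0.
pose P (x : S * T) := Kf e (w (xrow x)) (b (xrow x)).
have PE x : Kv e a (F x) = P x by rewrite GE.
have Psupp x : (forall z, z \in Z -> d <= `|xrow x - z|) -> P x = point.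
  move=> /hmu h; apply: Kf_far => //; apply: le_trans (le_normv_enorm _); apply: le_trans h.
  by rewrite -e2 mulrC ler_pM2r.
have cP : continuous P.
  by apply: cts_Kf => //; [apply: (@cts_comp _ _ _ (@xrow R m) w) => //|apply: (@cts_comp _ _ _ (@xrow R m) b) => //]; apply: cts_xrow; exact: cts_id.
have Pfar x : 2 <= `|x.1| \/ 2 <= `|x.2| -> P x = point.
  move=> hx; apply: Psupp => z zZ; have [[zl zr] _ _ _] := dP z zZ; case: hx => hx.
    apply: le_trans (norm_lsubmx _); rewrite linearB /= row_mxKl.
    by have := lerB_dist x.1 (lsubmx z); lra.
  apply: le_trans (norm_rsubmx _); rewrite linearB /= row_mxKr.
  by have := lerB_dist x.2 (rsubmx z); lra.
exists a, e; split=> //.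
  rewrite (funext PE); split=> //; exists 2; split=> [s t h|s s' t h h'].
    by apply: Pfar; right.
  by rewrite !Pfar //; left.
rewrite (acls_eq PE); apply: (@acls_localize _ _ _ (ell k) (1 + k%:R ^+ (m.+1).+1) d L (2 + 2) _ _ _ _ _ _ _ _ _ Z) => //.
- by apply: cts_ell; apply: cts_xrow; exact: cts_id.
- by rewrite lerDl exprn_ge0.
- by move=> s t c; exact: ell_shift.
- by move=> u v; exact: ell_le.
- exact: ball_multiple0.
- by move=> u v; exact: ball_multipleD.
- exact: undup_uniq.
- move=> z zZ; have [[zl zr] _ _ _] := dP z zZ.
  suff : `|z| <= 2 by have := normr_ge0 (lsubmx z); lra.
  apply: normv_le => // i; rewrite -[z]hsubmxK.
  by case: (split_ordP i) => j ->; rewrite ?row_mxEl ?row_mxEr; apply: le_trans (le_normv _ _) _; lra.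
- by move=> z z' zZ z'Z; have [_ _ _] := dP z zZ; apply.
move=> z zZ; have [_ [M uM wM] [bz hb] _] := dP z zZ.
apply: (regular_zero_class e0 d0 cb uM) => // h hd; rewrite e2.
(* The bound mu holds at distance d from z, where w is still given by M; homogeneity extends it to
   longer vectors. *)
pose h' := (d / `|h|) *: h; have h0 : 0 < `|h| by exact: lt_le_trans hd.
have nh' : `|h'| = d by rewrite normrZ ger0_norm ?divfK ?gt_eqF // divr_ge0 ?ltW.
have : mu <= `|w (z + h')|.
  apply: hmu => z' z'Z; rewrite leNgt; apply/negP => hz'.
  have zz' : z = z'.
    by apply: (@sep (z + h')) => //; [rewrite addrAC subrr add0r nh'|exact: ltW].
  by move: hz'; rewrite -zz' addrAC subrr add0r nh' ltxx.
rewrite wM; last by rewrite addrAC subrr add0r nh'.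
rewrite addrAC subrr add0r -scalemxAl normrZ ger0_norm; last by rewrite divr_ge0 ?ltW.
move=> /le_trans; apply; rewrite ler_piMl // ler_pdivrMr // mul1r //.
Qed.

End RegularApproximation.

Section TopCell.
Context (R : realType) (m : nat).
Local Notation S := 'rV[R]_m.+1.
Local Notation T := 'rV[R]_m.+2.
Local Notation N := (m.+1 + m.+2)%N.
Local Notation X := (sphere R m.+1 * sphere R m.+2)%type.

Definition chart_retract k (lam : R) (x : sphere R k.+1) : sphere R k.+1 := collapse (zeta lam x).

Lemma chart_retractE k (lam : R) (x : sphere R k.+1) : 1 <= lam ->
  chart_retract lam x = if headv x <= 0 then collapse (lam *: tailv x) else point.
Proof.
move=> l1; rewrite /chart_retract /zeta; case: ifP => // _.
by apply: collapse_far; rewrite normv_const; lra.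
Qed.

Lemma cts_chart_retract k (lam : R) : (k.+1 <= m.+2)%N -> (m.+2)%:R <= lam ->
  continuous (@chart_retract k lam).
Proof.
move=> km lm; have l1 : 1 <= lam by apply: le_trans lm; rewrite ler1n.
apply: (@cts_eq _ _ _ (fun x : sphere R k.+1 =>
    if headv x <= 0 then collapse (lam *: tailv x) else point)).
  by move=> x; exact: chart_retractE.
apply: cts_if; [by apply: cts_headv; exact: cts_id| |exact: cts_cst|].
  by apply: cts_collapse; apply: cts_scalev; [exact: cts_cst|apply: cts_tailv; exact: cts_id].
move=> x x0; apply: collapse_far; apply: (equator_far km) => //.
by rewrite mulr1.
Qed.

Lemma chart_retract_pt k (lam : R) : 1 <= lam -> @chart_retract k lam point = point.
Proof. by move=> l1; rewrite chart_retractE // headv_pt leNgt ltr01. Qed.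

Lemma chart_retract_antipode k (lam : R) (x : sphere R k.+1) : 1 <= lam ->
  svec (chart_retract lam x) + svec x != 0.
Proof.
move=> l1; apply/eqP => /headv_add_tail[]; rewrite chart_retractE //.
case: ifP => [hx|/negbT]; last by rewrite -ltNge headv_pt => h1 h2 _; lra.
rewrite tailv_collapse scalerA; set c := _ * lam => hh /eqP.
rewrite -addr_eq0 -{2}[tailv x]scale1r -scalerDl => h; have c0 : 0 <= c by rewrite !mulr_ge0 ?sqrtr_ge0 //; lra.
move: h; rewrite scaler_eq0 gt_eqF /=; last lra.
move=> /eqP t0; move: hh; rewrite t0 scaler0 headv_collapse.
have -> : sqnorm (0 : 'rV[R]_k.+1) = 0 by apply/eqP; rewrite sqnorm_eq0.
by rewrite [Num.min _ _](min_idPr _) //; lra.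
Qed.

(** The chart followed by [collapse] never takes a point of the sphere to its antipode, so it is
    homotopic to the identity on both factors. *)
Lemma Phicls_collapse (Y : ptopologicalType) (c : pointed_map X Y) :
  hclass R c = Phicls (fun x : S * T => c (collapse x.1, collapse x.2)).
Proof.
have cc := @pmap_cts _ _ c; pose lam : R := (m.+2)%:R.
have l1 : 1 <= lam by rewrite ler1n.
have wb : wbounded_by 1 (fun x : S * T => c (collapse x.1, collapse x.2)).
  split=> [s t t' h h'|s s' t h h'|s t h h'] /=; rewrite (collapse_far h) (collapse_far h') //.
  exact: (@pmap_pt _ _ c).
rewrite (@PhiclsE _ _ _ lam 1) //; [|by cts|by rewrite mulr1].
rewrite -mkp_pmap; apply/esym; apply: (mkp_homot (H := fun ax : R * X =>
  c (shom ax.1 (chart_retract lam ax.2.1) ax.2.1, shom ax.1 (chart_retract lam ax.2.2) ax.2.2))).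
- have ce k : (k.+1 <= m.+2)%N -> continuous (@chart_retract k lam).
    by move=> km; exact: cts_chart_retract.
  have c1 := ce m (leqnSn _); have c2 := ce m.+1 (leqnn _).
  apply: (@cts_comp _ _ _ (fun ax : R * X => (shom ax.1 (chart_retract lam ax.2.1) ax.2.1,
     shom ax.1 (chart_retract lam ax.2.2) ax.2.2)) c) => //.
  apply: cts_pair; apply: cts_shom; try by [cts|move=> z; exact: chart_retract_antipode].
- by move=> a /=; rewrite !chart_retract_pt // !shom_same; exact: (@pmap_pt _ _ c).
- by move=> x; rewrite /= !shom0.
- by move=> x; rewrite /= !shom1; case: x.
Qed.

(** The map c need not be trivial on S^p x pt, but after a piecewise affine approximation its
    composition with [Kv] for a generic direction is, because a zero at infinity would not be
    isolated. This is how c enters A(S^{p+n}), where the zeros can be added up. *)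
Lemma top_cell_class (c : pointed_map X (sphere R N)) :
  exists2 a : aclasses R m (sphere R N), ball_multiple a &
    forall (Y : ptopologicalType) (g : pointed_map (sphere R N) Y),
      hclass R (pointed_comp g c) = phi (push g a).
Proof.
pose C (x : S * T) := svec (c (collapse x.1, collapse x.2)).
have cc := @pmap_cts _ _ c; have cC : continuous C by rewrite /C; cts.
have C1 x : enorm (C x) = 1 by exact: enorm_svec.
have Cs s s' t : 1 <= `|s| -> 1 <= `|s'| -> C (s, t) = C (s', t).
  by move=> h h'; rewrite /C /= !(collapse_far h, collapse_far h').
have Ct s t t' : 1 <= `|t| -> 1 <= `|t'| -> C (s, t) = C (s, t').
  by move=> h h'; rewrite /C /= !(collapse_far h, collapse_far h').
have Cp s t : 1 <= `|s| -> 1 <= `|t| -> C (s, t) 0 0 = 1.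
  move=> h h'; rewrite /C /= (collapse_far h) (collapse_far h') (@pmap_pt _ _ c : c (point, point) = point).
  exact: headv_pt.
(* A unit vector of R^(N+1) has maximum norm at least 1 / (N + 1) = 2 e, so the segment from C to an
   e-approximation avoids 0. As e <= 1/2, the first coordinate stays positive where both variables
   are at infinity, and [Kv] gives the base point there. *)
pose e : R := (2 * (N.+1)%:R)^-1.
have n0 : 0 < (N.+1)%:R :> R by rewrite ltr0n.
have e0 : 0 < e by rewrite invr_gt0 mulr_gt0.
have en : e * (N.+1)%:R = 1 / 2 by rewrite /e invfM mulfVK ?gt_eqF // mul1r.
have e1 : e <= 1 / 2.
  by rewrite -en ler_peMr ?(ltW e0) // ler1n.
have nC x : 2 * e <= `|C x|.
  have := le_enorm_normv (C x); rewrite C1 => h.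
  rewrite -(ler_pM2r n0) -mulrA en; lra.
have Cn x : `|C x| <= 1 by rewrite -(C1 x) le_normv_enorm.
have [F [cF FC Fs Ft pF]] := pa_approx cC Cn Cs Ct e0.
have F00 x : C x 0 0 - e <= F x 0 0 <= C x 0 0 + e.
  have := le_trans (le_normv (F x - C x) 0) (FC x); rewrite !mxE ler_norml; lra.
have C00 x : -1 <= C x 0 0 <= 1.
  by rewrite -ler_norml; apply: le_trans (le_normv _ _) _; rewrite -(C1 x) le_normv_enorm.
have seg x (a : R) : 0 <= a <= 1 -> (1 - a) *: C x + a *: F x != 0.
  move=> /andP[a0 a1]; rewrite -normr_gt0.
  have -> : (1 - a) *: C x + a *: F x = C x + a *: (F x - C x).
    by apply/rowP => i; rewrite !mxE; ring.
  have : `|a *: (F x - C x)| <= e.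
    rewrite normrZ ger0_norm //; apply: le_trans (FC x); rewrite ler_piMl //.
  have := lerB_dist (C x) (- (a *: (F x - C x))); rewrite opprK normrN; have := nC x; lra.
have F0 x : F x != 0 by have := seg x 1; rewrite subrr scale0r add0r scale1r lexx ler01 => /(_ isT).
have F2 x : - 2 <= F x 0 0 by have /andP[? _] := F00 x; have /andP[? _] := C00 x; lra.
have [a [d [d0 aP mP]]] := regular_value_class cF F0 F2 Fs Ft pF.
exists (acls (fun x => Kv d a (F x))) => // Y g.
rewrite pushE // phiE; last exact: is_amap_comp.
have -> : hclass R (pointed_comp g c) =
    hclass R (pointed_comp (pointed_comp g (Kmap a d0)) c).
  apply/hclassP; apply: homotopic_comp; last exact: homotopic_refl.
  apply: homotopic_sym.
  have -> : g = pointed_comp g (pointed_id _) by case: g => gf gc gp; congr PMap.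
  by apply: homotopic_comp; [exact: homotopic_refl|exact: Kmap_homot].
rewrite Phicls_collapse.
have cg := @pmap_cts _ _ g.
apply: (@Phicls_homot _ _ _ (fun ax : R * (S * T) =>
  g (Kv d a ((1 - clamp ax.1) *: C ax.2 + clamp ax.1 *: F ax.2))) 2).
- apply: (@cts_comp _ _ _ (fun ax : R * (S * T) => Kv d a ((1 - clamp ax.1) *: C ax.2 + clamp ax.1 *: F ax.2)) g) => //.
  apply: cts_Kv => //; [exact: cts_cst|by cts|].
  by move=> [b x] /=; apply: seg; exact: clamp_itv.
- move=> b _; have b01 := clamp_itv b; split=> [s t t' h h'|s s' t h h'|s t h h'] /=.
  + by rewrite (Ct s t t') ?(Ft s t t' h h') //; lra.
  + by rewrite (Cs s s' t) ?(Fs s s' t h h') //; lra.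
  rewrite [Kv _ _ _](_ : _ = point) ?pmap_pt //; apply: Kf_pt => //.
    rewrite !mxE (Cp s t); [|lra|lra]; have /andP[] := F00 (s, t).
    rewrite (Cp s t); [|lra|lra]; move: b01 => /andP[b0 b1] h1 h2; nra.
  by apply: Kv_neq0; exact: seg.
- by move=> x /=; rewrite clamp_id ?lexx ?ler01 // subr0 scale1r scale0r addr0.
- by move=> x /=; rewrite clamp_id ?lexx ?ler01 // subrr scale0r scale1r add0r.
Qed.

End TopCell.

Lemma hclass_eq (R : realType) (X Y : ptopologicalType) (f g : pointed_map X Y) :
  f =1 g -> hclass R f = hclass R g.
Proof.
move=> fg; have cf := @pmap_cts _ _ f; apply: (@hclass_homot R _ _ f g (fun ax => f ax.2)) => //.
  by cts.
by move=> a; exact: (@pmap_pt _ _ f).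
Qed.

(** Sums of maps on a sphere commute with composition on the target side, so the multiple q is moved
    to a self-map g of the source; [top_cell_class] can then be applied to g after c. *)
Lemma hmulz_comp (R : realType) k (Y : ptopologicalType) (j : pointed_map (sphere R k) Y) (q : int) :
  exists g : pointed_map (sphere R k) (sphere R k),
    hmulz q (hclass R j) = hclass R (pointed_comp j g).
Proof.
have hn n : exists g : pointed_map (sphere R k) (sphere R k),
    hmuln n (hclass R j) = hclass R (pointed_comp j g).
  elim: n => [|n [g IH]].
    exists (pointed_const _ _); apply: hclass_eq => x; exact: esym (@pmap_pt _ _ j).
  exists (padd (pointed_id _) g); rewrite /hmuln iterS -/(hmuln n _) IH haddE.
  by apply: hclass_eq => x; rewrite /= /padd_fun; case: ifP.
case: q => n; first exact: hn.
have [g e] := hn n.+1; exists (pointed_comp g (preflect R k)).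
by rewrite /hmulz e /hopp hcompE; exact: hclass_eq.
Qed.

Section Divisibility.
Context (R : realType) (m : nat).
Local Notation N := (m.+1 + m.+2)%N.

Lemma finite_degree_Dh (Y : ptopologicalType) (l : pointed_map (sphere R m.+2) Y)
    (V : zmodType) (f : hclasses R (sphere R m.+1 * sphere R m.+2)%type Y -> V) (z : int) :
  finite_degree f -> rational_space R Y ->
  f (phi (Dh (acls (fibre l)) (hclass R l) *~ z)) = f (phi 0).
Proof.
move=> ff [_ rY]; apply: (finite_degree_phi (al := acls (fibre l)) ff) => k.
have [b' b'P] : exists b' : hgroup R m.+2 Y, hmuln k.+1 b' = hclass R l.
  by have [d _ dK] := rY m.+2 k.+1 isT isT; exists (d (hclass R l)).
have e := phi_Dh (acls (fibre l)) z b'P.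
by rewrite addrC e add0r.
Qed.

End Divisibility.

Theorem mainTheorem6 (R : realType) (n : nat) (n_gt0 : (0 < n)%N)
    (n_even : ~~ odd n)
    (mu : schain R (sphere R n.-1 * sphere R n)%type (n + n).-1)
    (nu : schain R (sphere R (n + n).-1) (n + n).-1)
    (mu_fundamental : fundamental_cycle mu)
    (nu_fundamental : fundamental_cycle nu)
    (c : pointed_map (sphere R n.-1 * sphere R n)%type (sphere R (n + n).-1))
    (c_degree : has_degree mu nu c 1)
    (SnQ : ptopologicalType) (l : pointed_map (sphere R n) SnQ)
    (l_rationalization : rationalization R l)
    (V : zmodType)
    (f : hclasses R (sphere R n.-1 * sphere R n)%type SnQ -> V)
    (f_finite : finite_degree f) (q : int) :
  f (ubar_class n_gt0 c l q) = f (ubar_class n_gt0 c l 0).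
Proof.
clear mu nu mu_fundamental nu_fundamental c_degree.
(* The case n = 1 is excluded by parity; n = m + 2 gives the charts R^(m+1) and R^(m+2). *)
case: n n_gt0 n_even c l l_rationalization f f_finite => [|[|m]] // n0 _ c l [rS _] f ff.
suff h z : f (ubar_class n0 c l z) = f (phi 0) by rewrite !h.
pose j := whitehead n0 n0 (pointed_id (sphere R m.+2)) (pointed_id (sphere R m.+2)).
have [g gE] := hmulz_comp j z.
have -> : ubar_class n0 c l z = hclass R (pointed_comp (pointed_comp l j) (pointed_comp g c)).
  rewrite /ubar_class /u_class /whitehead_square hwhiteheadE -/j gE (hcompE R (pointed_comp j g) c) hcompE.
  exact: hclass_eq.
have [a [k ->] aE] := @top_cell_class R m (pointed_comp g c).
rewrite aE pushMz (@push_ball1 R m SnQ l (pointed_comp l j) n0 n0) //.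
exact: finite_degree_Dh.
Qed.
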